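(* Let $\Delta$ be a locally finite thick Euclidean building, $(W,S)$ the associated irreducible spherical Coxeter system, $I \subsetneq S$, and $\gamma \in \mathrm{Aut}(\Delta)$ a type-preserving, strongly $I$-regular hyperbolic element. Denote by $\sigma_+,\sigma_-$ the minimal ideal simplices containing the attracting, respectively repelling, endpoint of $\gamma$ in their interior. Let $\mathcal{R}_{-}$ be the residue corresponding to $\sigma_-$, i.e. the set of all chambers of $\partial_\infty\Delta$ having $\sigma_-$ as a face. Let $\xi \in \partial_\infty \Delta \setminus \partial_\infty \mathrm{Min}(\gamma)$, let $\beta$ be the minimal ideal simplex containing $\xi$ in its interior, let $J$ be its type, and let $\mathcal{S}$ be the $J$-residue corresponding to $\beta$, i.e. the set of all chambers of $\partial_\infty\Delta$ having $\beta$ as a face. Assume that $\mathrm{proj}_{\mathcal{R}_{-}}(\mathcal{S}) \cap \partial_\infty \mathrm{Min}(\gamma)$ contains at least one ideal chamber, i.e. some chamber in $\mathrm{proj}_{\mathcal{R}_{-}}(\mathcal{S})$ is contained in $\partial_\infty \mathrm{Min}(\gamma)$. Then the limit $\lim_{n\to \infty} \gamma^{n}(\xi)$ exists in the cone topology on $\partial_\infty\Delta$, and it coincides with $\rho_{\mathcal{A}',c_-}(\xi)$ for any chamber $c_- \in \mathrm{proj}_{\mathcal{R}_{-}}(\mathcal{S})$ with $c_-\subset \partial_\infty \mathrm{Min}(\gamma)$ and any apartment $\mathcal{A}'$ of $\Delta$ with $c_-, \sigma_+ \subset \partial_\infty \mathcal{A}'$.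
   Context: Buildings are irreducible, of dimension $\geq 1$, with their complete system of apartments. The visual boundary $\partial_\infty \Delta$ is a spherical building with finite Coxeter system $(W,S)$, whose apartments are the boundaries of the apartments of $\Delta$. Simplices are open (without their proper faces). An automorphism is type-preserving if it preserves the coloring of the vertices of the chambers of $\Delta$. Types: fix a model chamber $c_+$ of $\partial_\infty \Delta$ and identify $S$ with the walls through its panels. A face of $c_+$ has as type the set of walls in $S$ containing it (chambers have type $\emptyset$); an arbitrary ideal simplex has the type of the corresponding face of the model chamber. ''Two opposite ideal simplices of type $I$'' is meant with respect to the walls of the affine building: two opposite simplices lie in exactly the same walls of any ideal apartment containing both, and one of the two has type $I$ in the sense that the face of the model chamber $c_+$ corresponding to it is contained in exactly those walls of $S$ that belong to $I$ (the other may have a different type with respect to $(W,S)$). For a hyperbolic automorphism $\gamma$, $|\gamma|=\inf_{x} d(x,\gamma(x))$ and $\mathrm{Min}(\gamma)=\{x : d(x,\gamma(x))=|\gamma|\}$; $\partial_\infty\mathrm{Min}(\gamma)\subset\partial_\infty\Delta$ is the set of endpoints of geodesic rays contained in $\mathrm{Min}(\gamma)$. With $n=\dim\Delta$, $\gamma$ is strongly $I$-regular hyperbolic if $\mathrm{Min}(\gamma)$ contains a flat of dimension $n-|I|$ and the two endpoints of some (hence every) translation axis of $\gamma$ lie in the interior of two opposite ideal simplices of type $I$. The attracting (repelling) endpoint of $\gamma$ is the limit of $\gamma^k(x)$ as $k\to+\infty$ ($k\to-\infty$), $x\in\Delta$. Projections: for a residue $\mathcal{R}$ and a chamber $c$ in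 $\partial_\infty\Delta$, $\mathrm{proj}_{\mathcal{R}}(c)$ is the unique chamber of $\mathcal{R}$ at minimal gallery distance from $c$, and for a residue $\mathcal{S}$, $\mathrm{proj}_{\mathcal{R}}(\mathcal{S})=\{\mathrm{proj}_{\mathcal{R}}(c) : c\in\mathcal{S}\}$. $\rho_{\mathcal{A}',c_-}$ denotes the retraction onto the apartment $\mathcal{A}'$ centered at the ideal chamber $c_-$ of $\partial_\infty \mathcal{A}'$; on $\partial_\infty\Delta$ it is the retraction of the spherical building $\partial_\infty\Delta$ onto $\partial_\infty\mathcal{A}'$ centered at $c_-$. The cone topology is the usual one on $\Delta\cup\partial_\infty\Delta$ for the $\mathrm{CAT}(0)$ space $\Delta$. *)

(* Defs.v *)
From HB Require Import structures.
From mathcomp Require Import all_boot all_order all_algebra.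
From mathcomp Require Import all_classical all_reals all_analysis.

Set Implicit Arguments.
Unset Strict Implicit.
Unset Printing Implicit Defensive.

Import Order.TTheory GRing.Theory Num.Theory.

Local Open Scope classical_set_scope.
Local Open Scope ring_scope.

(* 'rV[R]_n carries the sup norm in the library, hence a separate Euclidean
   norm. *)
Definition dot (R : realType) (n : nat) (u v : 'rV[R]_n) : R :=
  (u *m v^T) 0 0.

Definition enorm (R : realType) (n : nat) (v : 'rV[R]_n) : R :=
  Num.sqrt (dot v v).

Section CoxeterComplex.
Context {R : realType} {n : nat}.
Notation E := ('rV[R]_n).
Implicit Types (u v x y : E) (c : R) (H : set E) (M : set (set E)).

Definition hyperplane u c : set E := [set x | dot u x = c].

Definition reflection u c : E -> E :=
  fun x => x - (2 * (dot u x - c) / dot u u) *: u.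

(* The set of walls of an infinite essential discrete reflection group. *)
Definition affine_arrangement M : Prop :=
  [/\ forall H, M H -> exists u c, u != 0 /\ H = hyperplane u c,
      forall x, exists2 e : R, 0 < e &
        finite_set [set H | M H /\ exists2 y, H y & enorm (y - x) < e],
      forall u c H, u != 0 -> M (hyperplane u c) -> M H ->
        M (reflection u c @` H),
      forall v, (forall u c, M (hyperplane u c) -> dot u v = 0) -> v = 0
    & ~ exists x, forall H, M H -> H x].

Inductive reflection_group M : (E -> E) -> Prop :=
| reflection_group_id : reflection_group M idfun
| reflection_group_comp u c (w : E -> E) :
    u != 0 -> M (hyperplane u c) -> reflection_group M w ->
    reflection_group M (reflection u c \o w).

(* [y] lies in the closure of the open cell of [x]: every closed half-space
   bounded by a wall and containing [x] contains [y] (replacing [u, c] by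
   [-u, -c] gives the other half-space of the same wall). *)
Definition in_closed_cell M x y : Prop :=
  forall u c, M (hyperplane u c) -> dot u x <= c -> dot u y <= c.

Definition cell M x : set E :=
  [set y | in_closed_cell M x y /\ in_closed_cell M y x].

Definition in_chamber M x : Prop := forall H, M H -> ~ H x.

Definition in_panel M x : Prop := exists! H, M H /\ H x.

Definition linear_walls M : set (set E) :=
  [set H | exists u c,
     [/\ u != 0, M (hyperplane u c) & H = hyperplane u 0]].

Definition chamber_walls M x : set (set E) :=
  [set H | M H /\ exists p, [/\ in_panel M p, in_closed_cell M x p & H p]].

Definition orthogonal_walls (H H' : set E) : Prop :=
  forall u c u' c', u != 0 -> u' != 0 ->
    H = hyperplane u c -> H' = hyperplane u' c' -> dot u u' = 0.

(* Connectedness of the Coxeter diagram whose nodes are the walls in [S]: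
   distinct walls of a chamber are not joined iff their reflections commute,
   i.e. iff they are orthogonal. *)
Definition irreducible_system (S : set (set E)) : Prop :=
  forall S1 S2, S1 !=set0 -> S2 !=set0 -> S = S1 `|` S2 -> S1 `&` S2 = set0 ->
    exists H1 H2, [/\ S1 H1, S2 H2 & ~ orthogonal_walls H1 H2].

End CoxeterComplex.

Definition euclidean_isometry (R : realType) (m : nat) (X : metricType R)
    (f : 'rV[R]_m -> X) : Prop :=
  forall x y, mdist (f x) (f y) = enorm (x - y).

Section Boundary.
Context {R : realType} {X : metricType R}.
Implicit Types (c : R -> X) (Y : set X).

(* Rays are functions on R of which only the restriction to [0, +oo) matters. *)
Definition ray c : Prop :=
  forall s t, 0 <= s -> 0 <= t -> mdist (c s) (c t) = `|s - t|.

Definition asymptotic c c' : Prop :=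
  exists K : R, forall t, 0 <= t -> mdist (c t) (c' t) <= K.

End Boundary.

Record ideal_point (R : realType) (X : metricType R) := IdealPoint {
  ideal_class : set (R -> X);
  ideal_classP : exists2 c : R -> X, ray c &
    ideal_class = [set c' | ray c' /\ asymptotic c c'] }.

Arguments ideal_point {R} X.

Definition boundary (R : realType) (X : metricType R) (Y : set X) :
    set (ideal_point X) :=
  [set xi | exists2 c, ideal_class xi c & forall t, 0 <= t -> Y (c t)].

Definition isometric (R : realType) (X : metricType R) (f : X -> X) : Prop :=
  forall x y, mdist (f x) (f y) = mdist x y.

Section Pushforward.
Context {R : realType} {X : metricType R}.

Lemma asymptotic_trans (c c' c'' : R -> X) :
  asymptotic c c' -> asymptotic c' c'' -> asymptotic c c''.
Proof.
move=> [K cK] [K' cK']; exists (K + K') => t t0.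
by rewrite (le_trans (metric_triangle _ (c' t) _))// lerD ?cK ?cK'.
Qed.

Lemma ideal_map_subproof (f : X -> X) (fI : isometric f) (xi : ideal_point X) :
  exists2 c : R -> X, ray c &
    [set c' | ray c' /\ exists2 c, ideal_class xi c & asymptotic (f \o c) c'] =
    [set c' | ray c' /\ asymptotic c c'].
Proof.
have fA c c' : asymptotic c c' -> asymptotic (f \o c) (f \o c').
  by move=> [K cK]; exists K => t t0 /=; rewrite fI cK.
have [c rc xic] := ideal_classP xi; exists (f \o c).
  by move=> s t s0 t0 /=; rewrite fI rc.
rewrite xic; apply/seteqP; split => c' /= [rc'].
  move=> [d [_ cd] dc']; split => //.
  exact: asymptotic_trans (fA _ _ cd) dc'.
move=> cc'; split => //; exists c => //; split => //.
by exists 0 => t _; rewrite mdistxx.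
Qed.

Definition ideal_map (f : X -> X) (fI : isometric f) (xi : ideal_point X) :
    ideal_point X :=
  IdealPoint (ideal_map_subproof fI xi).

End Pushforward.

Variant bordification (R : realType) (X : metricType R) :=
| Interior of X
| Ideal of ideal_point X.

Arguments bordification {R} X.
Arguments Interior {R X}.
Arguments Ideal {R X}.

Section ConeTopology.
Context {R : realType} {X : metricType R}.

(* The set U(c, r, e) of Bridson-Haefliger II.8.6: points whose radial
   projection to the ball of radius [r] centered at [c 0] is at distance less
   than [e] from [c r]. *)
Definition cone_nbhs (c : R -> X) (r e : R) : set (bordification X) :=
  [set z | match z with
   | Interior x => r < mdist x (c 0) /\
       exists y, [/\ mdist (c 0) y = r, mdist y x = mdist (c 0) x - r
                   & mdist y (c r) < e]
   | Ideal xi => exists c', [/\ ideal_class xi c', c' 0 = c 0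
                            & mdist (c' r) (c r) < e]
   end].

Definition cone_subbase : set (set (bordification X)) :=
  [set U | (exists x (e : R), 0 < e /\
              U = [set z | exists2 y, mdist x y < e & z = Interior y]) \/
           (exists c r e, [/\ ray c, 0 < r, 0 < e & U = cone_nbhs c r e])].

HB.instance Definition _ := gen_eqMixin (bordification X).
HB.instance Definition _ := gen_choiceMixin (bordification X).
HB.instance Definition _ :=
  isSubBaseTopological.Build (bordification X) cone_subbase id.

End ConeTopology.

HB.instance Definition _ (R : realType) (X : metricType R) :=
  gen_eqMixin (ideal_point X).
HB.instance Definition _ (R : realType) (X : metricType R) :=
  gen_choiceMixin (ideal_point X).

(* Convergence of ideal points for the topology induced on the boundary. *)
Definition ideal_cvg (R : realType) (X : metricType R)
    (u : nat -> ideal_point X) (eta : ideal_point X) : Prop :=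
  (fun k => Ideal (u k)) @ \oo --> Ideal eta.

Section Building.
Context {R : realType} {n : nat} {X : metricType R}.
Notation E := ('rV[R]_n).
Variables (M : set (set E)) (A : set (E -> X)).
Implicit Types (f g : E -> X).

(* The metric realization of a building whose apartments are copies of the
   Euclidean Coxeter complex of [M].  The elements of [A] are the type-preserving
   isomorphisms from this complex onto the apartments; the simplices are the
   images of the open cells.  The last two clauses say that any two simplices
   lie in a common apartment, and that two apartments containing two given
   simplices are isomorphic by a map fixing these simplices pointwise. *)
Definition building_atlas (A : set (E -> X)) : Prop :=
  [/\ forall p, exists2 f, A f & range f p,
      forall f, A f -> euclidean_isometry f,
      forall f w, A f -> reflection_group M w -> A (f \o w),
      forall f g x y, A f -> A g -> exists h x' y',
        [/\ A h, h @` cell M x' = f @` cell M x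
               & h @` cell M y' = g @` cell M y]
    & forall f g x y x' y', A f -> A g ->
        f @` cell M x = g @` cell M x' -> f @` cell M y = g @` cell M y' ->
        exists2 w, reflection_group M w &
          forall z, (cell M x `|` cell M y) z -> f z = g (w z)].

(* Since any larger atlas has the same simplices and the same coloring of the
   vertices, this is the maximality of the system of apartments. *)
Definition complete_atlas : Prop :=
  forall A' : set (E -> X), building_atlas A' -> A `<=` A' -> A' `<=` A.

Definition apartment (a : set X) : Prop := exists2 f, A f & a = range f.

Definition simplex (s : set X) : Prop := exists f x, A f /\ s = f @` cell M x.

Definition chamber (s : set X) : Prop :=
  exists f x, [/\ A f, in_chamber M x & s = f @` cell M x].

Definition panel (s : set X) : Prop :=
  exists f x, [/\ A f, in_panel M x & s = f @` cell M x].

Definition face (s t : set X) : Prop :=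
  exists f x y, [/\ A f, in_closed_cell M y x, s = f @` cell M x
                  & t = f @` cell M y].

Definition vertex (p : X) : Prop := simplex [set p].

(* Colors of vertices are orbits of the affine Weyl group in the model. *)
Definition same_color (p q : X) : Prop :=
  exists f g x, [/\ A f, A g, f x = p & g x = q].

Definition thick : Prop :=
  forall p, panel p -> exists c1 c2 c3,
    [/\ [/\ chamber c1, chamber c2 & chamber c3],
        [/\ face p c1, face p c2 & face p c3]
      & [/\ c1 <> c2, c1 <> c3 & c2 <> c3]].

Definition locally_finite_building : Prop :=
  forall p : X, finite_set [set s | exists t, t p /\ face t s].

Definition euclidean_building : Prop :=
  [/\ affine_arrangement M, building_atlas A & complete_atlas].

Record automorphism := Automorphism {
  aut :> X -> X;
  aut_inv : X -> X;
  autK : cancel aut aut_inv;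
  aut_invK : cancel aut_inv aut;
  aut_isometric : isometric aut;
  aut_simplex : forall s, simplex s -> simplex (aut @` s) }.

Definition type_preserving (gamma : automorphism) : Prop :=
  forall p, vertex p -> same_color p (gamma p).

Definition aut_boundary (gamma : automorphism) :
    ideal_point X -> ideal_point X :=
  ideal_map (aut_isometric gamma).

Notation L := (linear_walls M).
Implicit Types (b c d : set (ideal_point X)).

Definition chart_end f (v : E) (xi : ideal_point X) : Prop :=
  enorm v = 1 /\ ideal_class xi (fun t => f (t *: v)).

(* The boundary of the image under [f] of the open conical cell of [v]; it is
   empty for [v = 0], which plays the role of the empty simplex. *)
Definition ideal_cell f (v : E) : set (ideal_point X) :=
  [set xi | exists2 w, cell L v w & chart_end f w xi].

Definition ideal_simplex b : Prop :=
  exists f v, [/\ A f, v != 0 & b = ideal_cell f v].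

Definition ideal_chamber c : Prop :=
  exists f v, [/\ A f, in_chamber L v & c = ideal_cell f v].

Definition ideal_panel b : Prop :=
  exists f v, [/\ A f, in_panel L v & b = ideal_cell f v].

Definition ideal_face b c : Prop :=
  exists f v w, [/\ A f, in_closed_cell L w v, b = ideal_cell f v
                  & c = ideal_cell f w].

Definition opposite b c : Prop :=
  exists f v, [/\ A f, v != 0, b = ideal_cell f v & c = ideal_cell f (- v)].

(* The model chamber is the conical chamber of [v0] in the model space, which
   the charts identify, type-preservingly, with the chambers at infinity. *)
Definition has_type (v0 : E) (I : set (set E)) b : Prop :=
  exists f v, [/\ A f, v != 0, in_closed_cell L v0 v,
                  [set H | chamber_walls L v0 H /\ H v] = I
                & b = ideal_cell f v].

Definition residue b : set (set (ideal_point X)) :=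
  [set c | ideal_chamber c /\ ideal_face b c].

Definition adjacent c d : Prop :=
  exists p, [/\ ideal_panel p, ideal_chamber c, ideal_chamber d,
                ideal_face p c & ideal_face p d].

Definition gallery (k : nat) c d : Prop :=
  exists p : nat -> set (ideal_point X),
    [/\ p 0%N = c, p k = d & forall i, (i < k)%N -> adjacent (p i) (p i.+1)].

Definition gallery_distance c d (k : nat) : Prop :=
  gallery k c d /\ forall m, gallery m c d -> (k <= m)%N.

Definition is_projection (Q : set (set (ideal_point X))) c d : Prop :=
  Q d /\ exists2 k, gallery_distance c d k &
    forall d' k', Q d' -> gallery_distance c d' k' -> d' <> d -> (k < k')%N.

Definition projection (Q T : set (set (ideal_point X))) :
    set (set (ideal_point X)) :=
  [set d | exists2 c, T c & is_projection Q c d].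

(* The retraction onto [boundary a] centered at the chamber [c]: on the
   boundary of an apartment [range f] whose boundary contains [c], it is the
   isomorphism onto the boundary of [a = range g] fixing [c] pointwise.  The
   first argument of [xget] is an irrelevant default value. *)
Definition retraction (a : set X) c (xi : ideal_point X) : ideal_point X :=
  xget xi [set eta | exists f g v u,
    [/\ [/\ A f, A g & a = range g],
        in_chamber L v,
        c = ideal_cell f v,
        forall w zeta, cell L v w -> (chart_end f w zeta <-> chart_end g w zeta)
      & chart_end f u xi /\ chart_end g u eta]].

Definition translation_length (gamma : X -> X) : R :=
  inf (range (fun x => mdist x (gamma x))).

Definition Min (gamma : X -> X) : set X :=
  [set x | mdist x (gamma x) = translation_length gamma].

Definition hyperbolic (gamma : X -> X) : Prop :=
  0 < translation_length gamma /\ Min gamma !=set0.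

Definition translation_axis (gamma : X -> X) (l : R -> X) : Prop :=
  (forall s t, mdist (l s) (l t) = `|s - t|) /\
  forall t, gamma (l t) = l (t + translation_length gamma).

Definition contains_flat (m : nat) (Y : set X) : Prop :=
  exists2 F : 'rV[R]_m -> X, euclidean_isometry F & range F `<=` Y.

Definition strongly_regular (v0 : E) (I : set (set E)) (gamma : X -> X) :
    Prop :=
  [/\ hyperbolic gamma,
      exists2 m, (I #= `I_m)%card & contains_flat (n - m) (Min gamma)
    & exists l bp bm,
      [/\ translation_axis gamma l, opposite bp bm,
          has_type v0 I bp \/ has_type v0 I bm,
          exists2 xi, bp xi & ideal_class xi l
        & exists2 xi, bm xi & ideal_class xi (fun t => l (- t))]].

Definition attracting (gamma : automorphism) (xi : ideal_point X) : Prop :=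
  forall x : X, (fun k => Interior (iter k (aut gamma) x)) @ \oo --> Ideal xi.

Definition repelling (gamma : automorphism) (xi : ideal_point X) : Prop :=
  forall x : X, (fun k => Interior (iter k (aut_inv gamma) x)) @ \oo --> Ideal xi.

End Building.

(* Main.v *)
(* Charts of the building are isometric embeddings of the Coxeter complex.  Let
   [c_-] be a projection of a chamber containing [xi], let [f] be a chart
   containing [c_-] and [xi] at infinity and [g] one containing [c_-] and
   [sigma_+]; after composition with an element of the Weyl group they agree on
   a sector towards [c_-].  Write [s], [-s] for the directions of the repelling
   and attracting points in [g], and [u] for that of [xi] in [f].

   Since [c_-] lies in the boundary of [Min gamma], this sector contains a point
   of [Min gamma], and [gamma] fixes [c_-] pointwise at infinity; hence
   [gamma ^ n] acts on the sector as the translation by [- n |gamma| s].  The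
   projection property means that no wall through [sigma_-] separates [c_-]
   from [xi], so the directions [n |gamma| s + t u], [t <= T], point into the
   sector for [n] large.  Therefore the images under [gamma ^ n] of suitable
   rays of [f] towards [xi] coincide on [0, T] with a fixed ray of [g] of
   direction [u], whose end point is the image of [xi] under the retraction;
   in a CAT(0) space this determines the limit in the cone topology.

   Charts through two chambers at infinity come from a maximality argument on
   the retracted direction and from the completeness of the atlas, which allows
   one to extend partial charts. *)
Require Import Defs.
From HB Require Import structures.
From mathcomp Require Import all_boot all_order all_algebra.
From mathcomp Require Import all_classical all_reals all_analysis.
From mathcomp Require Import ring lra.

Set Implicit Arguments.
Unset Strict Implicit.
Unset Printing Implicit Defensive.

Import Order.TTheory GRing.Theory Num.Theory.

Local Open Scope classical_set_scope.
Local Open Scope ring_scope.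

(** * Euclidean reflection groups *)

(** The atlas provides apartments through two simplices of the building, whereas the argument needs
    apartments through two chambers at infinity and retractions centered there. They are produced by
    gluing: a partial map on chambers is prolonged by one adjacent chamber at a time, and
    completeness of the atlas turns the union into a chart. Distances between chambers are counted
    by separating walls, so that folding and gluing reduce to comparing cardinals of finite sets of
    walls. An arrangement is only locally finite by definition; finiteness of the set of wall
    directions is derived from this, and the maximality argument, the openness of regular cones and
    the uniform choice of a large [n] rest on it. Curvature enters through the retraction centered
    at a chamber of the building: it preserves distances from that chamber and increases no others,
    which gives the CAT(0) inequality. Limits are obtained in a form stronger than the cone
    topology, eventual equality of rays on bounded intervals, and their uniqueness gives the
    independence of [c_-] and of the apartment. *)

Section Euclidean.
Context {R : realType} {n : nat}.
Notation E := ('rV[R]_n).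
Implicit Types (u v x y z : E) (c t : R).

Lemma dotE u v : dot u v = \sum_i u 0 i * v 0 i.
Proof. by rewrite /dot !mxE; apply: eq_bigr => i _; rewrite mxE. Qed.

Lemma dotC u v : dot u v = dot v u.
Proof. by rewrite !dotE; apply: eq_bigr => i _; rewrite mulrC. Qed.

Lemma dotDl u v x : dot (u + v) x = dot u x + dot v x.
Proof. by rewrite /dot mulmxDl mxE. Qed.

Lemma dotZl c u x : dot (c *: u) x = c * dot u x.
Proof. by rewrite /dot -scalemxAl mxE. Qed.

Lemma dotDr u v x : dot x (u + v) = dot x u + dot x v.
Proof. by rewrite dotC dotDl !(dotC x). Qed.

Lemma dotZr c u x : dot x (c *: u) = c * dot x u.
Proof. by rewrite dotC dotZl !(dotC x). Qed.

Lemma dotNl u x : dot (- u) x = - dot u x.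
Proof. by rewrite -scaleN1r dotZl mulN1r. Qed.

Lemma dotNr u x : dot x (- u) = - dot x u.
Proof. by rewrite dotC dotNl dotC. Qed.

Lemma dotBl u v x : dot (u - v) x = dot u x - dot v x.
Proof. by rewrite dotDl dotNl. Qed.

Lemma dotBr u v x : dot x (u - v) = dot x u - dot x v.
Proof. by rewrite dotDr dotNr. Qed.

Lemma dot0l x : dot 0 x = 0.
Proof. by rewrite -(scale0r 0) dotZl mul0r. Qed.

Lemma dot0r x : dot x 0 = 0.
Proof. by rewrite dotC dot0l. Qed.

Definition dotS := (dotDl, dotDr, dotNl, dotNr, dotZl, dotZr, dot0l, dot0r).

Lemma dot_ge0 u : 0 <= dot u u.
Proof. by rewrite dotE sumr_ge0// => i _; rewrite -expr2 sqr_ge0. Qed.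

Lemma dot_eq0 u : (dot u u == 0) = (u == 0).
Proof.
apply/eqP/eqP => [|->]; last exact: dot0l.
rewrite dotE => /eqP; rewrite psumr_eq0; last by move=> i _; rewrite -expr2 sqr_ge0.
move=> /allP u0; apply/rowP => i; rewrite mxE.
by have := u0 i (mem_index_enum _); rewrite /= mulf_eq0 orbb => /eqP.
Qed.

Lemma dot_gt0 u : (0 < dot u u) = (u != 0).
Proof. by rewrite lt_neqAle dot_ge0 andbT eq_sym dot_eq0. Qed.

Lemma enorm_ge0 u : 0 <= enorm u.
Proof. exact: sqrtr_ge0. Qed.

Lemma sqr_enorm u : enorm u ^+ 2 = dot u u.
Proof. by rewrite sqr_sqrtr// dot_ge0. Qed.

Lemma enorm_eq0 u : (enorm u == 0) = (u == 0).
Proof. by rewrite -dot_eq0 -sqr_enorm expf_eq0. Qed.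

Lemma enorm0 : enorm (0 : E) = 0.
Proof. by apply/eqP; rewrite enorm_eq0. Qed.

Lemma enorm_gt0 u : (0 < enorm u) = (u != 0).
Proof. by rewrite lt_neqAle enorm_ge0 andbT eq_sym enorm_eq0. Qed.

Lemma enormZ c u : enorm (c *: u) = `|c| * enorm u.
Proof.
rewrite /enorm dotZl dotZr mulrA -expr2 sqrtrM ?sqr_ge0//.
by rewrite sqrtr_sqr.
Qed.

Lemma enormN u : enorm (- u) = enorm u.
Proof. by rewrite -scaleN1r enormZ normrN1 mul1r. Qed.

Lemma enormB u v : enorm (u - v) = enorm (v - u).
Proof. by rewrite -enormN opprB. Qed.

Lemma enorm_ineq u c : 0 <= c -> (enorm u <= c) = (dot u u <= c ^+ 2).
Proof. by move=> c0; rewrite -sqr_enorm ler_pXn2r// nnegrE ?enorm_ge0. Qed.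

Lemma cauchy_schwarz u v : dot u v <= enorm u * enorm v.
Proof.
have [->|u0] := eqVneq u 0; first by rewrite dot0l enorm0 mul0r.
have un : 0 < enorm u by rewrite enorm_gt0.
have := dot_ge0 (dot u u *: v - dot u v *: u).
rewrite !dotS (dotC v u) -!sqr_enorm.
set a := enorm u in un *; set b := enorm v; set d := dot u v => h.
have {h} : 0 <= a ^+ 2 * ((a * b) ^+ 2 - d ^+ 2).
  by move: h; congr (_ <= _); ring.
rewrite pmulr_rge0 ?exprn_gt0// subr_ge0 => h.
have : 0 <= a * b by rewrite mulr_ge0 ?enorm_ge0.
nra.
Qed.

Lemma enormD u v : enorm (u + v) <= enorm u + enorm v.
Proof.
rewrite enorm_ineq ?addr_ge0 ?enorm_ge0// !dotS (dotC v u) -!sqr_enorm.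
have := cauchy_schwarz u v; nra.
Qed.

Lemma enorm_triangle x y z : enorm (x - z) <= enorm (x - y) + enorm (y - z).
Proof. by apply: le_trans (enormD _ _); rewrite addrA subrK. Qed.

Lemma norm_dot_le u v : `|dot u v| <= enorm u * enorm v.
Proof.
rewrite ler_norml cauchy_schwarz andbT lerNl -dotNl -(enormN u).
exact: cauchy_schwarz.
Qed.

Lemma norm_coord_le u i : `|u 0 i| <= enorm u.
Proof.
rewrite -(@ler_pXn2r _ 2)// ?nnegrE ?enorm_ge0// sqr_enorm real_normK ?num_real//.
rewrite dotE (bigD1 i)//= -expr2 lerDl sumr_ge0// => j _.
by rewrite -expr2 sqr_ge0.
Qed.

Lemma hyperplane_mem u c : u != 0 -> dot u ((c / dot u u) *: u) = c.
Proof. by rewrite -dot_eq0 => u0; rewrite dotZr divfK. Qed.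

Lemma hyperplane_eq u c u' c' : u != 0 -> u' != 0 ->
  hyperplane u c = hyperplane u' c' ->
  exists2 k, k != 0 & u' = k *: u /\ c' = k * c.
Proof.
move=> u0 u'0 /seteqP[+ _] => sub.
have u00 : dot u u != 0 by rewrite dot_eq0.
have p0 := hyperplane_mem c u0; set p := _ *: u in p0.
have p0' : dot u' p = c' := sub _ p0.
have perp x : dot u x = 0 -> dot u' x = 0.
  move=> ux; have : dot u' (p + x) = c'.
    by apply: sub; rewrite /hyperplane /= dotDr p0 ux addr0.
  by rewrite dotDr p0' => /eqP; rewrite -subr_eq0 addrAC subrr add0r => /eqP.
have uk : u' = (dot u' u / dot u u) *: u.
  apply/eqP; rewrite -subr_eq0 -dot_eq0; set r := u' - _.
  have ur : dot u r = 0 by rewrite dotBr dotZr divfK// dotC subrr.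
  by rewrite {1}/r dotBl dotZl ur mulr0 subr0 perp.
exists (dot u' u / dot u u); last first.
  by split => //; rewrite -p0' {1}uk dotZl p0.
by apply: contra u'0 => /eqP k0; rewrite uk k0 scale0r.
Qed.

Lemma hyperplane_neq0 u c u' c' : u != 0 -> hyperplane u c = hyperplane u' c' ->
  u' != 0.
Proof.
move=> u0 uu'; apply/eqP => u'0; move: uu'; rewrite {}u'0 => /seteqP[+ +].
have p0 := hyperplane_mem c u0; set p := _ *: u in p0.
move=> /(_ p p0); rewrite /hyperplane /= dot0l => c'0 /(_ (p + u)) /=.
rewrite dot0l -c'0 dotDr p0 => /(_ erefl)/eqP.
by rewrite -subr_eq0 addrAC subrr add0r dot_eq0 (negbTE u0).
Qed.

End Euclidean.

Section Reflections.
Context {R : realType} {n : nat}.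
Notation E := ('rV[R]_n).
Implicit Types (u v x y z : E) (c t : R) (w : E -> E).

(** The linear part of an affine map; through it the affine Weyl group acts on directions and at
    infinity. *)
Definition lin w x : E := w x - w 0.

Lemma linE w x : w x = lin w x + w 0.
Proof. by rewrite subrK. Qed.

Lemma hyperplaneZ k u c : k != 0 -> hyperplane (k *: u) (k * c) = hyperplane u c.
Proof.
move=> k0; apply/seteqP; split => x; rewrite /hyperplane /= dotZl; last by move->.
exact: mulfI.
Qed.

Lemma hyperplaneN u c : hyperplane (- u) (- c) = hyperplane u c.
Proof. by rewrite -(@hyperplaneZ (-1) u c) ?scaleN1r ?mulN1r// oppr_eq0 oner_eq0. Qed.

Lemma dot_reflection u c x v :
  dot v (reflection u c x) = dot v x - 2 * (dot u x - c) / dot u u * dot v u.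
Proof. by rewrite dotBr dotZr. Qed.

Lemma dot_reflection_normal u c x : u != 0 ->
  dot u (reflection u c x) - c = - (dot u x - c).
Proof. by rewrite -dot_eq0 dot_reflection => u0; field. Qed.

Lemma reflectionK u c : u != 0 -> cancel (reflection u c) (reflection u c).
Proof.
move=> u0 x; rewrite {1}/reflection dot_reflection_normal//.
by rewrite mulrN mulNr scaleNr opprK subrK.
Qed.

Lemma reflection_id u c x : dot u x = c -> reflection u c x = x.
Proof. by move=> <-; rewrite /reflection subrr mulr0 mul0r scale0r subr0. Qed.

Lemma lin_reflection u c : lin (reflection u c) = reflection u 0.
Proof.
apply/funext => x; rewrite /lin /reflection dot0r !sub0r subr0 opprK.
rewrite -addrA; congr (_ + _); rewrite addrC -scalerBl.
by rewrite -[RHS]scaleNr; congr (_ *: _); ring.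
Qed.

Lemma refl0D u x y : reflection u 0 (x + y) = reflection u 0 x + reflection u 0 y.
Proof.
by rewrite /reflection !subr0 dotDr mulrDr mulrDl scalerDl opprD addrACA.
Qed.

Lemma refl0Z u t x : reflection u 0 (t *: x) = t *: reflection u 0 x.
Proof.
rewrite /reflection !subr0 dotZr scalerBr scalerA; congr (_ - _ *: _); ring.
Qed.

Lemma reflectionB u c x y :
  reflection u c x - reflection u c y = reflection u 0 (x - y).
Proof.
have D z : reflection u c z = reflection u 0 z + reflection u c 0.
  by rewrite {1}(linE (reflection u c)) lin_reflection.
by rewrite (D x) (D y) opprD addrACA subrr addr0 refl0D -[- y]scaleN1r refl0Z scaleN1r.
Qed.

Lemma dot_refl0 u x y : u != 0 -> dot (reflection u 0 x) (reflection u 0 y) = dot x y.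
Proof.
rewrite -dot_eq0 => u0; rewrite /reflection !subr0 !dotS (dotC x u); field.
exact: u0.
Qed.

End Reflections.

(** * Action of the affine Weyl group on walls, cells and directions *)

Section Arrangement.
Context {R : realType} {n : nat} (M : set (set 'rV[R]_n)).
Notation E := ('rV[R]_n).
Implicit Types (u v x y z : E) (c t : R) (w : E -> E).
Hypothesis arr : affine_arrangement M.
Notation W := (reflection_group M).
Notation L := (linear_walls M).

Lemma wallP H : M H -> exists u c, [/\ u != 0, H = hyperplane u c & M (hyperplane u c)].
Proof.
case: arr => /(_ H) + _ _ _ _ MH => /(_ MH)[u [c [u0 uc]]].
by exists u, c; split => //; rewrite -uc.
Qed.

Lemma wall_neq0 u c : M (hyperplane u c) -> u != 0.
Proof. by move=> /wallP[v [d [v0 /esym/(hyperplane_neq0 v0)]]]. Qed.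

Lemma wallN u c : M (hyperplane u c) -> M (hyperplane (- u) (- c)).
Proof. by rewrite hyperplaneN. Qed.

Lemma W_linP w : W w ->
  [/\ forall x y, lin w (x + y) = lin w x + lin w y,
      forall t x, lin w (t *: x) = t *: lin w x
    & forall x y, dot (lin w x) (lin w y) = dot x y].
Proof.
elim => [|u c {}w u0 _ _ [IH1 IH2 IH3]].
  by split => *; rewrite /lin/= ?subr0.
have E x : lin (reflection u c \o w) x = reflection u 0 (lin w x).
  by rewrite /lin /= reflectionB.
split=> *; [by rewrite !E IH1 refl0D | by rewrite !E IH2 refl0Z|].
by rewrite !E dot_refl0.
Qed.

Lemma W_linD w x y : W w -> lin w (x + y) = lin w x + lin w y.
Proof. by case/W_linP. Qed.

Lemma W_linZ w t x : W w -> lin w (t *: x) = t *: lin w x.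
Proof. by case/W_linP. Qed.

Lemma W_lin_dot w x y : W w -> dot (lin w x) (lin w y) = dot x y.
Proof. by case/W_linP. Qed.

Lemma W_linN w x : W w -> lin w (- x) = - lin w x.
Proof. by move=> Ww; rewrite -scaleN1r W_linZ// scaleN1r. Qed.

Lemma W_linB w x y : W w -> lin w (x - y) = lin w x - lin w y.
Proof. by move=> Ww; rewrite W_linD// W_linN. Qed.

Lemma W_B w x y : W w -> w x - w y = lin w (x - y).
Proof. by move=> Ww; rewrite W_linB// /lin opprB addrA subrK. Qed.

Lemma W_D w x y : W w -> w (x + y) = w x + lin w y.
Proof. by move=> Ww; rewrite (linE w (x + y)) W_linD// addrAC -linE. Qed.

Lemma W_enorm w x : W w -> enorm (lin w x) = enorm x.
Proof. by move=> Ww; rewrite /enorm W_lin_dot. Qed.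

Lemma W_comp w w' : W w -> W w' -> W (w \o w').
Proof.
move=> Ww Ww'; elim: Ww => [|u c v u0 Mu _ IH]; first exact: Ww'.
exact: (reflection_group_comp (w := v \o w')).
Qed.

Lemma W_reflection u c : M (hyperplane u c) -> W (reflection u c).
Proof.
move=> Mu; apply: (reflection_group_comp (w := idfun)) => //.
- exact: wall_neq0 Mu.
- exact: reflection_group_id.
Qed.

Lemma W_inv w : W w -> exists w', [/\ W w', cancel w w' & cancel w' w].
Proof.
elim => [|u c {}w u0 Mu Ww [w' [Ww' w1 w2]]].
  by exists idfun; split => //; exact: reflection_group_id.
exists (w' \o reflection u c); split.
- by apply: W_comp => //; exact: W_reflection.
- by move=> x /=; rewrite reflectionK.
- by move=> x /=; rewrite w2 reflectionK.
Qed.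

Lemma lin_comp w w' x : W w -> lin (w \o w') x = lin w (lin w' x).
Proof. by move=> Ww; rewrite {1}/lin /= W_B. Qed.

Lemma W_linK w w' : W w -> W w' -> cancel w w' -> cancel (lin w) (lin w').
Proof.
by move=> Ww Ww' ww' x; rewrite -lin_comp//= /lin /= !ww' subr0.
Qed.

Lemma W_image w H : W w -> M H -> M (w @` H).
Proof.
move=> Ww; elim: Ww H => [|u c {}w u0 Mu _ IH] H MH.
  by rewrite (_ : _ @` H = H)// image_id.
by rewrite -image_comp; case: arr => _ _ + _ _; apply => //; exact: IH.
Qed.

Lemma W_dot w u x : W w -> dot (lin w u) (w x) = dot u x + dot (lin w u) (w 0).
Proof. by move=> Ww; rewrite {1}(linE w x) dotDr W_lin_dot. Qed.

Lemma W_dotK w w' u x : W w' -> cancel w w' ->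
  dot (lin w' u) x = dot u (w x) + dot (lin w' u) (w' 0).
Proof. by move=> Ww' ww'; rewrite -(@W_dot w' u (w x) Ww') ww'. Qed.

Lemma W_lin_dotK w w' u x : W w -> W w' -> cancel w w' ->
  dot (lin w' u) x = dot u (lin w x).
Proof.
by move=> Ww Ww' ww'; rewrite -(@W_lin_dot w' u _ Ww') (W_linK Ww Ww' ww').
Qed.

Lemma W_wall w u c : W w -> M (hyperplane u c) ->
  M (hyperplane (lin w u) (c + dot (lin w u) (w 0))).
Proof.
move=> Ww Mu; have [w' [Ww' ww' w'w]] := W_inv Ww.
rewrite (_ : hyperplane _ _ = w @` hyperplane u c); first exact: W_image.
apply/seteqP; split => [x|_ [x /= <- <-]]; rewrite /hyperplane /=; last by rewrite (W_dot _ _ Ww).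
by move=> h; exists (w' x) => //; move: h; rewrite -{1}(w'w x) (W_dot _ _ Ww) => /addIr.
Qed.

Lemma W_closed_cell w x y : W w ->
  in_closed_cell M (w x) (w y) <-> in_closed_cell M x y.
Proof.
suff H (g : E -> E) x' y' : W g -> in_closed_cell M x' y' -> in_closed_cell M (g x') (g y').
  move=> Ww; split; last exact: H.
  have [w' [Ww' ww' w'w]] := W_inv Ww.
  by move=> /(H w' _ _ Ww'); rewrite !ww'.
move=> Wv xy u c Mu; have [v' [Wv' vv' v'v]] := W_inv Wv.
have := xy _ _ (W_wall Wv' Mu).
by rewrite (W_dotK u x' Wv' vv') (W_dotK u y' Wv' vv') !lerD2r.
Qed.

Lemma W_cell w x y : W w -> cell M (w x) (w y) <-> cell M x y.
Proof.
by move=> Ww; split => -[h1 h2]; split;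
  (exact: (W_closed_cell _ _ Ww).1 || exact: (W_closed_cell _ _ Ww).2).
Qed.

Lemma chamberP x : in_chamber M x <-> forall u c, M (hyperplane u c) -> dot u x != c.
Proof.
split => [Cx u c Mu|Cx H MH Hx]; first by apply/eqP => /(Cx _ Mu).
by have [u [c [u0 HE Mu]]] := wallP MH; move: (Cx _ _ Mu); rewrite HE in Hx; rewrite Hx eqxx.
Qed.

Lemma W_chamber w x : W w -> in_chamber M (w x) <-> in_chamber M x.
Proof.
suff H (g : E -> E) x' : W g -> in_chamber M x' -> in_chamber M (g x').
  move=> Ww; split; last exact: H.
  have [w' [Ww' ww' w'w]] := W_inv Ww.
  by move=> /(H w' _ Ww'); rewrite !ww'.
move=> Wv /chamberP Cx; apply/chamberP => u c Mu; have [v' [Wv' vv' v'v]] := W_inv Wv.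
have := Cx _ _ (W_wall Wv' Mu).
by rewrite (W_dotK u x' Wv' vv') (inj_eq (addIr _)).
Qed.

Lemma LP u c : L (hyperplane u c) <-> [/\ u != 0, c = 0 & exists c', M (hyperplane u c')].
Proof.
split => [[v [d [v0 Md uv]]]|[u0 -> [c' Mu]]]; last by exists u, c'.
have u0 : u != 0 := hyperplane_neq0 v0 (esym uv).
have [k k0 [uE cE]] := hyperplane_eq v0 u0 (esym uv).
split => //; first by rewrite cE mulr0.
by exists (k * d); rewrite uE hyperplaneZ.
Qed.

Lemma L_wall u c : M (hyperplane u c) -> L (hyperplane u 0).
Proof. by move=> Mu; apply/LP; split; [exact: wall_neq0 Mu|by []|exists c]. Qed.

Lemma L_lin w u : W w -> L (hyperplane u 0) -> L (hyperplane (lin w u) 0).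
Proof.
by move=> Ww /LP[u0 _ [c Mu]]; apply: L_wall (W_wall Ww Mu).
Qed.

Lemma L_closed_cellP x y : in_closed_cell L x y <->
  forall u, L (hyperplane u 0) -> dot u x <= 0 -> dot u y <= 0.
Proof.
split => [xy u|xy u c Lu]; first exact: xy.
by have [_ c0 _] := (LP _ _).1 Lu; move: Lu; rewrite c0; exact: xy.
Qed.

Lemma L_chamberP x : in_chamber L x <-> forall u, L (hyperplane u 0) -> dot u x != 0.
Proof.
split => [Cx u Lu|Cx H LH Hx]; first by apply/eqP => /(Cx _ Lu).
have [u [c [u0 Mu HE]]] := LH.
by move: Hx; rewrite HE /hyperplane /=; apply/eqP/Cx/(L_wall Mu).
Qed.

Lemma L_chamberN x : in_chamber L x -> in_chamber L (- x).
Proof.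
move=> /L_chamberP Cx; apply/L_chamberP => u Lu.
by rewrite dotNr oppr_eq0 Cx.
Qed.

Lemma lin_closed_cell w x y : W w ->
  in_closed_cell L (lin w x) (lin w y) <-> in_closed_cell L x y.
Proof.
suff H (g : E -> E) x' y' : W g -> in_closed_cell L x' y' -> in_closed_cell L (lin g x') (lin g y').
  move=> Ww; split; last exact: H.
  have [w' [Ww' ww' w'w]] := W_inv Ww.
  by move=> /(H w' _ _ Ww'); rewrite !(W_linK Ww).
move=> Wv /L_closed_cellP xy; apply/L_closed_cellP => u Lu.
have [v' [Wv' vv' v'v]] := W_inv Wv.
have := xy _ (L_lin Wv' Lu).
by rewrite !(W_lin_dotK _ _ Wv Wv' vv').
Qed.

Lemma lin_cell w x y : W w -> cell L (lin w x) (lin w y) <-> cell L x y.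
Proof.
by move=> Ww; split => -[h1 h2]; split;
  (exact: (lin_closed_cell _ _ Ww).1 || exact: (lin_closed_cell _ _ Ww).2).
Qed.

Lemma lin_chamber w x : W w -> in_chamber L (lin w x) <-> in_chamber L x.
Proof.
suff H (g : E -> E) x' : W g -> in_chamber L x' -> in_chamber L (lin g x').
  move=> Ww; split; last exact: H.
  have [w' [Ww' ww' w'w]] := W_inv Ww.
  by move=> /(H w' _ Ww'); rewrite !(W_linK Ww).
move=> Wv /L_chamberP Cx; apply/L_chamberP => u Lu.
have [v' [Wv' vv' v'v]] := W_inv Wv.
have := Cx _ (L_lin Wv' Lu).
by rewrite !(W_lin_dotK _ _ Wv Wv' vv').
Qed.

End Arrangement.

(** * Cardinals of finite sets *)

Section FiniteSets.
Context {T T' : choiceType}.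
Implicit Types (S : set T).

(** Meaningful for finite sets only: [fset_set] sends an infinite set to the empty one. *)
Definition ncard {U : choiceType} (S : set U) : nat := size (finmap.enum_fset (fset_set S)).

Lemma ncard_le S S' : finite_set S' -> S `<=` S' -> (ncard S <= ncard S')%N.
Proof.
move=> fS' SS'; have fS := sub_finite_set SS' fS'.
apply: finmap.fsubset_leq_card; apply/finmap.fsubsetP => x.
by rewrite !in_fset_set// !inE; exact: SS'.
Qed.

Lemma ncard_image (f : T -> T') S : finite_set S -> {in S &, injective f} ->
  ncard (f @` S) = ncard S.
Proof.
move=> fS finj; rewrite /ncard fset_set_image// finmap.card_in_imfset// => x y.
by rewrite !in_fset_set//; exact: finj.
Qed.

Lemma ncardU S S' : finite_set S -> finite_set S' ->
  (ncard (S `|` S') <= ncard S + ncard S')%N.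
Proof.
move=> fS fS'; rewrite /ncard fset_setU// finmap.cardfsU.
exact: leq_subr.
Qed.

Lemma ncardUI S S' : finite_set S -> finite_set S' -> S `&` S' = set0 ->
  ncard (S `|` S') = (ncard S + ncard S')%N.
Proof.
move=> fS fS' SS'; rewrite /ncard fset_setU// finmap.cardfsU -fset_setI// SS'.
by rewrite fset_set0 finmap.cardfs0 subn0.
Qed.

Lemma ncard1 (x : T) : ncard [set x] = 1%N.
Proof. by rewrite /ncard fset_set1 finmap.cardfs1. Qed.

Lemma ncard0 S : finite_set S -> ncard S = 0%N -> S = set0.
Proof.
by move=> fS /finmap.cardfs0_eq S0; rewrite -(fset_setK fS) S0 set_fset0.
Qed.

Lemma ncard_eq1 S : finite_set S -> ncard S = 1%N -> exists x, S = [set x].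
Proof.
move=> fS /eqP /finmap.cardfs1P[x Sx]; exists x.
by rewrite -(fset_setK fS) Sx set_fset1.
Qed.

Lemma ncardD1 S (x : T) : finite_set S -> S x -> ncard S = (ncard (S `\` [set x])).+1.
Proof.
move=> fS Sx; have fS' : finite_set (S `\` [set x]) by apply: sub_finite_set fS => y [].
rewrite -addn1 -(ncard1 x) -ncardUI//; last by rewrite -subset0 => y [[_ +]].
congr ncard; apply/seteqP; split => y; last by case=> [[]//|->].
by move=> Sy; have [->|yx] := pselect (y = x); [right|left].
Qed.

End FiniteSets.

(** * Induction along a segment and choice of small parameters *)

Section RealLine.
Context {R : realType}.
Implicit Types (a b s t : R).

(** The supremum of the points reached from [a] is itself reached and cannot lie before [b]. This
    plays the role of compactness of the segment. *)
Lemma interval_chain (Q : R -> R -> Prop) a b : a <= b ->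
  (forall r s t, Q r s -> Q s t -> r <= s -> s <= t -> Q r t) ->
  (forall t, a <= t <= b -> exists2 e, 0 < e &
     (forall s, a <= s <= t -> t - e < s -> Q s t) /\
     (forall s, t <= s <= b -> s < t + e -> Q t s)) ->
  Q a b.
Proof.
move=> ab tr loc; pose S := [set t | a <= t <= b /\ Q a t].
have Sa : S a.
  split; first by rewrite lexx.
  have [|e e0 [_ +]] := loc a; first by rewrite lexx.
  by apply; [rewrite lexx|rewrite ltrDl].
have supS : has_sup S by split; [exists a|exists b => t [/andP[]]].
set m := sup S; have am : a <= m by exact: sup_upper_bound.
have mb : m <= b by apply: ge_sup; [exists a|move=> t [/andP[]]].
have [|e e0 [el er]] := loc m; first by rewrite am.
have [s [/andP[as_ sb] Qs] ms] := sup_adherent e0 supS.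
have sm : s <= m by apply: sup_upper_bound => //; split => //; rewrite as_.
have Qm : Q a m by apply: (tr _ s) => //; apply: el => //; rewrite as_.
have [bm|mb'] := leP b m; first by rewrite (le_anti (introT andP (conj mb bm))) in Qm.
pose t := Num.min b (m + e / 2).
have mt : m < t by rewrite lt_min mb'/= ltrDl divr_gt0.
have tb : t <= b by rewrite ge_min lexx.
have : S t.
  split; first by rewrite tb (le_trans am (ltW mt)).
  apply: (tr _ m) => //; last exact: ltW.
  apply: er; first by rewrite tb (ltW mt).
  by rewrite gt_min; apply/orP; right; rewrite ltrD2l ltr_pdivrMr// mulr2n mulrDr mulr1 ltrDl.
by move=> /(sup_upper_bound supS); rewrite leNgt mt.
Qed.

(** Used to perturb a point while avoiding finitely many bad parameters; with the empty list it just
    picks a small positive number. *)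
Lemma exists_notin (s : seq R) e : 0 < e -> exists2 t, 0 < t < e & t \notin s.
Proof.
elim: s e => [|r s IH] e e0; first by exists (e / 2) => //; rewrite divr_gt0//=; lra.
have [t /andP[t0 te] ts] := IH e e0.
have [r_eq|rt] := eqVneq r t; last by exists t; rewrite ?t0// inE negb_or ts eq_sym rt.
have [t' /andP[t'0 t't] t's] := IH t t0.
by exists t'; rewrite ?t'0 ?(lt_trans t't)// inE negb_or t's r_eq lt_eqF.
Qed.

Lemma seq_argmin (T : eqType) (f : T -> R) (s : seq T) : s != [::] ->
  exists2 x, x \in s & forall y, y \in s -> f x <= f y.
Proof.
elim: s => // x s IH _; have [->|/IH[y ys ymin]] := eqVneq s [::].
  by exists x; rewrite ?inE// => y; rewrite inE => /eqP ->.
have [xy|yx] := leP (f x) (f y).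
  exists x; rewrite ?inE ?eqxx// => z; rewrite inE => /orP[/eqP -> //|/ymin].
  exact: le_trans.
exists y; rewrite ?inE ?ys ?orbT// => z; rewrite inE => /orP[/eqP ->|/ymin//].
exact: ltW.
Qed.

End RealLine.

(** * General position and separating walls *)

Section Generic.
Context {R : realType} {n : nat}.
Notation E := ('rV[R]_n).
Implicit Types (x y z : E) (t s r : R).

(** If [b] is orthogonal to the new vector [u], moving it slightly along [u] repairs this, and only
    finitely many step lengths spoil the other conditions. *)
Lemma generic_vector (us : seq E) : (forall u, u \in us -> u != 0) ->
  exists b : E, forall u, u \in us -> dot u b != 0.
Proof.
elim: us => [|u us IH] us0; first by exists 0.
have [|b bus] := IH; first by move=> v vus; apply: us0; rewrite inE vus orbT.
have [ub|ub] := eqVneq (dot u b) 0; last first.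
  by exists b => v; rewrite inE => /orP[/eqP -> //|]; exact: bus.
have [t /andP[t0 _] tbad] := exists_notin [seq - dot v b / dot v u | v <- us] ltr01.
exists (b + t *: u) => v; rewrite inE dotDr dotZr => /orP[/eqP ->|vus].
  by rewrite ub add0r mulf_neq0 ?gt_eqF// dot_gt0 us0// inE eqxx.
apply: contraNneq tbad => vt; apply/mapP; exists v => //.
have := bus _ vus; have [vu|vu _] := eqVneq (dot v u) 0.
  by move: vt; rewrite vu mulr0 addr0 => ->; rewrite eqxx.
by apply: (mulIf vu); rewrite divfK//; lra.
Qed.

(** By Cauchy-Schwarz, a hyperplane missing [z] stays at distance at least [|dot u z - c| / enorm u]
    from it. *)
Lemma hyperplanes_avoid (s : seq (set E)) z :
  (forall H, H \in s -> exists u c, u != 0 /\ H = hyperplane u c) ->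
  exists2 e : R, 0 < e & forall H, H \in s -> forall y, H y -> enorm (y - z) < e -> H z.
Proof.
elim: s => [|H s IH] hs; first by exists 1.
have [|e e0 es] := IH; first by move=> K Ks; apply: hs; rewrite inE Ks orbT.
have [u [c [u0 HE]]] : exists u c, u != 0 /\ H = hyperplane u c by apply: hs; rewrite inE eqxx.
have un : 0 < enorm u by rewrite enorm_gt0.
have [zc|zc] := eqVneq (dot u z) c.
  by exists e => // K; rewrite inE => /orP[/eqP -> y _ _|]; [rewrite HE|exact: es].
exists (Num.min e (`|dot u z - c| / enorm u)).
  by rewrite lt_min e0 divr_gt0// normr_gt0 subr_eq0.
move=> K; rewrite inE => /orP[/eqP ->|Ks] y Ky; rewrite lt_min => /andP[ye yc]; last exact: es Ks _ Ky ye.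
move: Ky; rewrite HE /hyperplane /= => uy.
move: yc; rewrite ltr_pdivlMr// -uy -dotBr mulrC => h.
by have := norm_dot_le u (z - y); rewrite enormB leNgt h.
Qed.

(** A wall strictly separating [y] from [z] would meet the segment between them, at parameter [s],
    inside the ball, hence would contain [z]. *)
Lemma avoid_closed_cell (N : set (set E)) z (e : R) :
  (forall H y, N H -> H y -> enorm (y - z) < e -> H z) ->
  forall y, enorm (y - z) < e -> in_closed_cell N y z.
Proof.
move=> av y ye u c Nu uy; rewrite leNgt; apply/negP => uz.
have d0 : 0 < dot u z - dot u y by lra.
pose s := (c - dot u y) / (dot u z - dot u y).
have s0 : 0 <= s by apply: divr_ge0; lra.
have s1 : s <= 1 by rewrite ler_pdivrMr//; lra.
have /= := av _ (y + s *: (z - y)) Nu.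
rewrite /hyperplane /= dotDr dotZr dotBr /s divfK ?gt_eqF// => h.
suff : dot u z = c by lra.
apply: h; first by lra.
rewrite (_ : _ - z = (1 - s) *: (y - z)); last first.
  by rewrite scalerBl scale1r -(opprB z y) scalerN opprK addrAC opprB addrC; congr (_ + _).
rewrite enormZ ger0_norm ?subr_ge0//; apply: le_lt_trans ye.
by rewrite ler_piMl ?enorm_ge0//; lra.
Qed.

(** The arrangement is a parameter because both the affine walls and the linear walls are used, for
    chambers of the complex and for chambers at infinity. *)
Definition sepset (N : set (set E)) x y : set (set E) :=
  [set H | exists u c, [/\ H = hyperplane u c, N (hyperplane u c), dot u x < c & c < dot u y]].

Lemma sepsetC N x y : sepset N x y = sepset N y x.
Proof.
suff H x' y' : sepset N x' y' `<=` sepset N y' x' by apply/seteqP; split; exact: H.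
move=> H [u [c [-> Nu ux uy]]]; exists (- u), (- c).
by rewrite hyperplaneN !dotNl !ltrN2; split.
Qed.

Lemma sepset_tri N x y z : in_chamber N y ->
  sepset N x z `<=` sepset N x y `|` sepset N y z.
Proof.
move=> Cy H [u [c [-> Nu ux uz]]].
have [yc|yc|yc] := ltgtP (dot u y) c; first by right; exists u, c.
- by left; exists u, c.
- by have := Cy _ Nu yc.
Qed.

Lemma sepset_cell N x y : in_chamber N x -> in_chamber N y -> sepset N x y = set0 -> cell N x y.
Proof.
move=> Cx Cy xy; split=> u c Nu h; rewrite leNgt; apply/negP => h'.
- have : sepset N x y (hyperplane u c); last by rewrite xy.
  exists u, c; split => //; rewrite lt_neqAle h andbT; apply/eqP; exact: (Cx _ Nu).
- have : sepset N x y (hyperplane u c); last by rewrite xy.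
  rewrite sepsetC; exists u, c; split => //; rewrite lt_neqAle h andbT; apply/eqP; exact: (Cy _ Nu).
Qed.

Lemma cell_sepset N x y : cell N x y -> sepset N x y = set0.
Proof.
move=> [xy yx]; rewrite -subset0 => H [u [c [-> Nu ux uy]]].
by have := xy _ _ Nu (ltW ux); rewrite leNgt uy.
Qed.

End Generic.

Lemma finite_setUP (T : Type) (A B : set T) :
  finite_set A -> finite_set B -> finite_set (A `|` B).
Proof. by rewrite finite_setU. Qed.

Lemma conv_gt0 (R : realType) (a b s : R) : 0 < a -> 0 < b -> 0 <= s <= 1 ->
  0 < (1 - s) * a + s * b.
Proof.
move=> a0 b0 /andP[s0 s1]; have [ab|ba] := leP a b.
  have : 0 <= s * (b - a) by rewrite mulr_ge0// subr_ge0.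
  by lra.
have : 0 <= (1 - s) * (a - b) by rewrite mulr_ge0// subr_ge0 // ltW.
by lra.
Qed.

(** Both [(a, c)] and [(g, b)] lie on the upper half of the unit circle, where the cosine is an
    increasing function of the cotangent. *)
Lemma unit_circle_le (R : realType) (g a b c : R) : 0 < b -> 0 < c ->
  b ^+ 2 = 1 - g ^+ 2 -> a ^+ 2 + c ^+ 2 = 1 -> a * b <= g * c -> a <= g.
Proof.
move=> b0 c0 bE ac h; rewrite leNgt; apply/negP => ga.
have [a0|a0] := leP a 0.
  have : b < c by rewrite -(@ltr_pXn2r _ 2)// ?nnegrE ?ltW// bE; nra.
  nra.
have [g0|g0] := leP g 0; first nra.
have : c < b by rewrite -(@ltr_pXn2r _ 2)// ?nnegrE ?ltW// bE; nra.
nra.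
Qed.

Lemma unit_circle_gtN1 (R : realType) (a c : R) : 0 < c -> a ^+ 2 + c ^+ 2 = 1 -> -1 < a.
Proof. move=> *; nra. Qed.

Section SeparatedSets.
Context {R : realType} {n : nat}.
Notation E := ('rV[R]_n).
Implicit Types (u v : E).

(** The cube is cut into boxes of side [1 / N]. Two points in one box are at distance at most
    [sqrt n / N], which is less than [d], so each box contains at most one point of [S]. *)
Lemma separated_finite (S : set E) (d : R) : 0 < d -> (forall u, S u -> enorm u <= 1) ->
  (forall u v, S u -> S v -> enorm (u - v) < d -> u = v) -> finite_set S.
Proof.
move=> d0 S1 Sd; pose N := Num.Def.archi_bound (n.+1%:R / d).
have Nd : n.+1%:R / d < N%:R by apply: archi_boundP; rewrite divr_ge0// ltW.
have N0 : 0 < N%:R :> R by apply: le_lt_trans Nd; rewrite divr_ge0// ltW.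
pose idx u : {ffun 'I_n -> 'I_(N + N).+1} :=
  [ffun i => inord (Num.truncn ((u 0 i + 1) * N%:R))].
have idx_inj u v : S u -> S v -> idx u = idx v -> u = v.
  move=> Su Sv uv; apply: Sd => //.
  have coordP x i : S x -> 0 <= (x 0 i + 1) * N%:R /\ leq (Num.truncn ((x 0 i + 1) * N%:R)) (N + N).
    move=> Sx; have := le_trans (norm_coord_le x i) (S1 _ Sx); rewrite ler_norml => /andP[x1 x2].
    have ge0 : 0 <= (x 0 i + 1) * N%:R by rewrite mulr_ge0//; lra.
    split => //; rewrite -ltnS -(ltr_nat R); have /andP[h _] := truncn_itv ge0.
    apply: le_lt_trans h _; rewrite -natr1 natrD; nra.
  have close i : `|(u - v) 0 i| <= N%:R^-1.
    have [u0 u1] := coordP u i Su; have [v0 v1] := coordP v i Sv.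
    have : Num.truncn ((u 0 i + 1) * N%:R) = Num.truncn ((v 0 i + 1) * N%:R).
      by have /ffunP/(_ i)/(congr1 val) := uv; rewrite !ffunE /= !inordK.
    move=> uvt; have /andP[a1 a2] := truncn_itv u0; have /andP[b1 b2] := truncn_itv v0.
    rewrite uvt in a1 a2; set k := Num.truncn _ in a1 a2 b1 b2.
    rewrite -(ler_pM2r N0) mulVf ?gt_eqF// -(ger0_norm (ltW N0)) -normrM.
    by rewrite ler_norml !mxE; move: a2 b2; rewrite -natr1; lra.
  rewrite -(@ltr_pXn2r _ 2)// ?nnegrE ?enorm_ge0 ?ltW// sqr_enorm dotE.
  apply: (@le_lt_trans _ _ (\sum_(i < n) (N%:R^-1 ^+ 2))).
    apply: ler_sum => i _; rewrite -expr2 -real_normK ?num_real//.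
    by rewrite ler_pXn2r// nnegrE invr_ge0 ltW.
  rewrite sumr_const card_ord exprVn -[X in X < _]mulr_natl ltr_pdivrMr ?exprn_gt0// -exprMn.
  move: Nd; rewrite ltr_pdivrMr// mulrC => Nd.
  have n0 : 0 <= n%:R :> R by [].
  move: Nd; rewrite -natr1 => Nd; nra.
(* One point is selected in each occupied box; [0] is the value for the empty boxes. *)
pose g (f : {ffun 'I_n -> 'I_(N + N).+1}) : E := xget 0 [set u | S u /\ idx u = f].
apply: (@sub_finite_set _ _ (g @` setT)); last exact/finite_image/finite_finset.
move=> u Su; exists (idx u) => //; rewrite /g.
case: xgetP => [v _ [Sv vu]|/(_ u)[]//].
exact: idx_inj.
Qed.

End SeparatedSets.

(** * Chambers, adjacency, and finiteness of the set of wall directions *)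

Section Chambers.
Context {R : realType} {n : nat} (M : set (set 'rV[R]_n)).
Notation E := ('rV[R]_n).
Implicit Types (u v x y z : E) (c t s : R) (w : E -> E).
Hypothesis arr : affine_arrangement M.
Notation W := (reflection_group M).
Notation L := (linear_walls M).
Notation sep := (sepset M).

Lemma wall_rep H : M H -> exists u c, u != 0 /\ H = hyperplane u c.
Proof. by case: arr => + _ _ _ _; apply. Qed.

(** Only finitely many walls meet a small ball, and shrinking it discards those that miss its
    center. *)
Lemma near_walls z : exists2 e : R, 0 < e &
  forall H y, M H -> H y -> enorm (y - z) < e -> H z.
Proof.
case: arr => _ /(_ z)[e e0 fin] _ _ _.
have [s sE] := (finite_seqP _).1 fin.
have memP H : (H \in s) <-> (M H /\ exists2 y, H y & enorm (y - z) < e).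
  by split => [Hs|hH]; [have : [set` s] H by []|suff : [set` s] H by []]; rewrite -sE.
have [|d d0 sd] := @hyperplanes_avoid _ _ s z.
  by move=> H /memP[MH _]; exact: wall_rep.
exists (Num.min e d); first by rewrite lt_min e0.
move=> H y MH Hy; rewrite lt_min => /andP[ye yd].
by apply: (sd H _ y Hy yd); apply/memP; split => //; exists y.
Qed.

Lemma near_closed_cell z : exists2 e : R, 0 < e &
  forall y, enorm (y - z) < e -> in_closed_cell M y z.
Proof.
by have [e e0 /avoid_closed_cell ez] := near_walls z; exists e.
Qed.

Lemma closed_cell_chamber x y : in_chamber M x -> in_closed_cell M y x -> cell M x y.
Proof.
move=> Cx yx; split => // u c Mu ux; rewrite leNgt; apply/negP => uy.
have := yx _ _ (wallN Mu); rewrite !dotNl !lerN2 => /(_ (ltW uy)) xc.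
by apply: (Cx _ Mu); apply/eqP; rewrite eq_le ux.
Qed.

Lemma near_cell x : in_chamber M x -> exists2 e : R, 0 < e &
  forall y, enorm (y - x) < e -> cell M x y.
Proof.
move=> Cx; have [e e0 ez] := near_closed_cell x; exists e => // y /ez.
exact: closed_cell_chamber.
Qed.

Lemma cell_chamber (N : set (set E)) x y : (forall H, N H -> exists u c, H = hyperplane u c) ->
  in_chamber N x -> cell N x y -> in_chamber N y.
Proof.
move=> rep Cx [xy yx] H NH Hy; have [u [c HE]] := rep _ NH; rewrite HE in NH Hy.
apply: (Cx _ NH); apply/eqP; rewrite eq_le yx ?Hy//=.
have Nu' : N (hyperplane (- u) (- c)) by rewrite hyperplaneN.
by have := yx _ _ Nu'; rewrite !dotNl !lerN2 Hy; exact.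
Qed.

Lemma M_cell_chamber x y : in_chamber M x -> cell M x y -> in_chamber M y.
Proof.
by apply: cell_chamber => H /wall_rep[u [c [_ ->]]]; exists u, c.
Qed.

Lemma seg_sub x y s t : x + s *: (y - x) - (x + t *: (y - x)) = (s - t) *: (y - x).
Proof. by rewrite opprD addrACA subrr add0r -scalerBl. Qed.

Lemma finite_seg x y :
  finite_set [set H | M H /\ exists2 s, 0 <= s <= 1 & H (x + s *: (y - x))].
Proof.
pose Q a b := finite_set [set H | M H /\ exists2 s, a <= s <= b & H (x + s *: (y - x))].
have : Q 0 1; last by [].
apply: interval_chain => //.
  move=> r s t fr fs rs st; have := finite_setUP fr fs.
  apply: sub_finite_set.
  move=> H [MH [a /andP[ra at_] Ha]]; have [as_|sa] := leP a s; [left|right].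
    by split => //; exists a => //; rewrite ra.
  by split => //; exists a => //; rewrite at_ ltW.
move=> t _; pose z := x + t *: (y - x).
case: arr => _ /(_ z)[e e0 fin] _ _ _.
have N0 : 0 < enorm (y - x) + 1 by rewrite ltr_wpDl ?enorm_ge0.
have near s : `|s - t| < e / (enorm (y - x) + 1) -> enorm (x + s *: (y - x) - z) < e.
  move=> st; rewrite seg_sub enormZ; move: st; rewrite ltr_pdivlMr//; apply: le_lt_trans.
  by rewrite ler_wpM2l// lerDl.
exists (e / (enorm (y - x) + 1)); first by rewrite divr_gt0.
split=> s /andP[h1 h2] st; apply: sub_finite_set fin => H [MH [a /andP[sa at_] Ha]].
  split => //; exists (x + a *: (y - x)) => //; apply: near.
  by rewrite ler0_norm; lra.
split => //; exists (x + a *: (y - x)) => //; apply: near.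
by rewrite ger0_norm; lra.
Qed.

Lemma dot_seg u x y s : dot u (x + s *: (y - x)) = dot u x + s * (dot u y - dot u x).
Proof. by rewrite dotDr dotZr dotBr. Qed.

Lemma sep_finite x y : finite_set (sep x y).
Proof.
apply: sub_finite_set (finite_seg x y) => H [u [c [-> Mu ux uy]]]; split => //.
have d0 : 0 < dot u y - dot u x by lra.
exists ((c - dot u x) / (dot u y - dot u x)).
  by rewrite ler_pdivrMr// divr_ge0; lra.
by rewrite /hyperplane /= dot_seg divfK ?gt_eqF//; lra.
Qed.

(** On chambers this is the gallery distance of the Coxeter complex, counted by separating walls so
    that no galleries are manipulated. *)
Definition wall_dist x y : nat := ncard (sep x y).
Notation dE := wall_dist.

Lemma dEC x y : dE x y = dE y x.
Proof. by rewrite /wall_dist sepsetC. Qed.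

Lemma dE_tri x y z : in_chamber M y -> (dE x z <= dE x y + dE y z)%N.
Proof.
move=> Cy; apply: leq_trans (ncardU (sep_finite x y) (sep_finite y z)).
by apply: ncard_le; [rewrite finite_setU; split; exact: sep_finite|exact: sepset_tri].
Qed.

Lemma dE0_cell x y : in_chamber M x -> in_chamber M y -> dE x y = 0%N -> cell M x y.
Proof.
by move=> Cx Cy /(ncard0 (sep_finite x y)); exact: sepset_cell.
Qed.

Lemma cell_dE0 x y : cell M x y -> dE x y = 0%N.
Proof. by rewrite /wall_dist => /cell_sepset ->; rewrite /ncard fset_set0. Qed.

Lemma sep_W w x y : W w -> sep (w x) (w y) = (fun H => w @` H) @` sep x y.
Proof.
suff sub (g : E -> E) x' y' : W g -> (fun H => g @` H) @` sep x' y' `<=` sep (g x') (g y').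
  move=> Ww; apply/seteqP; split; last exact: sub.
  have [w' [Ww' ww' w'w]] := W_inv arr Ww.
  move=> H Hs; exists (w' @` H); last first.
    by rewrite image_comp (_ : _ \o _ = id) ?image_id//; apply/funext => a /=; rewrite w'w.
  by rewrite -(ww' x) -(ww' y); apply: sub => //; exists H.
move=> Wg _ [H [u [c [-> Mu ux uy]]] <-].
have [g' [Wg' gg' g'g]] := W_inv arr Wg.
exists (lin g u), (c + dot (lin g u) (g 0)); split.
- apply/seteqP; split => [_ [a <- <-]|a]; rewrite /hyperplane /=.
    by rewrite (W_dot _ _ Wg).
  by move=> h; exists (g' a) => //; move: h; rewrite -{1}(g'g a) (W_dot _ _ Wg) => /addIr.
- exact: W_wall.
- by rewrite (W_dot u x' Wg) ltrD2r.
- by rewrite (W_dot u y' Wg) ltrD2r.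
Qed.

Lemma dE_W w x y : W w -> dE (w x) (w y) = dE x y.
Proof.
move=> Ww; rewrite /wall_dist sep_W// ncard_image//; first exact: sep_finite.
have [w' [Ww' ww' w'w]] := W_inv arr Ww.
move=> H H' _ _ /(congr1 (fun K => w' @` K)); rewrite !image_comp.
by rewrite (_ : _ \o _ = id) ?image_id//; apply/funext => a /=; rewrite ww'.
Qed.

Lemma sep_crossing x y u c s : in_chamber M x -> in_chamber M y -> M (hyperplane u c) ->
  0 <= s <= 1 -> dot u (x + s *: (y - x)) = c -> sep x y (hyperplane u c).
Proof.
move=> Cx Cy Mu s01; rewrite dot_seg => h.
have xc : dot u x != c by apply/eqP; exact: (Cx _ Mu).
have yc : dot u y != c by apply/eqP; exact: (Cy _ Mu).
have [xlt|xgt|/eqP] := ltgtP (dot u x) c; last by rewrite (negbTE xc).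
  exists u, c; split => //; rewrite lt_neqAle eq_sym yc/= leNgt; apply/negP => yl.
  have := @conv_gt0 _ (c - dot u x) (c - dot u y) s; rewrite !subr_gt0 => /(_ xlt yl s01).
  by lra.
rewrite sepsetC; exists u, c; split => //; rewrite lt_neqAle yc/= leNgt; apply/negP => yl.
have := @conv_gt0 _ (dot u x - c) (dot u y - c) s; rewrite !subr_gt0 => /(_ xgt yl s01).
by lra.
Qed.

(** The chambers [d] and [d'] are adjacent, [d] on the negative side of the wall, and [z] is a point
    of the open panel between them. *)
Definition panel_between d d' u c z : Prop :=
  [/\ [/\ in_chamber M d, in_chamber M d', M (hyperplane u c) & dot u z = c],
      dot u d < c < dot u d', forall H, M H -> H z -> H = hyperplane u c,
      in_closed_cell M d z /\ in_closed_cell M d' z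
    & sep d d' = [set hyperplane u c]].

(** Take for [z] the point where the segment from [d] to [d'] meets the only separating wall; any
    wall through [z] separates [d] from [d'], hence is that wall. *)
Lemma adjacent_panel d d' : in_chamber M d -> in_chamber M d' -> dE d d' = 1%N ->
  exists u c z, panel_between d d' u c z.
Proof.
move=> Cd Cd' /(ncard_eq1 (sep_finite d d'))[H sH].
have : sep d d' H by rewrite sH.
move=> [u [c [HE Mu ud ud']]]; have d0 : 0 < dot u d' - dot u d by lra.
pose s := (c - dot u d) / (dot u d' - dot u d).
have s01 : 0 <= s <= 1 by rewrite ler_pdivrMr// divr_ge0; lra.
pose z := d + s *: (d' - d).
have uz : dot u z = c by rewrite dot_seg divfK ?gt_eqF//; lra.
have uniq K : M K -> K z -> K = hyperplane u c.
  move=> MK Kz; have [v [b [v0 KE Mv]]] := wallP arr MK.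
  rewrite KE in Kz *; have := sep_crossing Cd Cd' Mv s01 Kz.
  by rewrite sH -HE.
exists u, c, z; rewrite HE in sH; split => //; first by rewrite ud.
have cc v b e : M (hyperplane v b) -> e = d \/ e = d' -> dot v e <= b -> dot v z <= b.
  move=> Mv ee ve; rewrite leNgt; apply/negP => vz.
  have [vd|vd|/(Cd _ Mv)//] := ltgtP (dot v d) b; have [vd'|vd'|/(Cd' _ Mv)//] := ltgtP (dot v d') b.
  - have := @conv_gt0 _ (b - dot v d) (b - dot v d') s; rewrite !subr_gt0 => /(_ vd vd' s01).
    by move: vz; rewrite dot_seg; lra.
  - have : sep d d' (hyperplane v b) by exists v, b.
    rewrite sH => /(congr1 (fun K => K z)); rewrite /hyperplane/= => h.
    by have : dot v z = b; [rewrite h|move: vz => /[swap] ->; rewrite ltxx].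
  - have : sep d d' (hyperplane v b) by rewrite sepsetC; exists v, b.
    rewrite sH => /(congr1 (fun K => K z)); rewrite /hyperplane/= => h.
    by have : dot v z = b; [rewrite h|move: vz => /[swap] ->; rewrite ltxx].
  - by case: ee => ee; move: ve; rewrite ee leNgt ?vd ?vd'.
by split=> v b Mv; apply: cc => //; [left|right].
Qed.

Lemma panel_cells d d' u c z e : panel_between d d' u c z -> in_chamber M e ->
  in_closed_cell M e z -> if dot u e < c then cell M d e else cell M d' e.
Proof.
move=> [[Cd Cd' Mu uz] /andP[ud ud'] uniq [dz d'z] _] Ce ez.
have only a v b : in_chamber M a -> in_closed_cell M a z -> M (hyperplane v b) ->
    dot v a < b -> b < dot v e -> hyperplane v b = hyperplane u c.
  move=> Ca az Mv va ve; apply: uniq => //; apply/eqP; rewrite eq_le (az _ _ Mv (ltW va))/=.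
  by have := ez _ _ (wallN Mv); rewrite !dotNl !lerN2; apply; exact: ltW.
have main a : in_chamber M a -> in_closed_cell M a z ->
    ((dot u a < c) = (dot u e < c)) -> cell M a e.
  move=> Ca az same; apply: sepset_cell => //.
  rewrite -subset0 => H [v [b [HE Mv va ve]]].
  have vu := only _ _ _ Ca az Mv va ve.
  have [k k0 [vE bE]] := hyperplane_eq (wall_neq0 arr Mu) (wall_neq0 arr Mv) (esym vu).
  move: va ve same; rewrite vE bE !dotZl.
  have [kp|kn|] := ltgtP k 0; last by move=> /eqP; rewrite (negbTE k0).
    by rewrite !ltr_nM2l// => h1 h2; rewrite h2 ltNge ltW.
  by rewrite !ltr_pM2l// => h1 h2; rewrite h1 ltNge ltW.
case: ifPn => ue; first by apply: main; rewrite // ud ue.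
by apply: main; rewrite // (negbTE ue) ltNge ltW.
Qed.

Lemma panel_sym d d' u c z : panel_between d d' u c z -> panel_between d' d (- u) (- c) z.
Proof.
move=> [[Cd Cd' Mu uz] /andP[ud ud'] uniq [dz d'z] sE]; split => //.
- by split => //; [exact: wallN|rewrite dotNl uz].
- by rewrite !dotNl !ltrN2 ud ud'.
- by move=> H MH Hz; rewrite hyperplaneN; exact: uniq.
- by rewrite hyperplaneN sepsetC.
Qed.

Lemma dE_panel d d' u c z y : panel_between d d' u c z -> in_chamber M y ->
  dot u y < c -> dE y d' = (dE y d).+1.
Proof.
move=> [[Cd Cd' Mu uz] /andP[ud ud'] uniq [dz d'z] sE] Cy uy.
have H0 : ~ sep y d (hyperplane u c).
  move=> -[v [b [vu Mv va ve]]].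
  have [k k0 [vE bE]] := hyperplane_eq (wall_neq0 arr Mu) (wall_neq0 arr Mv) vu.
  move: va ve; rewrite vE bE !dotZl.
  have [kp|kn|] := ltgtP k 0; last by move=> /eqP; rewrite (negbTE k0).
    by rewrite !ltr_nM2l// => h1 h2; lra.
  by rewrite !ltr_pM2l// => h1 h2; lra.
have : sep y d' = sep y d `|` [set hyperplane u c].
  apply/seteqP; split; first by rewrite -sE; exact: sepset_tri.
  move=> H [Hs|->]; last by exists u, c.
  have := sepset_tri Cd' Hs; rewrite sepsetC (sepsetC _ d' d) sE => -[|HE]; first by rewrite sepsetC.
  by move: H0; rewrite -HE.
rewrite /wall_dist => ->; rewrite ncardUI ?ncard1 ?addn1//; first exact: sep_finite.
by rewrite -subset0 => H [Hs HE]; move: H0; rewrite -HE.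
Qed.

Lemma cell_lt (N : set (set E)) x y u c : N (hyperplane u c) -> in_chamber N y ->
  cell N x y -> dot u x < c -> dot u y < c.
Proof.
move=> Nu Cy [xy _] ux; rewrite lt_neqAle xy ?ltW// andbT.
by apply/eqP; exact: (Cy _ Nu).
Qed.

Lemma cell_sym (N : set (set E)) x y : cell N x y -> cell N y x.
Proof. by case. Qed.

Lemma cell_trans (N : set (set E)) x y z : cell N x y -> cell N y z -> cell N x z.
Proof. by move=> [xy yx] [yz zy]; split=> u c Nu h; [apply/yz/xy|apply/yx/zy]. Qed.

Lemma cell_refl (N : set (set E)) x : cell N x x.
Proof. by split. Qed.

Lemma sep_cell x y z : in_chamber M x -> cell M x y -> sep x z = sep y z.
Proof.
move=> Cx xy; have Cy := M_cell_chamber Cx xy.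
apply/seteqP; split=> H [u [c [-> Mu h1 h2]]]; exists u, c; split => //.
  exact: cell_lt xy h1.
exact: cell_lt (cell_sym xy) h1.
Qed.

Lemma dE_cell x x' y y' : in_chamber M x -> in_chamber M y ->
  cell M x x' -> cell M y y' -> dE x y = dE x' y'.
Proof.
move=> Cx Cy xx yy; rewrite /wall_dist (sep_cell _ Cx xx) sepsetC.
by rewrite (sep_cell _ Cy yy) sepsetC.
Qed.

Lemma sep_between x y s : 0 <= s <= 1 ->
  sep x (y + s *: (x - y)) `<=` sep x y /\ sep (y + s *: (x - y)) y `<=` sep x y.
Proof.
move=> /andP[s0 s1]; split=> H [u [c [-> Mu h1 h2]]]; exists u, c; split => //.
- rewrite ltNge; apply/negP => uy; move: h2; rewrite dot_seg; nra.
- rewrite ltNge; apply/negP => ux; move: h1; rewrite dot_seg; nra.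
Qed.

Lemma dE_succ x y y' : in_chamber M x -> in_chamber M y -> in_chamber M y' ->
  dE y' y = 1%N -> sep y' y `<=` sep x y -> dE x y = (dE x y').+1.
Proof.
move=> Cx Cy Cy' yy sub; have [u [c [z P]]] := adjacent_panel Cy' Cy yy.
apply: (dE_panel P Cx); case: P => [[_ _ Mu _] /andP[uy' uy] _ _ sE].
have [v [b [E Mv h1 h2]]] : sep x y (hyperplane u c) by apply: sub; rewrite sE.
have [k k0 [vE bE]] := hyperplane_eq (wall_neq0 arr Mu) (wall_neq0 arr Mv) E.
move: h1 h2; rewrite vE bE !dotZl.
have [kp|kn|] := ltgtP k 0; last by move=> /eqP; rewrite (negbTE k0).
  by rewrite !ltr_nM2l// => h1 h2; lra.
by rewrite !ltr_pM2l.
Qed.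

(** The penultimate chamber of a minimal gallery. After a perturbation of [x] inside its chamber,
    the segment from [y] crosses the separating walls one at a time; [y'] is taken just after the
    first crossing. *)
Lemma last_step x y m : in_chamber M x -> in_chamber M y -> dE x y = m.+1 ->
  exists y', [/\ in_chamber M y', dE x y' = m, dE y' y = 1%N, sep x y' `<=` sep x y
                & sep y' y `<=` sep x y].
Proof.
move=> Cx Cy dxy; have [s sE] := (finite_seqP _).1 (sep_finite x y).
have rep_ex H : exists p : E * R, sep x y H ->
    [/\ H = hyperplane p.1 p.2, M H, dot p.1 x < p.2 & p.2 < dot p.1 y].
  have [[u [c [-> Mu h1 h2]]]|nH] := pselect (sep x y H); last by exists (0, 0).
  by exists (u, c).
have [rep repP] := choice rep_ex.
have memP H : (H \in s) <-> sep x y H by rewrite sE.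
have M0 H : sep x y H -> (rep H).1 != 0.
  by move=> /repP[HE MH _ _]; apply: (wall_neq0 arr (c := (rep H).2)); rewrite -HE.
pose f H := (rep H).2 - dot (rep H).1 y.
(* The segment leaving [y] in direction [e] meets [H] and [K] at the same parameter exactly when [e]
   is orthogonal to [N (H, K)]. *)
pose N (p : set E * set E) := f p.1 *: (rep p.2).1 - f p.2 *: (rep p.1).1.
pose us := [seq N p | p <- [seq p <- [seq (H, K) | H <- s, K <- s] | p.1 != p.2]].
have usP H K : sep x y H -> sep x y K -> H != K -> N (H, K) \in us.
  move=> /memP Hs /memP Ks HK; apply: map_f; rewrite mem_filter HK.
  by apply/allpairsP; exists (H, K).
have [|b bP] := @generic_vector _ _ us.
  move=> u /mapP[[H K]]; rewrite mem_filter /= => /andP[HK /allpairsP[[H' K'] /= [Hs Ks [? ?]]]].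
  subst H' K'; move: Hs Ks => /memP Hs /memP Ks ->.
  have [HE _ _ Hy] := repP _ Hs; have [KE _ _ Ky] := repP _ Ks.
  have fH : f H != 0 by rewrite /f subr_eq0 lt_eqF.
  apply: contra HK => /eqP; rewrite /N /= => /eqP; rewrite subr_eq0 => /eqP e.
  have e' : (rep K).1 = (f K / f H) *: (rep H).1.
    by apply: (scalerI fH); rewrite e scalerA mulrC divfK.
  have k0 : f K / f H != 0 by rewrite mulf_neq0 ?invr_eq0// /f subr_eq0 lt_eqF.
  rewrite HE KE e' -(hyperplaneZ (rep H).1 (rep H).2 k0); apply/eqP; congr hyperplane.
  have : f K = (f K / f H) * f H by rewrite divfK.
  by rewrite {1}/f {3}/f e' dotZl; lra.
have [e e0 ecell] := near_cell Cx.
have b0 : 0 < enorm b + 1 by rewrite ltr_wpDl ?enorm_ge0.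
(* The bound on [t] keeps [x'] in the chamber of [x]; the excluded values are those for which two
   separating walls would be crossed simultaneously. *)
have [t /andP[t0 te] tbad] := exists_notin [seq - dot u (x - y) / dot u b | u <- us] (divr_gt0 e0 b0).
pose x' := x + t *: b.
have xx' : cell M x x'.
  apply: ecell; rewrite /x' addrAC subrr add0r enormZ ger0_norm ?ltW//.
  move: te; rewrite ltr_pdivlMr//; apply: le_lt_trans.
  by apply: ler_wpM2l; [exact: ltW|rewrite lerDl].
have Cx' := M_cell_chamber Cx xx'.
have gen H K : sep x y H -> sep x y K -> H != K -> dot (N (H, K)) (x' - y) != 0.
  move=> Hs Ks HK; have Nus := usP _ _ Hs Ks HK; have Nb := bP _ Nus.
  apply: contraNneq tbad; rewrite /x' addrAC dotDr dotZr => h.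
  apply/mapP; exists (N (H, K)) => //; apply: (mulIf Nb); rewrite divfK//; lra.
have sepx' z : sep x' z = sep x z by rewrite (sep_cell _ Cx xx').
have repx' H : sep x y H -> dot (rep H).1 x' < (rep H).2.
  by move=> Hs; have [HE MH h _] := repP _ Hs; apply: (cell_lt _ Cx' xx' h); rewrite -HE.
(* The parameter at which the segment from [y] to [x'] crosses [H]. *)
pose r H := f H / dot (rep H).1 (x' - y).
have dneg H : sep x y H -> dot (rep H).1 (x' - y) < 0.
  by move=> Hs; have [_ _ _ h] := repP _ Hs; rewrite dotBr subr_lt0 (lt_trans (repx' _ Hs)).
have rP H : sep x y H -> [/\ 0 < r H, r H < 1 & f H = r H * dot (rep H).1 (x' - y)].
  move=> Hs; have [_ _ _ h] := repP _ Hs; have h' := repx' _ Hs.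
  have d0 := dneg _ Hs.
  rewrite /r divfK ?lt_eqF//; split => //.
    by rewrite -mulrNN -invrN divr_gt0 ?oppr_gt0// /f; lra.
  by rewrite ltr_ndivrMr// /f dotBr; lra.
have s0 : s != [::].
  by apply/eqP => s0; move: dxy; rewrite /wall_dist sE s0 (_ : [set` [::]] = set0) ?set_nil// /ncard fset_set0.
have [H0 /memP H0s H0min] := @seq_argmin R _ r s s0.
have [HE0 MH0 h0x h0y] := repP _ H0s; have [r0 r1 fr] := rP _ H0s.
set u0 := (rep H0).1 in HE0 h0x h0y fr; set c0 := (rep H0).2 in HE0 h0x h0y.
pose z := y + r H0 *: (x' - y).
have onz H a : sep x y H -> dot (rep H).1 (y + a *: (x' - y)) - (rep H).2 = (a - r H) * dot (rep H).1 (x' - y).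
  by move=> Hs; rewrite dotDr dotZr mulrBl; have [_ _ <-] := rP _ Hs; rewrite /f; lra.
have uniq K : M K -> K z -> K = H0.
  move=> MK Kz; have [v [d [v0 KE Mv]]] := wallP arr MK.
  have Ks : sep x y K.
    rewrite -sepx' sepsetC KE; apply: (sep_crossing (s := r H0)) => //; first by rewrite !ltW.
    by rewrite KE in Kz.
  have [KE' _ _ _] := repP _ Ks.
  have : dot (rep K).1 z - (rep K).2 = 0.
    have : hyperplane (rep K).1 (rep K).2 z by rewrite -KE'.
    by rewrite /hyperplane /= => ->; rewrite subrr.
  rewrite onz// => /eqP; rewrite mulf_eq0 (lt_eqF (dneg _ Ks)) orbF.
  rewrite subr_eq0 => /eqP rr; apply/eqP; case: eqP => // /eqP KH.
  have := gen _ _ Ks H0s KH; rewrite /N /= dotBl !dotZl fr.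
  by have [_ _ ->] := rP _ Ks; rewrite rr -/u0 (_ : _ - _ = 0) ?eqxx//; ring.
have [e1 e10 near1] := near_walls z.
have X0 : 0 < enorm (x' - y) + 1 by rewrite ltr_wpDl ?enorm_ge0.
have bnd : 0 < Num.min (1 - r H0) (e1 / (enorm (x' - y) + 1)) by rewrite lt_min subr_gt0 r1 divr_gt0.
(* An overshoot beyond the first crossing, too small to reach another wall or [x']. *)
have [d /andP[d0] ] := exists_notin [::] bnd; rewrite lt_min => /andP[d1 d2] _.
have close a : r H0 <= a <= r H0 + d -> enorm (y + a *: (x' - y) - z) < e1.
  move=> /andP[a0 a1]; rewrite seg_sub enormZ ger0_norm ?subr_ge0//.
  move: d2; rewrite ltr_pdivlMr//; apply: le_lt_trans; apply: ler_pM => //.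
  - by rewrite subr_ge0.
  - exact: enorm_ge0.
  - lra.
  - lra.
pose y' := y + (r H0 + d) *: (x' - y).
have u0y' : dot u0 y' < c0.
  by rewrite -subr_lt0 onz// addrAC subrr add0r pmulr_rlt0// dneg.
have Cy' : in_chamber M y'.
  move=> K MK Ky'; have KE : K = H0.
    by apply: uniq => //; apply: near1 Ky' _ => //; apply: close; rewrite lerDl lexx (ltW d0).
  by move: Ky'; rewrite KE HE0 /hyperplane /= => h; move: u0y'; rewrite h ltxx.
have [sub1 sub2] : sep x y' `<=` sep x y /\ sep y' y `<=` sep x y.
  by rewrite -!sepx'; apply: sep_between; rewrite addr_ge0 ?ltW//=; lra.
have sy : sep y' y = [set H0].
  apply/seteqP; split=> [K Ks|_ ->]; last by exists u0, c0; rewrite -HE0; split.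
  have Kxy := sub2 _ Ks; have [k0 k1 _] := rP _ Kxy; have [KE MK kx ky] := repP _ Kxy.
  have kx' := repx' _ Kxy.
  have Kr : r H0 <= r K by apply: H0min; apply/memP.
  have Kd : r K <= r H0 + d.
    rewrite leNgt; apply/negP => dK.
    have [v [q [vE Mv v1 v2]]] := Ks.
    have : dot (rep K).1 y' - (rep K).2 > 0.
      by rewrite onz// nmulr_lgt0 ?dneg// subr_lt0.
    rewrite subr_gt0 => h.
    rewrite KE in vE MK.
    have [k kn0 [vE' bE]] := hyperplane_eq (M0 _ Kxy) (wall_neq0 arr Mv) vE.
    move: v1 v2; rewrite vE' bE !dotZl.
    have [kp|kn|] := ltgtP k 0; last by move=> /eqP; rewrite (negbTE kn0).
      by rewrite !ltr_nM2l// => _ h2; move: (lt_trans ky h2); rewrite ltxx.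
    by rewrite !ltr_pM2l// => h1 _; move: (lt_trans h h1); rewrite ltxx.
  apply: uniq => //; apply: near1 (close (r K) _) => //; last by rewrite Kr.
  by rewrite {1}KE /hyperplane /=; apply/eqP; rewrite -subr_eq0 onz// subrr mul0r.
have dy : dE y' y = 1%N by rewrite /wall_dist sy ncard1.
exists y'; split => //; have := dE_succ Cx Cy Cy' dy sub2.
by rewrite dxy => -[].
Qed.

(** Along a minimal gallery, the reflection in the wall of each panel exchanges the two chambers on
    its sides. *)
Lemma W_transitive x y : in_chamber M x -> in_chamber M y ->
  exists2 w, W w & cell M (w x) y.
Proof.
move=> Cx Cy; move dxy: (dE x y) => m; elim: m y Cy dxy => [|m IH] y Cy dxy.
  by exists idfun; [exact: reflection_group_id|exact: dE0_cell].
have [y' [Cy' dxy' dyy _ _]] := last_step Cx Cy dxy.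
have [w Ww wx] := IH _ Cy' dxy'.
have [u [c [z P]]] := adjacent_panel Cy' Cy dyy.
have [[_ _ Mu uz] /andP[uy' uy] _ [y'z yz] _] := P.
have Wr := W_reflection arr Mu.
exists (reflection u c \o w); first exact: W_comp.
apply: (cell_trans (y := reflection u c y')) => /=; first exact/(W_cell arr _ _ Wr).
have Cr : in_chamber M (reflection u c y') by apply/(W_chamber arr _ Wr).
have rz : in_closed_cell M (reflection u c y') z.
  by rewrite -(reflection_id uz); apply/(W_closed_cell arr _ _ Wr).
apply: cell_sym; have := panel_cells P Cr rz; case: ifPn => //.
have := dot_reflection_normal c y' (wall_neq0 arr Mu) => h1 h2.
by clear IH dxy dxy' dyy; have : False by lra.
Qed.

(* [u] is the unit inward normal of a wall of the chamber of [x]. *)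
Definition chamber_normal x u : Prop :=
  dot u u = 1 /\ exists c p, [/\ M (hyperplane u c) /\ dot u p = c, c < dot u x,
    in_closed_cell M x p & forall H, M H -> H p -> H = hyperplane u c].

Lemma unit_parallel u c v d : dot u u = 1 -> dot v v = 1 ->
  hyperplane u c = hyperplane v d -> v = u \/ v = - u.
Proof.
move=> u1 v1 uv; have u0 : u != 0 by rewrite -dot_eq0 u1 oner_eq0.
have v0 : v != 0 by rewrite -dot_eq0 v1 oner_eq0.
have [k _ [vE _]] := hyperplane_eq u0 v0 uv.
move: v1; rewrite vE dotZl dotZr u1 mulr1 => /eqP; rewrite -expr2 sqrf_eq1.
by case/orP => /eqP ->; [left|right]; rewrite ?scale1r ?scaleN1r.
Qed.

(** Otherwise the second wall, reflected in the first one, would separate the chamber from the point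
    [q] of its own closure: [p] is fixed by the reflection and lies with [x] on one side, [q] on the
    other. *)
Lemma chamber_normal_obtuse x u v : in_chamber M x -> chamber_normal x u ->
  chamber_normal x v -> u != v -> dot u v <= 0.
Proof.
move=> Cx [u1 [c [p [[Mu up] ux xp uniqp]]]] [v1 [d [q [[Mv vq] vx xq uniqq]]]] uv.
have HK : hyperplane u c <> hyperplane v d.
  move=> e; have [vu|vu] := unit_parallel u1 v1 e; first by move: uv; rewrite vu eqxx.
  have := hyperplane_eq (wall_neq0 arr Mu) (wall_neq0 arr Mv) e.
  move=> [k _ [kv kc]]; have k1 : k = -1.
    have : dot u v = k by rewrite kv dotZr u1 mulr1.
    by rewrite vu dotNr u1 => <-.
  by move: vx; rewrite vu kc k1 dotNl mulN1r ltrN2; rewrite ltNge ltW.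
have far a b y : M (hyperplane a b) -> b < dot a x -> in_closed_cell M x y ->
    ~ hyperplane a b y -> b < dot a y.
  move=> Ma ax xy nay; have := xy _ _ (wallN Ma); rewrite !dotNl !lerN2 => /(_ (ltW ax)).
  by rewrite le_eqVlt => /orP[/eqP e|//]; case: nay; rewrite /hyperplane /= -e.
have vp : d < dot v p by apply: far => // vp; apply: HK; rewrite -(uniqp _ Mv vp).
have uq : c < dot u q by apply: far => // uq; apply: HK; rewrite -(uniqq _ Mu uq).
rewrite leNgt; apply/negP => uv0.
have Ws := W_reflection arr Mu; have sK := reflectionK c (wall_neq0 arr Mu).
have Ma := W_wall arr Ws Mv; set a := lin _ _ in Ma; set b := d + _ in Ma.
have side y : dot a y - b = dot v (reflection u c y) - d.
  by rewrite /a (W_dotK v y Ws sK) /b; lra.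
have ap : b < dot a p by rewrite -subr_gt0 side (reflection_id up) subr_gt0.
have ax : b < dot a x.
  by rewrite ltNge; apply/negP => ax; have := xp _ _ Ma ax; rewrite leNgt ap.
have := xq _ _ (wallN Ma); rewrite !dotNl !lerN2 => /(_ (ltW ax)).
rewrite -subr_ge0 side dot_reflection u1 vq (dotC v u); nra.
Qed.

(** Unit vectors forming pairwise nonacute angles are at distance at least [sqrt 2], hence
    separated. *)
Lemma chamber_normals_finite x : in_chamber M x -> finite_set (chamber_normal x).
Proof.
move=> Cx; apply: (@separated_finite _ _ _ 1) => // [u [u1 _]|u v Nu Nv].
  by rewrite /enorm u1 sqrtr1.
have [-> //|uv] := eqVneq u v; have := chamber_normal_obtuse Cx Nu Nv uv.
have [u1 _] := Nu; have [v1 _] := Nv => uv0.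
rewrite ltNge => /negP[]; rewrite -(@ler_pXn2r _ 2)// ?nnegrE ?enorm_ge0//.
by rewrite sqr_enorm expr1n !dotS (dotC v u); lra.
Qed.

Lemma chamber_normal_cell x y u : in_chamber M x -> cell M x y ->
  chamber_normal x u -> chamber_normal y u.
Proof.
move=> Cx xy [u1 [c [p [[Mu up] ux xp uniqp]]]]; split => //; exists c, p; split => //.
  have := cell_lt (wallN Mu) (M_cell_chamber Cx xy) xy.
  by rewrite !dotNl !ltrN2; exact.
by move=> v d Mv vy; apply: xp => //; have [_] := xy; apply.
Qed.

Lemma chamber_normal_W x u w : W w -> chamber_normal x u -> chamber_normal (w x) (lin w u).
Proof.
move=> Ww [u1 [c [p [[Mu up] ux xp uniqp]]]]; split; first by rewrite (W_lin_dot _ _ Ww).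
have [w' [Ww' ww' w'w]] := W_inv arr Ww.
exists (c + dot (lin w u) (w 0)), (w p); split.
- by split; [exact: W_wall|rewrite (W_dot _ _ Ww) ?up].
- by rewrite (W_dot u x Ww) ltrD2r.
- exact/(W_closed_cell arr _ _ Ww).
- move=> H MH Hp.
  have p' : (w' @` H) p by exists (w p).
  have e := uniqp _ (W_image arr Ww' MH) p'.
  have -> : H = w @` (w' @` H).
    by rewrite image_comp (_ : _ \o _ = id) ?image_id//; apply/funext => a /=; rewrite w'w.
  rewrite e; apply/seteqP; split => [_ [a /= <- <-]|a]; rewrite /hyperplane /=.
    by rewrite (W_dot _ _ Ww).
  by move=> h; exists (w' a) => //; move: h; rewrite -{1}(w'w a) (W_dot _ _ Ww) => /addIr.
Qed.

Lemma near_same_side q (e : R) : (forall H y, M H -> H y -> enorm (y - q) < e -> H q) ->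
  forall y y' v b, enorm (y - q) < e -> enorm (y' - q) < e -> M (hyperplane v b) ->
  dot v q != b -> dot v y <= b -> dot v y' <= b.
Proof.
move=> /avoid_closed_cell near y y' v b ye ye' Mv vq vy.
have := near _ ye _ _ Mv vy; rewrite le_eqVlt (negbTE vq)/= => vq'.
rewrite leNgt; apply/negP => vy'.
have := near _ ye' _ _ (wallN Mv); rewrite !dotNl !lerN2 => /(_ (ltW vy')).
by rewrite leNgt vq'.
Qed.

(* Among the chambers at a generic point of the intersection of two walls, one
   has the first wall as a wall; the other wall through that point is the one
   making the smallest angle with it. *)
Lemma dihedral_chamber u1 c1 u2 c2 : M (hyperplane u1 c1) -> M (hyperplane u2 c2) ->
  dot u1 u1 = 1 -> dot u2 u2 = 1 -> u2 != u1 -> u2 != - u1 ->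
  exists d u3, [/\ in_chamber M d, chamber_normal d u1, chamber_normal d u3,
    dot u1 u3 <= dot u1 u2 & -1 < dot u1 u3].
Proof.
move=> M1 M2 u11 u22 u21 u21'; set g := dot u1 u2.
have b20 : 0 < dot (u2 - g *: u1) (u2 - g *: u1).
  rewrite dot_gt0 subr_eq0; apply/eqP => ug; move: u22.
  rewrite ug dotZl dotZr u11 mulr1 => /eqP; rewrite -expr2 sqrf_eq1.
  by case/orP => /eqP g1; move: u21 u21'; rewrite ug g1 ?scale1r ?scaleN1r eqxx.
set b2 := Num.sqrt (dot (u2 - g *: u1) (u2 - g *: u1)).
have b2p : 0 < b2 by rewrite sqrtr_gt0.
have b2E : b2 ^+ 2 = 1 - g ^+ 2.
  by rewrite sqr_sqrtr ?ltW// !dotS u11 u22 (dotC u2 u1) -/g; ring.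
(* The vectors [u1] and [e2] form an orthonormal basis of the plane of the two normals; [g] and [b2]
   are the cosine and the sine of their angle. *)
have [e2 [u2E e22 e12]] : exists e2, [/\ u2 = g *: u1 + b2 *: e2, dot e2 e2 = 1 & dot u1 e2 = 0].
  exists (b2^-1 *: (u2 - g *: u1)); split.
  - by rewrite scalerA mulfV ?gt_eqF// scale1r addrC subrK.
  - have : dot (u2 - g *: u1) (u2 - g *: u1) = b2 ^+ 2 by rewrite sqr_sqrtr ?ltW.
    by rewrite dotZl dotZr => ->; rewrite expr2 mulKf ?gt_eqF// mulVf// gt_eqF.
  - by rewrite dotZr dotBr dotZr u11 mulr1 -/g subrr mulr0.
have e21 : dot e2 u1 = 0 by rewrite dotC.
pose q0 := c1 *: u1 + ((c2 - g * c1) / b2) *: e2.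
have q01 : dot u1 q0 = c1 by rewrite !dotS u11 e12; ring.
have q02 : dot u2 q0 = c2.
  by rewrite {1}u2E !dotS u11 e12 e21 e22; field; rewrite gt_eqF.
pose perp v := v - dot u1 v *: u1 - dot e2 v *: e2.
have perp_dot v b : dot v (perp b) = dot (perp v) b.
  by rewrite !dotS (dotC v u1) (dotC v e2); ring.
have perp1 b : dot u1 (perp b) = 0 by rewrite !dotS u11 e12; ring.
have perp2 b : dot u2 (perp b) = 0 by rewrite u2E !dotS u11 e12 e21 e22; ring.
have [ea ea0 nearq0] := near_walls q0.
(* A direction orthogonal to the plane and generic in this respect: a wall through [q0] containing
   it must have its normal in the plane. Moving [q0] slightly along [rr] leaves all the other
   walls. *)
have [rr [rr1 rr2 rrP]] : exists r, [/\ dot u1 r = 0, dot u2 r = 0 & forall v b,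
    M (hyperplane v b) -> dot v q0 = b -> dot v r = 0 -> perp v = 0].
  have fin : finite_set [set H | M H /\ H q0].
    case: (arr) => _ /(_ q0)[e0 e00 fin] _ _ _; apply: sub_finite_set fin => H [MH Hq].
    by split => //; exists q0 => //; rewrite subrr enorm0.
  have [s sE] := (finite_seqP _).1 fin.
  have nu_ex H : exists u : E, M H -> exists c, u != 0 /\ H = hyperplane u c.
    have [/(wallP arr)[u [c [u0 HE _]]]|nH] := pselect (M H); last by exists 0.
    by exists u => _; exists c.
  have [nu nuP] := choice nu_ex.
  have [|b bP] := @generic_vector _ _ [seq v <- [seq perp (nu H) | H <- s] | v != 0].
    by move=> u; rewrite mem_filter => /andP[].
  exists (perp b); split => // v d Mv vq; rewrite perp_dot => vb.
  have Hs : hyperplane v d \in s by have : [set` s] (hyperplane v d) by rewrite -sE.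
  have [c [nu0 HE]] := nuP _ Mv; set a := nu _ in nu0 HE.
  have [k k0 [vE _]] := hyperplane_eq nu0 (wall_neq0 arr Mv) (esym HE).
  have perpZ x : perp (k *: x) = k *: perp x.
    by rewrite /perp !dotZr !scalerBr !scalerA.
  move: vb; rewrite vE perpZ dotZl => /eqP; rewrite mulf_eq0 (negbTE k0)/= => ab.
  apply/eqP; rewrite scaler_eq0; apply/orP; right; apply: contraLR ab => pa0.
  apply: bP; rewrite mem_filter pa0; apply/mapP; exists (hyperplane v d) => //.
have [t /andP[t0 te] _] := exists_notin [::] (divr_gt0 ea0 (ltr_wpDl (enorm_ge0 rr) ltr01)).
pose q := q0 + t *: rr.
have qq0 : enorm (q - q0) < ea.
  rewrite /q addrAC subrr add0r enormZ ger0_norm ?ltW//.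
  move: te; rewrite ltr_pdivlMr ?ltr_wpDl ?enorm_ge0//; apply: le_lt_trans.
  by apply: ler_wpM2l; [exact: ltW|rewrite lerDl].
have q1 : dot u1 q = c1 by rewrite dotDr dotZr rr1 mulr0 addr0.
have q2 : dot u2 q = c2 by rewrite dotDr dotZr rr2 mulr0 addr0.
have qP v b : M (hyperplane v b) -> dot v q = b -> v = dot u1 v *: u1 + dot e2 v *: e2.
  move=> Mv vq; have vq0 : dot v q0 = b := nearq0 _ _ Mv vq qq0.
  have : t * dot v rr = 0.
    by have := vq; rewrite dotDr vq0 dotZr => /eqP; rewrite -subr_eq0 addrAC subrr add0r => /eqP.
  move=> /eqP; rewrite mulf_eq0 (gt_eqF t0)/= => /eqP /(rrP _ _ Mv vq0) /eqP.
  by rewrite /perp -addrA -opprD subr_eq0 => /eqP.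
clearbody q.
have [eb eb0 nearq] := near_walls q.
have fin : finite_set [set H | (M H /\ H q) /\ H <> hyperplane u1 c1].
  case: (arr) => _ /(_ q)[e0 e00 fin] _ _ _; apply: sub_finite_set fin => H [[MH Hq] _].
  by split => //; exists q => //; rewrite subrr enorm0.
have [s sE] := (finite_seqP _).1 fin.
have memP H : (H \in s) <-> (M H /\ H q) /\ H <> hyperplane u1 c1.
  by split => [Hs|hH]; [have : [set` s] H by []|suff : [set` s] H by []]; rewrite -sE.
(* Each wall through [q] other than the first gets a unit equation whose [e2] component is positive.
   The [ratio] below is then the cotangent of the angle between its normal and [u1]. *)
have rep_ex H : exists p : E * R, H \in s -> [/\ H = hyperplane p.1 p.2, dot p.1 p.1 = 1 & 0 < dot e2 p.1].
  have [Hs|nH] := boolP (H \in s); last by exists (0, 0).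
  have [[MH Hq] H1] := (memP _).1 Hs; have [v [b [v0 HE Mv]]] := wallP arr MH.
  rewrite HE in Hq H1; have vE := qP _ _ Mv Hq.
  have ev0 : dot e2 v != 0.
    apply/eqP => ev; apply: H1; rewrite ev scale0r addr0 in vE.
    have k0 : dot u1 v != 0 by apply: contraNneq v0 => h; rewrite vE h scale0r.
    rewrite -(hyperplaneZ u1 c1 k0) -vE; congr hyperplane.
    by rewrite -Hq {1}vE dotZl q1.
  pose k := Num.sg (dot e2 v) / enorm v.
  have nv : enorm v != 0 by rewrite enorm_eq0.
  have k0 : k != 0 by rewrite mulf_neq0 ?invr_eq0// sgr_eq0.
  exists (k *: v, k * b) => _; rewrite /= hyperplaneZ//; split => //.
    rewrite dotZl dotZr -sqr_enorm /k.
    have -> : forall a b : R, a / b * (a / b * b ^+ 2) = a ^+ 2 * (b / b) ^+ 2 by move=> *; ring.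
    by rewrite mulfV// expr1n mulr1 sqr_sg ev0.
  by rewrite dotZr /k mulrAC -normrEsg divr_gt0 ?normr_gt0// enorm_gt0.
have [rep repP] := choice rep_ex.
pose ratio H := dot u1 (rep H).1 / dot e2 (rep H).1.
have H2s : hyperplane u2 c2 \in s.
  apply/memP; split => // e; have [h|h] := unit_parallel u22 u11 e.
    by move: u21; rewrite h eqxx.
  by move: u21'; rewrite h opprK eqxx.
have [|H3 H3s H3min] := @seq_argmin R _ ratio s; first by apply/eqP => s0; rewrite s0 in H2s.
have [H3E u33 b3p] := repP _ H3s.
set u3 := (rep H3).1 in H3E u33 b3p; set c3 := (rep H3).2 in H3E.
pose r3 := ratio H3.
have pE v b (y1 y2 : R) : M (hyperplane v b) -> dot v q = b ->
    dot v (q + (y1 *: u1 + y2 *: e2)) = b + (y1 * dot u1 v + y2 * dot e2 v).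
  by move=> Mv vq; rewrite !dotDr vq !dotZr (dotC v u1) (dotC v e2).
(* The points used below satisfy [|y1| + |y2| <= |r3| + 2], so the scale [ep] keeps them in the ball
   where only walls through [q] occur. *)
have B0 : 0 < `|r3| + 3 by rewrite ltr_wpDl.
have [ep /andP[ep0 epb] _] := exists_notin [::] (divr_gt0 eb0 B0).
have e2n : enorm e2 = 1 by rewrite /enorm e22 sqrtr1.
have u1n : enorm u1 = 1 by rewrite /enorm u11 sqrtr1.
have close (y1 y2 : R) : `|y1| <= 1 -> `|y2| <= `|r3| + 1 ->
    enorm (q + ((ep * y1) *: u1 + (ep * y2) *: e2) - q) < eb.
  move=> h1 h2; rewrite addrAC subrr add0r -!scalerA -scalerDr enormZ gtr0_norm//.
  move: epb; rewrite ltr_pdivlMr//; apply: le_lt_trans; apply: ler_wpM2l; first exact: ltW.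
  apply: le_trans (enormD _ _) _; rewrite !enormZ u1n e2n !mulr1.
  lra.
pose pt (y1 y2 : R) := q + ((ep * y1) *: u1 + (ep * y2) *: e2).
have repM H : H \in s -> M (hyperplane (rep H).1 (rep H).2) /\ dot (rep H).1 q = (rep H).2.
  move=> Hs; have [HE _ _] := repP _ Hs; have [[MH Hq] _] := (memP _).1 Hs.
  have Hq' : hyperplane (rep H).1 (rep H).2 q by rewrite -HE.
  by rewrite -HE.
have ptE H (y1 y2 : R) : H \in s ->
    dot (rep H).1 (pt y1 y2) - (rep H).2 = ep * dot e2 (rep H).1 * (y1 * ratio H + y2).
  move=> Hs; have [MH Hq] := repM _ Hs; have [_ _ h] := repP _ Hs.
  by rewrite /pt (pE _ _ _ _ MH Hq) /ratio; field; rewrite gt_eqF.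
have pt1 (y1 y2 : R) : dot u1 (pt y1 y2) - c1 = ep * y1.
  by rewrite /pt (pE _ _ _ _ M1 q1) u11 e21; ring.
have r3n : `|- r3| <= `|r3| + 1 by rewrite normrN lerDl.
have r3n' : `|1 - r3| <= `|r3| + 1 by rewrite addrC -[X in _ <= _ + X]normr1 -(normrN r3) ler_normD.
have n01 : `|0 : R| <= 1 by rewrite normr0.
have n11 : `|1 : R| <= `|r3| + 1 by rewrite normr1 lerDr.
have n1 : `|1 : R| <= 1 by rewrite normr1.
(* At [pt y1 y2] the wall [H] takes a value of the sign of [y1 * ratio H + y2], and the first wall
   that of [y1]. Hence [d] is in the open chamber, [z1] on its panel in the first wall, and [z3] on
   its panel in the wall of minimal ratio. *)
pose d := pt 1 (1 - r3); pose z1 := pt 0 1; pose z3 := pt 1 (- r3).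
have cases K : M K -> K q -> K = hyperplane u1 c1 \/ K \in s.
  by move=> MK Kq; have [|K1] := pselect (K = hyperplane u1 c1); [left|right; apply/memP].
have pos H (y : R) : H \in s -> 0 < y -> 0 < ep * dot e2 (rep H).1 * y.
  by move=> Hs y0; have [_ _ h] := repP _ Hs; rewrite !mulr_gt0.
have inH H y : H \in s -> H y -> dot (rep H).1 y - (rep H).2 = 0.
  move=> Hs Hy; have [HE _ _] := repP _ Hs.
  have : hyperplane (rep H).1 (rep H).2 y by rewrite -HE.
  by rewrite /hyperplane /= => ->; rewrite subrr.
have Cd : in_chamber M d.
  move=> K MK Kd; have Kq : K q := nearq _ _ MK Kd (close _ _ n1 r3n').
  have [KE|Ks] := cases _ MK Kq.
    rewrite KE in Kd; have := pt1 1 (1 - r3); rewrite -/d Kd subrr mulr1 => h.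
    by move: ep0; rewrite -h ltxx.
  have := ptE _ 1 (1 - r3) Ks; rewrite -/d (inH _ _ Ks Kd) mul1r => h.
  have h3 : r3 <= ratio K by exact: H3min.
  have : 0 < ratio K + (1 - r3) by rewrite addrCA ltr_wpDr// subr_ge0.
  by move=> /(pos _ _ Ks); rewrite -h ltxx.
have side (y1 y2 : R) : `|y1| <= 1 -> `|y2| <= `|r3| + 1 -> 0 <= y1 -> 0 <= y1 * r3 + y2 ->
    in_closed_cell M d (pt y1 y2).
  move=> h1 h2 y10 y12 v b Mv vd.
  have [vq|vq] := eqVneq (dot v q) b; last first.
    by apply: (near_same_side nearq (close _ _ n1 r3n') (close _ _ h1 h2) Mv vq vd).
  have [vE|Ks] := cases _ Mv vq.
    have [k k0 [va vb]] := hyperplane_eq (wall_neq0 arr M1) (wall_neq0 arr Mv) (esym vE).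
    move: vd; rewrite va vb !dotZl -subr_le0 -(subr_le0 (_ * _)) -!mulrBr pt1 -/d /d pt1.
    rewrite mulr1 pmulr_lle0// => k1; rewrite nmulr_rle0; last by rewrite lt_neqAle k0.
    by apply: mulr_ge0 => //; exact: ltW.
  have [HE _ hp] := repP _ Ks; have [MH Hq] := repM _ Ks; set K := hyperplane v b in Ks HE hp MH Hq.
  have [k k0 [va vb]] := hyperplane_eq (wall_neq0 arr MH) (wall_neq0 arr Mv) (esym HE).
  move: vd; rewrite va vb !dotZl -subr_le0 -(subr_le0 (_ * _)) -!mulrBr ptE// -/d /d ptE//.
  have h3 := H3min _ Ks; rewrite -/r3 in h3.
  rewrite pmulr_lle0; last by apply: pos => //; rewrite mul1r addrCA ltr_wpDr// subr_ge0.
  move=> k1; rewrite nmulr_rle0; last by rewrite lt_neqAle k0.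
  apply: mulr_ge0; first by rewrite mulr_ge0// ltW.
  by apply: le_trans y12 _; rewrite lerD2r ler_wpM2l.
have N1 : chamber_normal d u1.
  split => //; exists c1, z1; split.
  - by split => //; apply/eqP; rewrite -subr_eq0 pt1 mulr0.
  - by rewrite -subr_gt0 pt1 mulr1.
  - by apply: side; rewrite // mul0r add0r.
  move=> K MK Kz; have Kq : K q := nearq _ _ MK Kz (close _ _ n01 n11).
  have [//|Ks] := cases _ MK Kq.
  have := ptE _ 0 1 Ks; rewrite -/z1 (inH _ _ Ks Kz) mul0r add0r => h.
  by have := pos _ 1 Ks ltr01; rewrite -h ltxx.
have [M3 q3] := repM _ H3s; rewrite -/u3 -/c3 in M3 q3.
have e3 : dot u1 u3 ^+ 2 + dot e2 u3 ^+ 2 = 1.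
  have := congr1 (dot u3) (qP _ _ M3 q3).
  by rewrite u33 dotDr !dotZr (dotC u3 u1) (dotC u3 e2) !expr2 => <-.
have N3 : chamber_normal d u3.
  split => //; exists c3, z3; split.
  - by split => //; apply/eqP; rewrite -subr_eq0 ptE// -/r3 mul1r subrr mulr0.
  - by rewrite -subr_gt0 ptE// -/r3; apply: pos => //; rewrite mul1r addrCA subrr addr0.
  - by apply: side; rewrite // mul1r subrr.
  move=> K MK Kz; have Kq : K q := nearq _ _ MK Kz (close _ _ n1 r3n).
  have [KE|Ks] := cases _ MK Kq.
    rewrite KE in Kz; have := pt1 1 (- r3); rewrite -/z3 Kz subrr mulr1 => h.
    by move: ep0; rewrite -h ltxx.
  have [HE uK bK] := repP _ Ks; have [MH Hq] := repM _ Ks.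
  have := ptE _ 1 (- r3) Ks; rewrite -/z3 (inH _ _ Ks Kz) mul1r => /esym/eqP.
  rewrite mulf_eq0 mulf_eq0 (gt_eqF ep0) (gt_eqF bK)/= subr_eq0 => /eqP rK.
  have k0 : dot e2 (rep K).1 / dot e2 u3 != 0 by rewrite mulf_neq0 ?invr_eq0// gt_eqF.
  have KE : (rep K).1 = (dot e2 (rep K).1 / dot e2 u3) *: u3.
    transitivity ((dot e2 (rep K).1 / dot e2 u3) *: (dot u1 u3 *: u1 + dot e2 u3 *: e2)); last by rewrite -(qP _ _ M3 q3).
    rewrite [LHS](qP _ _ MH Hq) scalerDr !scalerA divfK ?gt_eqF//.
    congr (_ *: _ + _); have : dot u1 (rep K).1 = ratio K * dot e2 (rep K).1 by rewrite divfK// gt_eqF.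
    by move=> ->; rewrite rK /r3 /ratio -/u3; field; rewrite gt_eqF.
  rewrite HE {1}KE -(hyperplaneZ u3 c3 k0); congr hyperplane.
  by rewrite -Hq {1}KE dotZl q3.
exists d, u3; split => //.
- have h := H3min _ H2s; have [HE uH bH] := repP _ H2s; have [MH Hq] := repM _ H2s.
  set v := (rep _).1 in HE uH bH MH Hq.
  have vE : v = u2.
    have [h1|h1] := unit_parallel u22 uH HE; first by [].
    by move: bH; rewrite h1 dotNr u2E !dotS e21 e22 mulr0 add0r mulr1 oppr_gt0 ltNge ltW.
  have u2b : dot e2 u2 = b2 by rewrite u2E !dotS e21 e22; ring.
  move: h; rewrite /ratio -/v vE -/u3 -/g u2b ler_pdivlMr// mulrAC ler_pdivrMr// => h.
  exact: (unit_circle_le b2p b3p b2E e3 h).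
- exact: (unit_circle_gtN1 b3p e3).
Qed.

(** A regular direction is parallel to no wall, so it leaves at once all walls through [z], and a
    small ball meets no others. *)
Lemma regular_near v0 z : in_chamber L v0 -> exists2 e : R, 0 < e &
  forall t, 0 < t < e -> in_chamber M (z + t *: v0) /\ in_closed_cell M (z + t *: v0) z.
Proof.
move=> /(L_chamberP arr) Cv0; have [e e0 near] := near_walls z.
have X0 : 0 < enorm v0 + 1 by rewrite ltr_wpDl ?enorm_ge0.
exists (e / (enorm v0 + 1)); first exact: divr_gt0.
move=> t /andP[t0 te].
have zt : enorm (z + t *: v0 - z) < e.
  rewrite addrAC subrr add0r enormZ gtr0_norm//; move: te; rewrite ltr_pdivlMr//.
  by apply: le_lt_trans; apply: ler_wpM2l; [exact: ltW|rewrite lerDl].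
split; last exact: avoid_closed_cell zt.
move=> H MH Hz; have [u [c [u0 HE Mu]]] := wallP arr MH.
have := near _ _ MH Hz zt; move: Hz; rewrite HE /hyperplane /= dotDr dotZr => + uz.
rewrite uz => /eqP; rewrite -subr_eq0 addrAC subrr add0r mulf_eq0 (gt_eqF t0)/=.
exact/negP/Cv0/(L_wall arr Mu).
Qed.

(* By [dihedral_chamber] and the transitivity on chambers, the angles between
   nonparallel walls are bounded below by those between the finitely many walls
   of one chamber. *)
Lemma L_finite v0 : in_chamber L v0 -> finite_set L.
Proof.
move=> Cv0; have [e e0 /(_ (e / 2))] := regular_near 0 Cv0.
rewrite divr_gt0//= ltr_pdivrMr// ltr_pMr ?ltr1n// => /(_ isT)[Cx _].
set x := _ + _ in Cx.
have fN := chamber_normals_finite Cx.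
pose V := [set t | exists u v, [/\ chamber_normal x u, chamber_normal x v & t = dot u v]].
have [s sE] : exists s : seq R, forall t, V t -> t \in s.
  have fV : finite_set V.
    apply: (@sub_finite_set _ _ ((fun p : E * E => dot p.1 p.2) @` (chamber_normal x `*` chamber_normal x))).
      by move=> t [u [v [Nu Nv ->]]]; exists (u, v).
    by apply: finite_image; apply: finite_setX.
  by have [s sE] := (finite_seqP _).1 fV; exists s => t; rewrite sE.
(* The gap between [-1] and the finitely many other cosines of angles between normals of the
   reference chamber. *)
have [d d0 dP] : exists2 d, 0 < d & forall t, V t -> -1 < t -> d <= t + 1.
  suff [d d0 dP] : exists2 d : R, 0 < d & forall t, t \in s -> -1 < t -> d <= t + 1.
    by exists d => // t /sE; exact: dP.
  elim: (s) => [|t s' [d d0 IH]]; first by exists 1.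
  exists (if -1 < t then Num.min d (t + 1) else d); first by case: ifPn => // t1; rewrite lt_min d0/=; lra.
  move=> t'; rewrite inE => /orP[/eqP ->|t's] t1; first by rewrite t1 ge_min lexx orbT.
  by case: ifPn => _; rewrite ?ge_min IH.
have fS : finite_set [set u | dot u u = 1 /\ exists c, M (hyperplane u c)].
  apply: (@separated_finite _ _ _ (Num.min d 1)); first by rewrite lt_min d0 ltr01.
    by move=> u [u1 _]; rewrite /enorm u1 sqrtr1.
  move=> u v [u1 [c Mu]] [v1 [b Mv]] uv; apply/eqP; apply: contraLR uv => uv.
  rewrite -leNgt -(@ler_pXn2r _ 2)// ?nnegrE ?enorm_ge0//; last by rewrite le_min ltW/=.
  rewrite sqr_enorm !dotS u1 v1 (dotC v u).
  have m1 : Num.min d 1 ^+ 2 <= Num.min d 1.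
    have m0 : 0 <= Num.min d 1 by rewrite le_min ler01 ltW.
    by rewrite expr2 ler_piMl// ge_min lexx orbT.
  have m2 : Num.min d 1 <= 1 by rewrite ge_min lexx orbT.
  have m3 : Num.min d 1 <= d by rewrite ge_min lexx.
  have [uv'|uv'] := eqVneq u (- v).
    by rewrite uv' dotNl v1; lra.
  have v1' : dot (- v) (- v) = 1 by rewrite dotNl dotNr opprK.
  have nuv : - v != - u by rewrite eqr_opp eq_sym.
  have nuv' : - v != u by rewrite eq_sym.
  (* Applied to [u] and [- v]: carried to the reference chamber, it gives [dot u v <= 1 - d], so
     that [u] and [v] cannot be close. *)
  have [y [u3 [Cy Nu Nu3 le gt]]] := dihedral_chamber Mu (wallN Mv) u1 v1' nuv' nuv.
  have [w Ww wy] := W_transitive Cy Cx.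
  have Cwy : in_chamber M (w y) by apply/(W_chamber arr).
  have /dP : V (dot u u3).
    exists (lin w u), (lin w u3); split; last by rewrite (W_lin_dot _ _ Ww).
      exact: (chamber_normal_cell Cwy wy (chamber_normal_W Ww Nu)).
    exact: (chamber_normal_cell Cwy wy (chamber_normal_W Ww Nu3)).
  by move=> /(_ gt) dl; move: le; rewrite dotNr; lra.
apply: sub_finite_set (finite_image (fun u : E => hyperplane u 0) fS).
move=> H [u [c [u0 Mu ->]]].
have k0 : (enorm u)^-1 != 0 by rewrite invr_eq0 enorm_eq0.
exists ((enorm u)^-1 *: u); last by rewrite -{1}(mulr0 (enorm u)^-1) hyperplaneZ.
split; last by exists ((enorm u)^-1 * c); rewrite hyperplaneZ.
by rewrite dotZl dotZr -sqr_enorm expr2 mulKf ?mulVf ?enorm_eq0.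
Qed.

Variable v0 : E.
Hypothesis Cv0 : in_chamber L v0.

Lemma sep_rep (N : set (set E)) x y u c : u != 0 -> sepset N x y (hyperplane u c) ->
  (dot u x < c /\ c < dot u y) \/ (c < dot u x /\ dot u y < c).
Proof.
move=> u0 [v [b [uv Nv h1 h2]]].
have [k k0 [vk bk]] := hyperplane_eq u0 (hyperplane_neq0 u0 uv) uv.
move: h1 h2; rewrite vk bk !dotZl.
have [kn|kp|/eqP] := ltgtP k 0; last by rewrite (negbTE k0).
  by rewrite !ltr_nM2l//; right.
by rewrite !ltr_pM2l//; left.
Qed.

Lemma L_rep H : L H -> exists u, [/\ u != 0, H = hyperplane u 0 & L (hyperplane u 0)].
Proof. by move=> [u [c [u0 Mu ->]]]; exists u; split => //; exact: L_wall Mu. Qed.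

(** Finiteness of [L] gives one radius for all linear walls, although they all pass through the
    origin. *)
Lemma near_linear z : exists2 e : R, 0 < e &
  forall H y, L H -> H y -> enorm (y - z) < e -> H z.
Proof.
have [s sE] := (finite_seqP _).1 (L_finite Cv0).
have [|e e0 es] := @hyperplanes_avoid _ _ s z.
  move=> H Hs; have [|u [u0 -> _]] := @L_rep H; last by exists u, 0.
  by rewrite sE.
exists e => // H y LH Hy ye; apply: (es H _ y) => //.
by have : [set` s] H by rewrite -sE.
Qed.

Lemma near_direction v : in_chamber L v -> exists2 e : R, 0 < e &
  forall y, enorm (y - v) < e -> cell L v y.
Proof.
move=> Cv; have [e e0 /avoid_closed_cell near] := near_linear v; exists e => // y /near yv.
split => // u c Lu uv; rewrite leNgt; apply/negP => uy.
have Lu' : L (hyperplane (- u) (- c)) by rewrite hyperplaneN.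
have := yv _ _ Lu'; rewrite !dotNl !lerN2 => /(_ (ltW uy)) cu.
by apply: (Cv _ Lu); apply/eqP; rewrite eq_le uv.
Qed.

Lemma L_cell_chamber v y : in_chamber L v -> cell L v y -> in_chamber L y.
Proof.
by apply: cell_chamber => H [u [c [_ _ ->]]]; exists u, 0.
Qed.

Lemma direction_cover z : exists2 v, in_chamber L v & in_closed_cell L v z.
Proof.
have [e e0 near] := near_linear z.
have X0 : 0 < enorm v0 + 1 by rewrite ltr_wpDl ?enorm_ge0.
have [t /andP[t0 te] _] := exists_notin [::] (divr_gt0 e0 X0).
have zt : enorm (z + t *: v0 - z) < e.
  rewrite addrAC subrr add0r enormZ gtr0_norm//; move: te; rewrite ltr_pdivlMr//.
  by apply: le_lt_trans; apply: ler_wpM2l; [exact: ltW|rewrite lerDl].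
exists (z + t *: v0); last exact: avoid_closed_cell near _ zt.
apply/(L_chamberP arr) => u Lu; apply/eqP => ut.
have uz : dot u z = 0 := near _ _ Lu ut zt.
move: ut; rewrite dotDr uz add0r dotZr => /eqP; rewrite mulf_eq0 (gt_eqF t0)/=.
by apply/negP; exact: (L_chamberP arr _).1 Cv0 _ Lu.
Qed.

Lemma cone_add v x y : in_closed_cell L v x -> in_closed_cell L v y -> in_closed_cell L v (x + y).
Proof.
move=> /L_closed_cellP vx /L_closed_cellP vy; apply/L_closed_cellP => u Lu uv.
by rewrite dotDr; have := vx _ Lu uv; have := vy _ Lu uv; lra.
Qed.

Lemma cone_scale v x t : 0 <= t -> in_closed_cell L v x -> in_closed_cell L v (t *: x).
Proof.
move=> t0 /L_closed_cellP vx; apply/L_closed_cellP => u Lu uv.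
by rewrite dotZr mulr_ge0_le0//; exact: vx.
Qed.

Lemma cone_pos v x u : L (hyperplane u 0) -> in_closed_cell L v x -> 0 <= dot u v -> 0 <= dot u x.
Proof.
move=> Lu vx uv; have Lu' : L (hyperplane (- u) 0) by rewrite -oppr0 hyperplaneN.
by have := vx _ _ Lu'; rewrite !dotNl !oppr_le0; exact.
Qed.

Lemma cell_scale v x t : 0 < t -> cell L v x -> cell L v (t *: x).
Proof.
move=> t0 [vx xv]; split; first by apply: cone_scale => //; exact: ltW.
apply/L_closed_cellP => u Lu; rewrite dotZr pmulr_rle0//; exact: xv.
Qed.

Lemma cell_add v x y : cell L v x -> in_closed_cell L v y -> in_chamber L v -> cell L v (x + y).
Proof.
move=> [vx xv] vy Cv; split; first exact: cone_add.
apply/L_closed_cellP => u Lu; rewrite dotDr => uxy.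
rewrite leNgt; apply/negP => uv.
have uy := cone_pos Lu vy (ltW uv); have ux : dot u x <= 0 by lra.
by have := xv _ _ Lu ux; rewrite leNgt uv.
Qed.

(** The chamber of [v] is an open cone and [v + t^-1 *: z] tends to [v]. *)
Lemma cone_absorb v z : in_chamber L v -> exists T, forall t, T <= t -> in_closed_cell L v (t *: v + z).
Proof.
move=> Cv; have [e e0 near] := near_direction Cv; exists ((enorm z + 1) / e) => t Tt.
have z1 : 0 < enorm z + 1 by rewrite ltr_wpDl ?enorm_ge0.
have t0 : 0 < t by apply: lt_le_trans Tt; rewrite divr_gt0.
have -> : t *: v + z = t *: (v + t^-1 *: z) by rewrite scalerDr scalerA mulfV ?gt_eqF// scale1r.
apply: cone_scale; first exact: ltW.
suff [] : cell L v (v + t^-1 *: z) by [].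
apply: near; rewrite addrAC subrr add0r enormZ gtr0_norm ?invr_gt0//.
rewrite mulrC ltr_pdivrMr// mulrC.
by move: Tt; rewrite ler_pdivrMr//; apply: lt_le_trans; rewrite ltrDl.
Qed.

Lemma refl0_dotC u x y : dot (reflection u 0 x) y = dot x (reflection u 0 y).
Proof. by rewrite dotC !dot_reflection !subr0 (dotC y x) (dotC y u) (dotC u x); ring. Qed.

(** The walls between [v] and [V] inject into those between [v] and the mirror image of [V]: a wall
    common to both sets goes to itself, any other to its reflection. The mirror itself is not
    reached. *)
Lemma reflection_farther u v V : L (hyperplane u 0) -> in_chamber L v -> in_chamber L V ->
  0 < dot u v -> 0 < dot u V ->
  (ncard (sepset L v V) < ncard (sepset L v (reflection u 0 V)))%N.
Proof.
move=> Lu Cv CV uv uV; set s := reflection u 0; have [u0 _ [c Mu]] := (LP M _ _).1 Lu.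
have sK : cancel s s by exact: reflectionK.
have WL := W_reflection arr Mu.
have sL b : L (hyperplane b 0) -> L (hyperplane (s b) 0).
  by move=> Lb; rewrite /s -(lin_reflection u c); exact: L_lin.
have CsV : in_chamber L (s V).
  by rewrite /s -(lin_reflection u c); apply/(lin_chamber arr).
have simg b : s @` hyperplane b 0 = hyperplane (s b) 0.
  apply/seteqP; split => [_ [x bx <-]|x bx].
    by rewrite /hyperplane /= dot_refl0.
  by exists (s x) => //; move: bx; rewrite /hyperplane /= -refl0_dotC.
have fin S : S `<=` L -> finite_set S by move=> SL; exact: sub_finite_set SL (L_finite Cv0).
have subL x y : sepset L x y `<=` L by move=> H [b [d [-> Lb _ _]]].
set A := sepset L v V; set B := sepset L v (s V).
have AL : A `<=` L by exact: subL. have BL : B `<=` L by exact: subL.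
have simg_inj : {in A `\` B &, injective (fun H => s @` H)}.
  by move=> H K _ _ /= /(congr1 (fun S => s @` S)); rewrite !image_comp (_ : s \o s = id) ?image_id//; apply/funext.
have imB H : (A `\` B) H -> (B `\` A) (s @` H) /\ s @` H <> hyperplane u 0.
  move=> [[b [d [-> Lb bv bV]]] nB].
  have [b0 d0 _] := (LP M _ _).1 Lb; rewrite d0 in Lb bv bV nB *.
  have bsV : dot b (s V) < 0.
    have [//|bsV|e] := ltgtP (dot b (s V)) 0; last by have := (L_chamberP arr _).1 CsV _ Lb; rewrite e eqxx.
    by exfalso; apply: nB; exists b, 0.
  have bu : 0 < dot b u.
    move: bsV; rewrite dot_reflection subr0 => h; rewrite ltNge; apply/negP => bu.
    have : 0 <= 2 * dot u V / dot u u * - dot b u.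
      by rewrite mulr_ge0 ?oppr_ge0// divr_ge0 ?dot_ge0// mulr_ge0// ltW.
    by rewrite mulrN; lra.
  have sbv : dot (s b) v < 0.
    rewrite /s refl0_dotC dot_reflection subr0.
    have : 0 <= 2 * dot u v / dot u u * dot b u.
      by rewrite mulr_ge0 ?(ltW bu)// divr_ge0 ?dot_ge0// mulr_ge0// ltW.
    by lra.
  have sbV : dot (s b) V < 0 by rewrite /s refl0_dotC.
  rewrite simg; have sb0 : s b != 0 by have [] := (LP M _ _).1 (sL _ Lb).
  split; first split.
  - exists (s b), 0; split => //; first exact: sL.
    by rewrite dot_refl0.
  - by move=> /(sep_rep sb0)[[h1 h2]|[h1 h2]]; [move: (lt_trans h2 sbV)|move: (lt_trans h1 sbv)]; rewrite ltxx.
  - rewrite -simg => e; have bu0 : hyperplane b 0 = hyperplane u 0.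
      transitivity (s @` hyperplane u 0); first by rewrite -e image_comp (_ : s \o s = id) ?image_id//; apply/funext.
      rewrite simg (_ : s u = - u); first by rewrite -{1}oppr0 hyperplaneN.
      rewrite /s /reflection subr0 mulfK ?dot_eq0//.
      by rewrite scaler_nat mulr2n opprD addrA subrr add0r.
    have : sepset L v V (hyperplane u 0) by rewrite -bu0; exists b, 0.
    by move=> /(sep_rep u0)[[h1 h2]|[h1 h2]]; [move: (lt_trans uv h1)|move: (lt_trans uV h2)]; rewrite ltxx.
(* The image of this injection. *)
pose C := (A `&` B) `|` ((fun H => s @` H) @` (A `\` B)).
have uB : (B `\` A) (hyperplane u 0).
  split.
    rewrite /B sepsetC; exists u, 0; split => //.
    by have := dot_reflection_normal 0 V u0; rewrite !subr0 => ->; rewrite oppr_lt0.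
  by move=> /(sep_rep u0)[[h1 h2]|[h1 h2]]; [move: (lt_trans uv h1)|move: (lt_trans uV h2)]; rewrite ltxx.
have CB : C `<=` B `\` [set hyperplane u 0].
  move=> H [[AH BH]|[K AK <-]]; first by split => // HE; case: uB => _; rewrite -HE.
  by have [[BK _] nK] := imB _ AK.
have fA : finite_set A by exact: fin. have fB : finite_set B by exact: fin.
have fAB : finite_set (A `\` B) by apply: sub_finite_set fA => H [].
rewrite (ncardD1 fB uB.1) ltnS.
apply: leq_trans (ncard_le (sub_finite_set _ fB) CB); last by move=> H [].
have fAI : finite_set (A `&` B) by apply: sub_finite_set fA => H [].
rewrite /C ncardUI//; last 2 first.
- exact: finite_image.
- by rewrite -subset0 => H [[AH _] [K AK HK]]; have [[_ +] _] := imB _ AK; rewrite HK.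
rewrite ncard_image// -ncardUI//; last by rewrite -subset0 => H [[_ +] [_ +]].
by rewrite setUIDK.
Qed.

End Chambers.

Section ConvexCells.
Context {R : realType} {n : nat}.
Notation E := ('rV[R]_n).
Implicit Types (x z : E) (t : R).

Lemma closed_cell_seg (N : set (set E)) x z t : in_closed_cell N x z -> 0 < t <= 1 ->
  cell N x (z + t *: (x - z)).
Proof.
move=> xz /andP[t0 t1]; split=> u c Nu; rewrite dot_seg => h.
  by have := xz _ _ Nu h; nra.
rewrite leNgt; apply/negP => ux.
have Nu' : N (hyperplane (- u) (- c)) by rewrite hyperplaneN.
have := xz _ _ Nu'; rewrite !dotNl !lerN2 => /(_ (ltW ux)); nra.
Qed.

Lemma in_closed_cell_refl (N : set (set E)) x : in_closed_cell N x x.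
Proof. by []. Qed.

Lemma closed_cell_trans (N : set (set E)) x y z : in_closed_cell N x y -> in_closed_cell N y z ->
  in_closed_cell N x z.
Proof. by move=> xy yz u c Nu h; apply/yz/xy. Qed.

End ConvexCells.

(** * Rays and ideal points *)

Section IdealPoints.
Context {R : realType} {X : metricType R}.
Implicit Types (c d : R -> X) (xi eta : ideal_point X) (p q : X) (s t : R).

Lemma asymptotic_sym c d : asymptotic c d -> asymptotic d c.
Proof. by move=> [K cK]; exists K => t t0; rewrite metric_sym cK. Qed.

Lemma ideal_ray xi c : ideal_class xi c -> ray c.
Proof. by have [d rd ->] := ideal_classP xi; case. Qed.

Lemma ideal_asymptotic xi c d : ideal_class xi c -> ideal_class xi d -> asymptotic c d.
Proof.
have [e re ->] := ideal_classP xi => -[_ ec] [_ ed].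
exact: asymptotic_trans (asymptotic_sym ec) ed.
Qed.

Lemma asymptotic_ideal xi c d : ideal_class xi c -> ray d -> asymptotic c d -> ideal_class xi d.
Proof.
have [e re ->] := ideal_classP xi => -[_ ec] rd cd; split => //.
exact: asymptotic_trans ec cd.
Qed.

Lemma ideal_eq xi eta c : ideal_class xi c -> ideal_class eta c -> xi = eta.
Proof.
move=> xc ec; have H : ideal_class xi = ideal_class eta.
  apply/seteqP; split => d hd.
    exact: asymptotic_ideal ec (ideal_ray hd) (ideal_asymptotic xc hd).
  exact: asymptotic_ideal xc (ideal_ray hd) (ideal_asymptotic ec hd).
case: xi eta H {xc ec} => [a aP] [b bP] /= ab; subst b; congr IdealPoint.
exact: Prop_irrelevance.
Qed.

Lemma ray_ideal c : ray c -> exists xi, ideal_class xi c.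
Proof.
move=> rc; have P : exists2 d, ray d & [set c' | ray c' /\ asymptotic c c'] =
    [set c' | ray c' /\ asymptotic d c'] by exists c.
exists (IdealPoint P); split => //; exists 0 => t _; by rewrite mdistxx.
Qed.

Lemma asymptotic_refl c : asymptotic c c.
Proof. by exists 0 => t _; rewrite mdistxx. Qed.

Lemma ideal_map_class (f : X -> X) (fI : isometric f) xi c :
  ideal_class xi c -> ideal_class (ideal_map fI xi) (f \o c).
Proof.
move=> xc; split; first by move=> s t s0 t0 /=; rewrite fI (ideal_ray xc).
by exists c => //; exact: asymptotic_refl.
Qed.

End IdealPoints.

Section FlatRays.
Context {R : realType} {n : nat} {X : metricType R}.
Notation E := ('rV[R]_n).
Implicit Types (f g : E -> X) (x y v w : E) (xi : ideal_point X) (s t : R).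

Lemma flat_ray f x v : euclidean_isometry f -> enorm v = 1 -> ray (fun t => f (x + t *: v)).
Proof.
move=> fI v1 s t _ _; rewrite fI opprD addrACA subrr add0r -scalerBl enormZ v1.
by rewrite mulr1.
Qed.

Lemma flat_asymptotic f x y v : euclidean_isometry f ->
  asymptotic (fun t => f (x + t *: v)) (fun t => f (y + t *: v)).
Proof.
by move=> fI; exists (enorm (x - y)) => t _; rewrite fI opprD addrACA subrr addr0.
Qed.

(** Otherwise the distance grows linearly, at rate [enorm (v - w)]. *)
Lemma flat_direction f x y v w : euclidean_isometry f ->
  asymptotic (fun t => f (x + t *: v)) (fun t => f (y + t *: w)) -> v = w.
Proof.
move=> fI [K fK]; apply/eqP; rewrite -subr_eq0 -enorm_eq0 eq_le enorm_ge0 andbT.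
rewrite leNgt; apply/negP => d0.
pose B := `|K| + enorm (x - y) + 1.
have B0 : 0 < B by rewrite /B; have := enorm_ge0 (x - y); have := normr_ge0 K; lra.
have := fK (B / enorm (v - w)) (divr_ge0 (ltW B0) (ltW d0)).
rewrite fI; set t := B / _ => le.
have tE : t * enorm (v - w) = B by rewrite divfK// gt_eqF.
have t0 : 0 < t by rewrite divr_gt0.
have : t * enorm (v - w) <= K + enorm (x - y).
  rewrite -{1}(gtr0_norm t0) -enormZ scalerBr.
  rewrite (_ : _ - _ = (x + t *: v - (y + t *: w)) + (y - x)).
    apply: le_trans (enormD _ _) _; rewrite (enormB y); lra.
  by apply/rowP => i; rewrite !mxE; ring.
by rewrite tE /B; have := ler_norm K; lra.
Qed.

(** Parallel rays of a flat are asymptotic, so the end of a direction may be read from any base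
    point. *)
Lemma chart_endP f v xi x : euclidean_isometry f -> enorm v = 1 ->
  chart_end f v xi <-> ideal_class xi (fun t => f (x + t *: v)).
Proof.
move=> fI v1; have E0 : (fun t => f (t *: v)) = (fun t => f (0 + t *: v)).
  by apply/funext => t; rewrite add0r.
split=> [[_]|h].
  rewrite E0 => h; apply: asymptotic_ideal h (flat_ray x fI v1) (flat_asymptotic _ _ _ fI).
split => //; rewrite E0; exact: asymptotic_ideal h (flat_ray 0 fI v1) (flat_asymptotic _ _ _ fI).
Qed.

Lemma chart_end_uniq f v w xi : euclidean_isometry f -> chart_end f v xi -> chart_end f w xi -> v = w.
Proof.
move=> fI [v1 fv] [w1 fw]; have := ideal_asymptotic fv fw => as_.
apply: (@flat_direction f 0 0) => //.
case: as_ => K fK; exists K => t t0; rewrite !add0r; exact: fK.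
Qed.

(** Expanding the squares gives [dot y v = t], the equality case of Cauchy-Schwarz. *)
Lemma unit_collinear y v t : enorm v = 1 -> enorm y = t -> enorm (y - v) = `|t - 1| -> y = t *: v.
Proof.
move=> v1 yt yv; apply/eqP; rewrite -subr_eq0 -dot_eq0.
have := sqr_enorm (y - v); rewrite yv real_normK ?num_real//.
have := sqr_enorm y; rewrite yt; have := sqr_enorm v; rewrite v1.
rewrite !dotBl !dotBr !dotZl !dotZr (dotC v y) => h1 h2 h3.
have yvE : dot y v = t by lra.
by apply/eqP; rewrite -h1 -h2 yvE; ring.
Qed.

Lemma flat_line f (c : R -> X) : euclidean_isometry f -> ray c ->
  (forall t, 0 <= t -> exists x, f x = c t) ->
  exists x v, enorm v = 1 /\ forall t, 0 <= t -> c t = f (x + t *: v).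
Proof.
move=> fI rc fc.
have [x0 x0E] := fc 0 (lexx 0); have [x1 x1E] := fc 1 ler01.
pose v := x1 - x0.
have v1 : enorm v = 1.
  by rewrite /v -fI x0E x1E rc// subr0 normr1.
exists x0, v; split => // t t0; have [x xE] := fc t t0; rewrite -xE; congr f.
have d0 : enorm (x - x0) = t by rewrite -fI xE x0E rc// subr0 ger0_norm.
have d1 : enorm (x - x1) = `|t - 1| by rewrite -fI xE x1E rc.
have e : x - x1 = (x - x0) - v by rewrite /v opprB addrA subrK.
by rewrite -(unit_collinear v1 d0) -?e// addrC subrK.
Qed.

End FlatRays.

(** * Convergence tested on the subbase of the cone topology *)

Section Cone.
Context {R : realType} {X : metricType R}.

Lemma cone_cvg (u : nat -> bordification X) z :
  (forall U, cone_subbase U -> U z -> exists N, forall k, (N <= k)%N -> U (u k)) ->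
  u @ \oo --> z.
Proof.
move=> H B; rewrite nbhsE => -[V [Vo Vz] VB].
apply: filterS VB _; case: Vo => D sD DV; move: Vz; rewrite -DV => -[F FD Fz].
apply: (@filterS _ _ _ F); first by move=> x Fx; exists F.
have [G GD GF] := sD _ FD; rewrite -GF in Fz *.
apply: filter_bigI => i iF; have [N NP] := H _ (set_mem (GD _ iF)) (Fz _ iF).
by exists N => // k /=; exact: NP.
Qed.

Lemma cone_cvg_interior (u : nat -> X) xi (c : R -> X) (r e : R) :
  (fun k => Interior (u k)) @ \oo --> Ideal xi -> ideal_class xi c -> 0 < r -> 0 < e ->
  exists N, forall k, (N <= k)%N -> cone_nbhs c r e (Interior (u k)).
Proof.
move=> uxi xic r0 e0; have : nbhs (Ideal xi : bordification X) (cone_nbhs c r e).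
  rewrite nbhsE; exists (cone_nbhs c r e) => //; split.
    exists [set cone_nbhs c r e]; last by rewrite bigcup_set1.
    move=> _ ->; apply: finI_from1; right; exists c, r, e; split => //.
    exact: (ideal_ray xic).
  by exists c; split => //; rewrite mdistxx.
by move=> /uxi [N _ NP]; exists N => k; exact: NP.
Qed.

End Cone.

(** * Apartments *)

Section Building.
Context {R : realType} {n : nat} {X : metricType R}.
Notation E := ('rV[R]_n).
Variables (M : set (set E)) (A : set (E -> X)).
Hypothesis arr : affine_arrangement M.
Hypothesis atl : building_atlas M A.
Notation W := (reflection_group M).
Notation L := (linear_walls M).
Notation dE := (wall_dist M).

(** * Transition maps, and the retraction centered at a chamber of the building *)

Section Charts.
Implicit Types (f g h k : E -> X) (x y z : E) (p q : X) (t : R).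

Lemma chart_isom f x y : A f -> mdist (f x) (f y) = enorm (x - y).
Proof. by case: atl => _ + _ _ _ Af; apply. Qed.

Lemma chart_inj f : A f -> injective f.
Proof.
move=> Af x y fxy; apply/eqP; rewrite -subr_eq0 -enorm_eq0 -(chart_isom x y Af).
by rewrite fxy mdistxx.
Qed.

Lemma chart_comp f (w : E -> E) : A f -> W w -> A (f \o w).
Proof. by case: atl => _ _ + _ _; apply. Qed.

(** In a chart containing both open cells they share a point, hence coincide. *)
Lemma chart_cells f g x y : A f -> A g -> f x = g y -> f @` cell M x = g @` cell M y.
Proof.
move=> Af Ag fg; case: (atl) => _ _ _ /(_ f g x y Af Ag)[h [a [b [Ah ha hb]]]] _.
have cellE u v : cell M u v -> cell M v = cell M u.
  move=> uv; apply/seteqP; split => z hz; first exact: cell_trans uv hz.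
  exact: cell_trans (cell_sym uv) hz.
have [a' aa' ha'] : (h @` cell M a) (f x) by rewrite ha; exists x => //; exact: cell_refl.
have [b' bb' hb'] : (h @` cell M b) (f x) by rewrite hb fg; exists y => //; exact: cell_refl.
have ab : a' = b' by apply: (chart_inj Ah); rewrite ha' hb'.
by rewrite -ha -hb -(cellE _ _ aa') -(cellE _ _ bb') ab.
Qed.

(** By continuity: the segment from [z] to [x] runs inside the open cell except at [z]. *)
Lemma chart_ext f g x z : A f -> A g -> (forall z, cell M x z -> f z = g z) ->
  in_closed_cell M x z -> f z = g z.
Proof.
move=> Af Ag fg xz; apply/eqP; rewrite -[_ == _]negbK -mdist_gt0; apply/negP => d0.
have X0 : 0 < 2 * enorm (x - z) + 1 by rewrite ltr_wpDl// mulr_ge0// enorm_ge0.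
set d := mdist _ _ in d0.
have b0 : 0 < Num.min 1 (d / (2 * enorm (x - z) + 1)) by rewrite lt_min ltr01 divr_gt0.
have [t /andP[t0 +] _] := exists_notin [::] b0; rewrite lt_min ltr_pdivlMr// => /andP[t1 td].
have zt := closed_cell_seg xz (introT andP (conj t0 (ltW t1))).
have zt' : enorm (z - (z + t *: (x - z))) = t * enorm (x - z).
  by rewrite opprD addrA subrr add0r enormN enormZ gtr0_norm.
have h1 : mdist (f z) (f (z + t *: (x - z))) = t * enorm (x - z) by rewrite chart_isom.
have h2 : mdist (f (z + t *: (x - z))) (g z) = t * enorm (x - z).
  by rewrite fg// metric_sym chart_isom.
have := metric_triangle (f z) (f (z + t *: (x - z))) (g z).
by rewrite h1 h2 -/d; lra.
Qed.

Lemma chart_change f g x y x' y' : A f -> A g -> f x = g x' -> f y = g y' ->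
  exists w, [/\ W w, w x = x', w y = y',
    forall z, in_closed_cell M x z -> f z = g (w z)
  & forall z, in_closed_cell M y z -> f z = g (w z)].
Proof.
move=> Af Ag fx fy; case: (atl) => _ _ _ _ /(_ f g x y x' y' Af Ag).
move=> /(_ (chart_cells Af Ag fx) (chart_cells Af Ag fy))[w Ww fw].
have Agw := chart_comp Ag Ww.
exists w; split => //.
- by apply: (chart_inj Ag); rewrite -fw ?fx//; left; exact: cell_refl.
- by apply: (chart_inj Ag); rewrite -fw ?fy//; right; exact: cell_refl.
- by move=> z; apply: (chart_ext Af Agw) => a xa; apply: fw; left.
- by move=> z; apply: (chart_ext Af Agw) => a xa; apply: fw; right.
Qed.

Lemma chart_through p q : exists h x y, [/\ A h, h x = p & h y = q].
Proof.
case: (atl) => cov _ _ two _.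
have [f Af [x _ fx]] := cov p; have [g Ag [y _ gy]] := cov q.
have [h [a [b [Ah ha hb]]]] := two f g x y Af Ag.
have [a' _ ha'] : (h @` cell M a) p by rewrite ha; exists x => //; exact: cell_refl.
have [b' _ hb'] : (h @` cell M b) q by rewrite hb; exists y => //; exact: cell_refl.
by exists h, a', b'.
Qed.

Lemma W_fix (w : E -> E) x : W w -> in_chamber M x -> (forall z, cell M x z -> w z = z) ->
  forall z, w z = z.
Proof.
move=> Ww Cx fixx z; have [e e0 near] := near_cell arr Cx.
have X0 : 0 < enorm (z - x) + 1 by rewrite ltr_wpDl ?enorm_ge0.
have [t /andP[t0 te] _] := exists_notin [::] (divr_gt0 e0 X0).
have xt : cell M x (x + t *: (z - x)).
  apply: near; rewrite addrAC subrr add0r enormZ gtr0_norm//.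
  move: te; rewrite ltr_pdivlMr//; apply: le_lt_trans.
  by apply: ler_wpM2l; [exact: ltW|rewrite lerDl].
have := fixx _ xt; rewrite (W_D _ _ Ww) (W_linZ _ _ Ww) fixx; last exact: cell_refl.
move=> /addrI /scalerI => /(_ (lt0r_neq0 t0)) h.
by rewrite -(subrK x z) addrC (W_D _ _ Ww) h fixx; last exact: cell_refl.
Qed.

Definition agree f g x := forall z, in_closed_cell M x z -> f z = g z.

Lemma agree_sym f g x : agree f g x -> agree g f x.
Proof. by move=> fg z /fg. Qed.

Lemma agree_trans f g h x : agree f g x -> agree g h x -> agree f h x.
Proof. by move=> fg gh z xz; rewrite fg ?gh. Qed.

Lemma agree_cell f g x y : cell M x y -> agree f g x -> agree f g y.
Proof. by move=> [xy _] fg z yz; apply/fg/(closed_cell_trans xy). Qed.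

Lemma agreeP f g x : A f -> A g -> (forall z, cell M x z -> f z = g z) -> agree f g x.
Proof. by move=> Af Ag fg z; exact: chart_ext. Qed.

(** The transition map fixes an open chamber pointwise, hence is the identity. This makes the
    retraction below independent of the chart [k]. *)
Lemma agree_point k k' x y y' : A k -> A k' -> in_chamber M x -> agree k k' x ->
  k y = k' y' -> y = y' /\ agree k k' y.
Proof.
move=> Ak Ak' Cx kk ky.
have [w [Ww wx wy wcx wcy]] := chart_change Ak Ak' (kk _ (@in_closed_cell_refl _ _ M x)) ky.
have wid : forall z, w z = z.
  apply: (W_fix Ww Cx) => z [xz _]; apply: (chart_inj Ak').
  by rewrite -wcx// kk.
by split; [rewrite -wy wid|move=> z yz; rewrite wcy// wid].
Qed.

Definition regular p : Prop := exists f x, [/\ A f, in_chamber M x & f x = p].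

Lemma regular_chart h y : A h -> regular (h y) -> in_chamber M y.
Proof.
move=> Ah [f [x [Af Cx fx]]].
have [w [Ww wx _ _ _]] := chart_change Af Ah fx fx.
by rewrite -wx; apply/(W_chamber arr).
Qed.

Lemma chart_regular h y : A h -> in_chamber M y -> regular (h y).
Proof. by exists h, y. Qed.

(* [rho h x] is the retraction onto [range h] centered at the chamber of [h x],
   read in the chart [h]. *)
Definition rho h x p : E := xget 0 [set y | exists k, [/\ A k, agree k h x & k y = p]].

Lemma rhoP h x p : A h -> in_chamber M x -> exists k, [/\ A k, agree k h x & k (rho h x p) = p].
Proof.
move=> Ah Cx; rewrite /rho; case: xgetP => [y _ //|no].
have [k [a [b [Ak ka kb]]]] := chart_through (h x) p.
have [w [Ww wx _ wc _]] := chart_change Ah Ak (esym ka) (esym ka).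
have [w' [Ww' ww' w'w]] := W_inv arr Ww.
exfalso; apply: (no (w' b)); exists (k \o w); split; first exact: chart_comp.
- by move=> z xz; rewrite wc.
- by rewrite /= w'w.
Qed.

Lemma rho_eq h x k y : A h -> in_chamber M x -> A k -> agree k h x -> rho h x (k y) = y.
Proof.
move=> Ah Cx Ak kh; have [k' [Ak' k'h k'y]] := rhoP (k y) Ah Cx.
exact: (agree_point Ak' Ak Cx (agree_trans k'h (agree_sym kh)) k'y).1.
Qed.

Lemma rho_id h x y : A h -> in_chamber M x -> rho h x (h y) = y.
Proof. by move=> Ah Cx; exact: rho_eq. Qed.

(** On each closed cell the retraction is an element of the affine Weyl group, in particular an
    isometry. *)
Lemma rho_chart h x g y : A h -> in_chamber M x -> A g ->
  exists2 w, W w & forall z, in_closed_cell M y z -> rho h x (g z) = w z.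
Proof.
move=> Ah Cx Ag; have [k [Ak kh ky]] := rhoP (g y) Ah Cx.
have [w [Ww _ _ wc _]] := chart_change Ag Ak (esym ky) (esym ky).
by exists w => // z yz; rewrite wc// rho_eq.
Qed.

Lemma rho_center h x z p : A h -> in_chamber M x -> in_closed_cell M x z ->
  mdist (h z) p = enorm (z - rho h x p).
Proof.
move=> Ah Cx xz; have [k [Ak kh kp]] := rhoP p Ah Cx.
by rewrite -{1}kp -(kh _ xz) chart_isom.
Qed.

(** The retraction folds a geodesic segment of a common chart into a broken line: locally, distances
    from a point of the segment are preserved on either side, and these pieces are chained. *)
Lemma rho_lipschitz h x p q : A h -> in_chamber M x ->
  enorm (rho h x p - rho h x q) <= mdist p q.
Proof.
move=> Ah Cx; have [g [a [b [Ag <- <-]]]] := chart_through p q.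
pose z t := a + t *: (b - a).
have zE s t : enorm (z s - z t) = `|s - t| * enorm (b - a) by rewrite seg_sub enormZ.
pose Q s t := enorm (rho h x (g (z s)) - rho h x (g (z t))) <= (t - s) * enorm (b - a).
have : Q 0 1.
  apply: (@interval_chain _ Q 0 1) => //.
    move=> r s t Qrs Qst _ _; apply: le_trans (enorm_triangle _ (rho h x (g (z s))) _) _.
    by apply: le_trans (lerD Qrs Qst) _; rewrite -mulrDl; apply: ler_wpM2r; [exact: enorm_ge0|lra].
  move=> t _; have [e e0 near] := near_closed_cell arr (z t).
  have X0 : 0 < enorm (b - a) + 1 by rewrite ltr_wpDl ?enorm_ge0.
  have close s : `|s - t| < e / (enorm (b - a) + 1) ->
      enorm (rho h x (g (z s)) - rho h x (g (z t))) = `|s - t| * enorm (b - a).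
    rewrite ltr_pdivlMr// => st; have : in_closed_cell M (z s) (z t).
      by apply: near; rewrite zE; apply: le_lt_trans st; apply: ler_wpM2l; rewrite ?lerDl.
    have [w Ww wc] := rho_chart (z s) Ah Cx Ag => st'.
    by rewrite !wc// (W_B _ _ Ww) (W_enorm _ Ww) zE.
  exists (e / (enorm (b - a) + 1)); first exact: divr_gt0.
  split=> s /andP[h1 h2] st.
    by rewrite /Q close; [rewrite distrC ger0_norm ?subr_ge0|rewrite ler0_norm; lra].
  by rewrite /Q enormB close; [rewrite ger0_norm ?subr_ge0|rewrite ger0_norm; lra].
rewrite /Q subr0 mul1r /z scale0r addr0 scale1r (addrC a) subrK => H.
by rewrite (chart_isom a b Ag) (enormB a).
Qed.

(** Gallery distance read in a common chart. Such a chart exists for any two points, so the default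
    [0] never occurs. *)
Definition wdist p q : nat := xget 0%N [set m | exists h x y, [/\ A h, h x = p, h y = q & m = dE x y]].

Lemma wdistE h x y : A h -> wdist (h x) (h y) = dE x y.
Proof.
move=> Ah; rewrite /wdist; case: xgetP => [_ _ [k [a [b [Ak ka kb ->]]]]|/(_ (dE x y))[]]; last by exists h, x, y.
have [w [Ww wa wb _ _]] := chart_change Ak Ah ka kb.
by rewrite -wa -wb (dE_W arr).
Qed.

Lemma wdistC p q : wdist p q = wdist q p.
Proof.
have [h [x [y [Ah <- <-]]]] := chart_through p q.
by rewrite !wdistE// dEC.
Qed.

Lemma wdist_rho h x y p : A h -> in_chamber M x -> in_closed_cell M x y ->
  wdist (h y) p = dE y (rho h x p).
Proof.
move=> Ah Cx xy; have [k [Ak kh kp]] := rhoP p Ah Cx.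
by rewrite -{1}kp -(kh y xy) wdistE.
Qed.

Lemma rho_regular h x p : A h -> in_chamber M x -> regular p -> in_chamber M (rho h x p).
Proof.
move=> Ah Cx; have [k [Ak _ kp]] := rhoP p Ah Cx.
by rewrite -{1}kp => /(regular_chart Ak).
Qed.

Lemma same_chamber_range h y p : A h -> in_chamber M y -> regular p ->
  wdist (h y) p = 0%N -> exists2 z, h z = p & cell M y z.
Proof.
move=> Ah Cy rp hp; have [k [Ak kh kp]] := rhoP p Ah Cy.
have yp : cell M y (rho h y p).
  by apply: (dE0_cell arr) => //; [exact: rho_regular|rewrite -wdist_rho].
exists (rho h y p) => //; rewrite -[RHS]kp; apply/esym/kh; exact: yp.1.
Qed.

(** The images of two adjacent chambers still have a common panel in their closures, so they are
    adjacent or equal; this is summed along a minimal gallery. *)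
Lemma wdist_rho_le h x p q : A h -> in_chamber M x -> regular p -> regular q ->
  (dE (rho h x p) (rho h x q) <= wdist p q)%N.
Proof.
move=> Ah Cx; have [g [a [b [Ag <- <-]]]] := chart_through p q.
move=> /(regular_chart Ag) Ca /(regular_chart Ag) Cb; rewrite wdistE//.
move dab: (dE a b) => m; elim: m b Cb dab => [|m IH] b Cb dab.
  have ab := dE0_cell arr Ca Cb dab; have [w Ww wc] := rho_chart a Ah Cx Ag.
  by rewrite !wc ?(dE_W arr)// ?dab//; case: ab.
have [b' [Cb' db' dbb _ _]] := last_step arr Ca Cb dab.
have Creg z : in_chamber M z -> in_chamber M (rho h x (g z)).
  by move=> Cz; apply: rho_regular => //; exact: chart_regular.
apply: leq_trans (dE_tri arr _ _ (Creg _ Cb')) _; rewrite -addn1; apply: leq_add; first exact: IH.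
have [u [c [z P]]] := adjacent_panel arr Cb' Cb dbb.
have [[_ _ Mu uz] _ uniq [bz' bz] _] := P.
have [w' Ww' wc'] := rho_chart b' Ah Cx Ag; have [w Ww wc] := rho_chart b Ah Cx Ag.
have wz : w z = w' z by rewrite -wc// wc'.
have [v [vv' v'v]] : exists v : E -> E, [/\ W v, cancel w v & cancel v w].
  by have [v []] := W_inv arr Ww; exists v.
move=> vw'.
have Cv : in_chamber M (v (w' b')) by apply/(W_chamber arr _ vv')/(W_chamber arr _ Ww').
have vz : in_closed_cell M (v (w' b')) z.
  by rewrite -(v'v z) wz; apply/(W_closed_cell arr _ _ vv')/(W_closed_cell arr _ _ Ww').
rewrite wc'// wc// -(dE_W arr (w := v)) // v'v.
have := panel_cells arr P Cv vz; case: ifPn => _ h1.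
  by rewrite -(dE_cell arr Cb' Cb h1 (cell_refl _ _)) dbb.
by rewrite -(dE_cell arr Cb Cb h1 (cell_refl _ _)) (cell_dE0 (cell_refl _ _)).
Qed.

Lemma wdist_tri p q r : regular p -> regular q -> regular r ->
  (wdist p r <= wdist p q + wdist q r)%N.
Proof.
move=> rp rq rr; have [h [x [z [Ah hx hz]]]] := chart_through p r.
have Cx : in_chamber M x by apply: (regular_chart Ah); rewrite hx.
rewrite -hx (wdist_rho q Ah Cx (in_closed_cell_refl (N := M) (x := x))).
rewrite -{1}hz wdistE//; apply: leq_trans (dE_tri arr _ _ (rho_regular Ah Cx rq)) _.
rewrite leq_add2l; have -> : z = rho h x r by rewrite -hz rho_id.
exact: wdist_rho_le.
Qed.

(** Retract from a chamber whose closure contains the intermediate point: the distance of [p] to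
    that point is kept, those to [f y] and [f z] do not grow, and in the chart the inequality is a
    Euclidean identity. *)
Lemma cat0_chart f y z p t : A f -> 0 <= t <= 1 -> (exists x, in_chamber M x /\ in_closed_cell M x (y + t *: (z - y))) ->
  mdist p (f (y + t *: (z - y))) ^+ 2 <=
  (1 - t) * mdist p (f y) ^+ 2 + t * mdist p (f z) ^+ 2 - t * (1 - t) * enorm (z - y) ^+ 2.
Proof.
move=> Af /andP[t0 t1] [x [Cx xm]]; set m := y + _ in xm *.
rewrite metric_sym (rho_center p Af Cx xm) enormB.
have lip w : enorm (rho f x p - w) <= mdist p (f w).
  by rewrite -{1}(rho_id w Af Cx); exact: rho_lipschitz.
set r := rho f x p in lip *.
have sq w : enorm (r - w) ^+ 2 <= mdist p (f w) ^+ 2.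
  by rewrite ler_pXn2r// nnegrE ?enorm_ge0// mdist_ge0.
apply: (@le_trans _ _ ((1 - t) * enorm (r - y) ^+ 2 + t * enorm (r - z) ^+ 2 - t * (1 - t) * enorm (z - y) ^+ 2)).
  rewrite !sqr_enorm /m le_eqVlt; apply/orP; left; apply/eqP.
  by rewrite !dotS (dotC y r) (dotC z r) (dotC z y); ring.
by apply: lerB => //; apply: lerD; apply: ler_wpM2l => //; rewrite subr_ge0.
Qed.

End Charts.

(** * Chambers beyond a panel and one-step extension of partial charts *)

Section Beyond.
Implicit Types (f h k : E -> X) (x y z d e u g : E) (p q : X) (t c : R).

Lemma rho_closed_cell h x k e z : A h -> in_chamber M x -> A k -> k z = h z ->
  in_closed_cell M e z -> in_closed_cell M (rho h x (k e)) z.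
Proof.
move=> Ah Cx Ak kz ez; have [w Ww wc] := rho_chart e Ah Cx Ak.
rewrite wc; last exact: in_closed_cell_refl.
suff -> : z = w z by apply/(W_closed_cell arr _ _ Ww).
by rewrite -wc// kz rho_id.
Qed.

Lemma panel_dist d d' u c z : panel_between M d d' u c z -> dE d d' = 1%N.
Proof. by case=> _ _ _ _ sE; rewrite /wall_dist sE ncard1. Qed.

(** Half-spaces are convex for galleries: a wall crossed on the way to [e] and again on the way back
    would be counted twice. *)
Lemma between_same_side x y e u c : in_chamber M e -> M (hyperplane u c) ->
  (dE x e + dE e y <= dE x y)%N -> c < dot u x -> c < dot u y -> c < dot u e.
Proof.
move=> Ce Mu le ux uy; rewrite ltNge; apply/negP => ue.
have uel : dot u e < c by rewrite lt_neqAle ue andbT; apply/eqP; exact: (Ce _ Mu).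
have Hs : sepset M x e (hyperplane u c) by rewrite sepsetC; exists u, c.
have fin : finite_set (sepset M x e `\` [set hyperplane u c]).
  by apply: sub_finite_set (sep_finite arr x e) => K [].
move: le; rewrite {1}/wall_dist (ncardD1 (sep_finite arr x e) Hs) addSn ltnNge => /negP; apply.
apply: leq_trans (ncardU fin (sep_finite arr e y)); apply: ncard_le.
  exact: finite_setUP fin (sep_finite arr e y).
move=> K Ks; have [Kx|Ke] := sepset_tri Ce Ks; [left|by right].
split => // KH; move: Ks; rewrite KH => -[v [b [vE Mv h1 h2]]].
have [k k0 [vk bk]] := hyperplane_eq (wall_neq0 arr Mu) (wall_neq0 arr Mv) vE.
move: h1 h2; rewrite vk bk !dotZl.
have [kp|kn|] := ltgtP k 0; last by move=> /eqP; rewrite (negbTE k0).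
  by rewrite !ltr_nM2l// => _ h2; move: (lt_trans h2 uy); rewrite ltxx.
by rewrite !ltr_pM2l// => h1 _; move: (lt_trans h1 ux); rewrite ltxx.
Qed.

(* If [y] is on the side of [d] then any chamber adjacent to [h1 d] along the
   panel of [d] and [d'] is farther from [h1 y] than [h1 d]; a common chart of
   that chamber and [h1 y] then has to contain [h1 d]. *)
Lemma extend_away h1 k d d' u c z y : A h1 -> A k -> agree h1 k d ->
  panel_between M d d' u c z -> in_chamber M y -> dot u y < c ->
  exists h, [/\ A h, agree h h1 y, agree h h1 d & agree h k d'].
Proof.
move=> Ah1 Ak h1k P Cy uy.
have [[Cd Cd' Mu uz] /andP[ud ud'] uniq [dz d'z] _] := P.
have yd' := dE_panel arr P Cy uy.
have [h [Ah hh1 he]] := rhoP (k d') Ah1 Cy.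
set e := rho h1 y (k d') in he.
have rk : regular (k d') by exists k, d'.
have Ce : in_chamber M e by exact: rho_regular.
have ry : regular (h1 y) by exists h1, y.
have rd : regular (h1 d) by exists h1, d.
have yq : (dE y d).+1 = dE y e.
  have <- : wdist (h1 y) (k d') = dE y e by apply: wdist_rho => //; exact: in_closed_cell_refl.
  apply/eqP; rewrite eqn_leq; apply/andP; split; last first.
    apply: leq_trans (wdist_tri ry rd rk) _.
    by rewrite wdistE// (h1k _ (@in_closed_cell_refl _ _ M d)) wdistE// (panel_dist P) addn1.
  rewrite -yd'; have := wdist_rho_le Ah1 Cd ry rk.
  by rewrite rho_id// (rho_eq d' Ah1 Cd Ak)//; exact: agree_sym.
have kz : k z = h1 z by rewrite h1k.
have ez : in_closed_cell M e z by apply: rho_closed_cell.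
have hz : h z = h1 z.
  have [w [Ww we _ wc _]] := chart_change Ak Ah (esym he) (esym he).
  rewrite -kz wc//; congr h.
  have : rho h1 y (k z) = w z by rewrite wc// rho_eq.
  by rewrite kz rho_id.
have d'e : cell M d' e.
  have := panel_cells arr P Ce ez; case: ifPn => // _ de.
  have : dE y e = dE y d by apply/esym/(dE_cell arr Cy Cd (cell_refl _ _) de).
  by rewrite -yq => /eqP; rewrite -addn1 -{2}(addn0 (dE y d)) eqn_add2l.
(* Retract [h1 d] onto [h] from the chamber of [h d]. If it landed on [d'], its distance to [y]
   would have grown, which a retraction cannot do. *)
have [b hb] : exists b, h b = h1 d.
  pose b := rho h d (h1 d).
  have Cb : in_chamber M b by exact: rho_regular.
  have bz : in_closed_cell M b z by apply: rho_closed_cell.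
  have hdb : wdist (h d) (h1 d) = dE d b by apply: wdist_rho => //; exact: in_closed_cell_refl.
  have := panel_cells arr P Cb bz; case: ifPn => _ db.
    have [|a ha _] := same_chamber_range Ah Cd rd; last by exists a.
    by rewrite hdb (cell_dE0 db).
  have := wdist_rho_le Ah Cd ry rd; rewrite -/b wdistE//.
  have -> : rho h d (h1 y) = y by rewrite -(hh1 y (@in_closed_cell_refl _ _ M y)) rho_id.
  by rewrite -(dE_cell arr Cy Cd' (cell_refl _ _) db) yd' ltnn.
have [bd hd] := agree_point Ah Ah1 Cy hh1 hb; rewrite bd in hd.
have hkd : agree h k d := agree_trans hd h1k.
have [ed' hk] := agree_point Ah Ak Cd hkd he.
by exists h; split => //; rewrite -ed'.
Qed.

(* The chamber at distance at most one beyond the panel of [d] and [d'] does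
   not depend on the chamber behind this panel from which it is seen. *)
Lemma beyond_adjacent k k' d d' u c z g g' : A k -> A k' -> agree k k' d ->
  panel_between M d d' u c z -> in_chamber M g -> in_chamber M g' ->
  c < dot u g -> c < dot u g' ->
  (wdist (k g) (k' g') = 0 \/ wdist (k g) (k' g') = 1 /\ dE d g <> dE d g')%N ->
  k d' = k' d'.
Proof.
move=> Ak Ak' kk P Cg Cg' ug ug' near; apply: contrapT => ne.
(* If the chambers beyond the panel differ, the retraction centered at [f' d'] sends [f d'] to the
   chamber of [d], which improves the triangle inequality by one. Exchanging the two charts gives
   the contradiction. *)
have main f f' a a' : A f -> A f' -> agree f f' d -> in_chamber M a -> in_chamber M a' ->
    c < dot u a -> c < dot u a' -> f d' <> f' d' ->
    ((dE d a').+1 <= dE d a + wdist (f a) (f' a'))%N.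
  move=> Af Af' ff Ca Ca' ua ua' ne'.
  have [[Cd Cd' Mu uz] _ uniq [dz d'z] _] := P.
  have rq : regular (f d') by exists f, d'.
  have rfa : regular (f a) by exists f, a.
  have rfa' : regular (f' a') by exists f', a'.
  pose b := rho f' d' (f d').
  have Cb : in_chamber M b by exact: rho_regular.
  have bz : in_closed_cell M b z by apply: rho_closed_cell => //; rewrite ff.
  have db : cell M d b.
    have := panel_cells arr P Cb bz; case: ifPn => // _ d'b; exfalso; apply: ne'.
    have [|x xq _] := same_chamber_range Af' Cd' rq.
      by rewrite (wdist_rho _ Af' Cd' (@in_closed_cell_refl _ _ M d')) (cell_dE0 d'b).
    by have [dx _] := agree_point Af Af' Cd ff (esym xq); rewrite -xq dx.
  have side e : in_chamber M e -> c < dot u e -> dE d e = (dE d' e).+1.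
    move=> Ce ue; rewrite (dEC M d e) (dEC M d' e); apply: (dE_panel arr (panel_sym P) Ce).
    by rewrite dotNl ltrN2.
  have : (dE d a' <= dE d' a + wdist (f a) (f' a'))%N.
    apply: leq_trans (_ : wdist (f d') (f' a') <= _)%N; last first.
      by apply: leq_trans (wdist_tri rq rfa rfa') _; rewrite wdistE.
    have := wdist_rho_le Af' Cd' rq rfa'; rewrite -/b rho_id//.
    by rewrite (dE_cell arr Cd Ca' db (cell_refl _ _)).
  by rewrite (side a)// addSn ltnS.
have h1 := main _ _ _ _ Ak Ak' kk Cg Cg' ug ug' ne.
have h2 := main _ _ _ _ Ak' Ak (agree_sym kk) Cg' Cg ug' ug (nesym ne).
rewrite wdistC// in h2; move: h1 h2; case: near => [->|[-> dd]].
  by rewrite !addn0 => h1 h2; have := leq_trans h1 (ltnW h2); rewrite ltnn.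
by rewrite !addn1 !ltnS => h1 h2; apply: dd; apply/eqP; rewrite eqn_leq h1 h2.
Qed.

(** Follow in [h2] a minimal gallery from [y] to [y0]. Its retraction from [d] remains beyond the
    wall, and for consecutive chambers the charts through [d] see the same chamber behind the panel
    by [beyond_adjacent]. *)
Lemma beyond_unique h1 h0 h2 d d' u c z y y0 : A h1 -> A h0 -> A h2 -> agree h0 h1 d ->
  panel_between M d d' u c z -> in_chamber M y -> in_chamber M y0 ->
  c < dot u y -> c < dot u y0 -> h2 y = h1 y -> h2 y0 = h0 y0 -> h0 d' = h1 d'.
Proof.
move=> Ah1 Ah0 Ah2 h01 P Cy Cy0 uy uy0 h2y h2y0.
have [[Cd Cd' Mu uz] _ _ _ _] := P.
have ry : rho h1 d (h2 y) = y by rewrite h2y rho_id.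
have ry0 : rho h1 d (h2 y0) = y0 by rewrite h2y0 rho_eq.
pose r g := rho h1 d (h2 g).
have reg g : in_chamber M g -> regular (h2 g) by exists h2, g.
have Cr g : in_chamber M g -> in_chamber M (r g) by move=> Cg; exact: rho_regular (reg _ Cg).
(* The retraction fixes both ends [y] and [y0] in coordinates and lengthens nothing, so a chamber
   between them keeps its distance from [y] and stays on their side of the wall. *)
have btw g : in_chamber M g -> (dE y g + dE g y0 = dE y y0)%N -> dE y (r g) = dE y g /\ c < dot u (r g).
  move=> Cg e.
  have l1 : (dE y (r g) <= dE y g)%N.
    by rewrite -{1}ry -(wdistE y g Ah2); exact: (wdist_rho_le Ah1 Cd (reg _ Cy) (reg _ Cg)).
  have l2 : (dE (r g) y0 <= dE g y0)%N.
    by rewrite -{1}ry0 -(wdistE g y0 Ah2); exact: (wdist_rho_le Ah1 Cd (reg _ Cg) (reg _ Cy0)).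
  have l3 := dE_tri arr y y0 (Cr _ Cg).
  split; last by apply: between_same_side (Cr _ Cg) Mu _ uy uy0; rewrite -e leq_add.
  apply/eqP; rewrite eqn_leq l1/= -(leq_add2r (dE g y0)) e; apply: leq_trans l3 _.
  by rewrite leq_add2l.
suff [k [Ak kh1 ky0 kd']] : exists k, [/\ A k, agree k h1 d, k y0 = h2 y0 & k d' = h1 d'].
  rewrite -kd'; symmetry; apply: (beyond_adjacent Ak Ah0 _ P Cy0 Cy0 uy0 uy0).
    exact: agree_trans kh1 (agree_sym h01).
  by left; rewrite ky0 h2y0 wdistE// (cell_dE0 (cell_refl _ _)).
suff ind m g : in_chamber M g -> (dE y g + dE g y0 = dE y y0)%N -> dE y g = m ->
    exists k, [/\ A k, agree k h1 d, k (r g) = h2 g & k d' = h1 d'].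
  have [|k [Ak kh1 ky0 kd']] := ind _ y0 Cy0 _ erefl.
    by rewrite (cell_dE0 (cell_refl M y0)) addn0.
  by exists k; split => //; rewrite -ky0 /r ry0.
elim: m g => [|m IH] g Cg e yg.
  have [|x xg _] := same_chamber_range Ah1 Cy (reg _ Cg).
    by rewrite -h2y wdistE.
  by exists h1; split => //; rewrite /r -xg rho_id.
have [g1 [Cg1 yg1 g1g _ _]] := last_step arr Cy Cg yg.
have e1 : (dE y g1 + dE g1 y0 = dE y y0)%N.
  apply/eqP; rewrite eqn_leq (dE_tri arr)// andbT -e yg yg1 addSnnS leq_add2l.
  by rewrite -add1n -g1g; exact: dE_tri.
have [k1 [Ak1 k1h1 k1g1 k1d']] := IH _ Cg1 e1 yg1.
have [k [Ak kh1 kg]] := rhoP (h2 g) Ah1 Cd.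
exists k; split => //; rewrite -k1d'; symmetry.
have [b1 s1] := btw _ Cg1 e1; have [b2 s2] := btw _ Cg e.
apply: (beyond_adjacent Ak1 Ak _ P (Cr _ Cg1) (Cr _ Cg) s1 s2).
  exact: agree_trans k1h1 (agree_sym kh1).
right; rewrite k1g1 kg wdistE//; split => // dd.
have rr : dE (r g1) (r g) = 1%N.
  have : (dE (r g1) (r g) <= 1)%N.
    by rewrite -g1g -(wdistE g1 g Ah2); exact: (wdist_rho_le Ah1 Cd (reg _ Cg1) (reg _ Cg)).
  rewrite leq_eqVlt => /orP[/eqP //|]; rewrite ltnS leqn0 => /eqP /(dE0_cell arr (Cr _ Cg1) (Cr _ Cg)) c0.
  have := dE_cell arr Cy (Cr _ Cg1) (cell_refl _ _) c0; rewrite b1 b2 yg yg1 => /eqP.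
  by rewrite eqn_leq ltnn andbF.
have [v [b [q Q]]] := adjacent_panel arr (Cr _ Cg1) (Cr _ Cg) rr.
have [[_ _ Mv _] _ _ _ _] := Q.
have [vd|vd|/(Cd _ Mv)//] := ltgtP (dot v d) b.
  by have := dE_panel arr Q Cd vd; rewrite dd => /eqP; rewrite -[X in X == _]addn0 -addn1 eqn_add2l.
have vd' : dot (- v) d < - b by rewrite dotNl ltrN2.
by have := dE_panel arr (panel_sym Q) Cd vd'; rewrite dd => /eqP; rewrite -[X in X == _]addn0 -addn1 eqn_add2l.
Qed.

(* A partial map given by its graph, any two chambers of which lie in a common
   chart. *)
Definition charted (G : set (E * X)) : Prop := forall a b, G a -> G b ->
  exists h, [/\ A h, in_chamber M a.1 /\ h a.1 = a.2, in_chamber M b.1 /\ h b.1 = b.2,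
    forall z, cell M a.1 z -> G (z, h z) & forall z, cell M b.1 z -> G (z, h z)].

Lemma charted_fun G x p q : charted G -> G (x, p) -> G (x, q) -> p = q.
Proof. by move=> cG Gp Gq; have [h [_ [_ /= <-] [_ /= <-] _ _]] := cG _ _ Gp Gq. Qed.

(** A chamber of the domain on the side of [d] is joined to the new chamber by [extend_away], one on
    the far side by [beyond_unique]. *)
Lemma charted_step G d p d' : charted G -> G (d, p) -> in_chamber M d' -> dE d d' = 1%N ->
  exists2 k, A k & charted (G `|` [set a | cell M d' a.1 /\ a.2 = k a.1]).
Proof.
move=> cG Gd Cd' dd'.
have [k0 [_ [Cd _] _ _ _]] := cG _ _ Gd Gd.
have [u [c [z P]]] := adjacent_panel arr Cd Cd' dd'.
have [[_ _ Mu _] _ _ _ _] := P.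
(* If the domain meets the far side, the new value is dictated there, so [k] is taken through [d]
   and a chamber of the far side; otherwise any chart at [d] serves. *)
have [k [Ak kd kfar]] : exists k, [/\ A k, forall z, cell M d z -> G (z, k z)
    & forall y q, G (y, q) -> c < dot u y -> exists y0, [/\ in_chamber M y0, G (y0, k y0) & c < dot u y0]].
  have [[[y q] [Gy uy]]|no] := pselect (exists a, G a /\ c < dot u a.1).
    have [k [Ak [_ _] [Cy _] k1 k2]] := cG _ _ Gd Gy; exists k; split => // _ _ _ _.
    by exists y; split => //; apply: k2; exact: cell_refl.
  have [k [Ak _ _ k1 _]] := cG _ _ Gd Gd; exists k; split => // y q Gy uy.
  by exfalso; apply: no; exists (y, q).
exists k => //; set G' := _ `|` _.
have mixed y q e : G (y, q) -> cell M d' e -> exists h, [/\ A h, in_chamber M y /\ h y = q,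
    in_chamber M e /\ h e = k e, forall z, cell M y z -> G' (z, h z)
    & forall z, cell M e z -> G' (z, h z)].
  move=> Gy d'e; have Ce := M_cell_chamber arr Cd' d'e.
  have [h1 [Ah1 _ [/= Cy h1y] h1d h1c]] := cG _ _ Gd Gy.
  have h1k : agree h1 k d.
    apply: agreeP => // a da; exact: (charted_fun cG (h1d _ da) (kd _ da)).
  suff [h [Ah hh1 hk]] : exists h, [/\ A h, agree h h1 y & agree h k d'].
    exists h; split => //.
    - by split => //; rewrite (hh1 _ (@in_closed_cell_refl _ _ M y)).
    - by split => //; apply: hk; case: d'e.
    - by move=> a ya; left; rewrite hh1; [exact: h1c|case: ya].
    - move=> a ea; right; split; first exact: cell_trans d'e ea.
      by apply: hk; case: (cell_trans d'e ea).
  have [uy|uy|/(Cy _ Mu)//] := ltgtP (dot u y) c.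
    by have [h [Ah hh1 _ hk]] := extend_away Ah1 Ak h1k P Cy uy; exists h.
  have [y0 [Cy0 Gy0 uy0]] := kfar _ _ Gy uy.
  have [h2 [Ah2 [_ h2y] [_ h2y0] _ _]] := cG _ _ Gy Gy0.
  have kd' : k d' = h1 d'.
    apply: (beyond_unique Ah1 Ak Ah2 (agree_sym h1k) P Cy Cy0 uy uy0) => //.
    by rewrite h1y.
  have [_ h1kd'] := agree_point Ah1 Ak Cd h1k (esym kd').
  by exists h1; split.
move=> [x a'] [y b'] /= [Ga|[/= xa ->]] [Gb|[/= yb ->]].
- have [h [Ah ha hb h1 h2]] := cG _ _ Ga Gb; by exists h; split => // e he; left; [exact: h1|exact: h2].
- exact: mixed.
- by have [h [Ah h1 h2 h3 h4]] := mixed _ _ _ Gb xa; exists h.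
- have ok e : cell M d' e -> forall z, cell M e z -> G' (z, k z).
    by move=> d'e a ea; right; split => //; exact: cell_trans d'e ea.
  by exists k; split => //; [split => //; exact: M_cell_chamber xa|split => //; exact: M_cell_chamber yb|exact: ok|exact: ok].
Qed.

End Beyond.

Variable v0 : E.
Hypothesis Cv0 : in_chamber L v0.
Hypothesis cpl : complete_atlas M A.

(** * Extension of partial charts to apartments *)

Section Extension.
Implicit Types (f h k : E -> X) (x y z d e u g : E) (p q : X) (t c : R).

Lemma chamber_cover z : exists2 x, in_chamber M x & in_closed_cell M x z.
Proof.
have [e e0 /(_ (e / 2))] := regular_near arr z Cv0.
rewrite divr_gt0//= ltr_pdivrMr// ltr_pMr ?ltr1n// => /(_ isT)[Cx xz].
by exists (z + (e / 2) *: v0).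
Qed.

(** The maps that agree with a chart on any two cells form a building atlas containing [A], so
    completeness makes them charts. *)
Lemma complete_chart h : (forall x y, exists h', [/\ A h',
    forall z, cell M x z -> h z = h' z & forall z, cell M y z -> h z = h' z]) -> A h.
Proof.
pose A' := [set h | forall x y, exists h', [/\ A h',
    forall z, cell M x z -> h z = h' z & forall z, cell M y z -> h z = h' z]].
move=> Ph; suff : building_atlas M A'.
  by move/cpl; apply => // f Af x y; exists f.
case: (atl) => cov iso comp two chg.
have AA' f : A f -> A' f by move=> Af x y; exists f.
have im f f' x : (forall z, cell M x z -> f z = f' z) -> f @` cell M x = f' @` cell M x.
  by move=> ff; apply/seteqP; split => _ [z xz <-]; exists z; rewrite ?ff.
split.
- by move=> p; have [f Af fp] := cov p; exists f => //; exact: AA'.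
- move=> f A'f x y; have [f' [Af' fx fy]] := A'f x y.
  by rewrite fx ?fy ?(iso _ Af')//; exact: cell_refl.
- move=> f w A'f Ww x y; have [f' [Af' fx fy]] := A'f (w x) (w y).
  exists (f' \o w); split; first exact: comp.
    by move=> z xz /=; rewrite fx//; apply/(W_cell arr _ _ Ww).
  by move=> z xz /=; rewrite fy//; apply/(W_cell arr _ _ Ww).
- move=> f g x y A'f A'g; have [f' [Af' fx _]] := A'f x x; have [g' [Ag' gy _]] := A'g y y.
  have [k [a [b [Ak ka kb]]]] := two f' g' x y Af' Ag'.
  by exists k, a, b; rewrite (im _ _ _ fx) (im _ _ _ gy); split => //; exact: AA'.
- move=> f g x y x' y' A'f A'g; have [f' [Af' fx fy]] := A'f x y; have [g' [Ag' gx gy]] := A'g x' y'.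
  rewrite (im _ _ _ fx) (im _ _ _ fy) (im _ _ _ gx) (im _ _ _ gy) => ex ey.
  have [w Ww fgw] := chg f' g' x y x' y' Af' Ag' ex ey; exists w => // z.
  have inj := chart_inj Ag'.
  case=> xz.
    have : (g' @` cell M x') (g' (w z)) by rewrite -ex; exists z => //; rewrite fgw//; left.
    by move=> [b x'b /inj bw]; rewrite fx// fgw; [rewrite -gx// -bw|left].
  have : (g' @` cell M y') (g' (w z)) by rewrite -ey; exists z => //; rewrite fgw//; right.
  by move=> [b x'b /inj bw]; rewrite fy// fgw; [rewrite -gy// -bw|right].
Qed.

(** Zorn's lemma gives a maximal charted extension. It is defined on all chambers, since
    [charted_step] would otherwise enlarge it along a gallery, and it is then prolonged to the
    walls. *)
Lemma charted_extends G a0 : charted G -> G a0 ->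
  exists2 h, A h & forall a, G a -> h a.1 = a.2.
Proof.
move=> cG Ga0.
have [|K [cK Kmax]] := @Zorn_bigcup _ [set K | charted (G `|` K)].
  move=> F FP tot a b Ga Gb.
  suff [K [cK Ka Kb sub]] : exists K, [/\ charted (G `|` K), (G `|` K) a, (G `|` K) b &
      K `<=` \bigcup_(Y in F) Y].
    have [h [Ah ha hb h1 h2]] := cK _ _ Ka Kb.
    have sub' : G `|` K `<=` G `|` \bigcup_(Y in F) Y by move=> y [|/sub]; [left|right].
    by exists h; split => // z za; apply: sub'; [exact: h1|exact: h2].
  case: Ga => [Ga|[Y FY Ya]]; case: Gb => [Gb|[Y' FY' Yb]].
  - by exists set0; split; rewrite ?setU0.
  - by exists Y'; split; [exact: FP|left|right|exact: bigcup_sup].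
  - by exists Y; split; [exact: FP|right|left|exact: bigcup_sup].
  - have [YY|YY] := tot _ _ FY FY'.
      by exists Y'; split; [exact: FP|right; exact: YY|right|exact: bigcup_sup].
    by exists Y; split; [exact: FP|right|right; exact: YY|exact: bigcup_sup].
set K1 := G `|` K in cK.
have K1a : K1 a0 by left.
have [_ [_ [C0 _] _ _ _]] := cK _ _ K1a K1a.
have total y : in_chamber M y -> exists p, K1 (y, p).
  move=> Cy; move dy: (dE a0.1 y) => m; elim: m y Cy dy => [|m IH] y Cy dy.
    have [h [Ah _ _ hc _]] := cK _ _ K1a K1a; exists (h y); apply: hc.
    exact: (dE0_cell arr).
  have [y' [Cy' dy' yy _ _]] := last_step arr C0 Cy dy.
  have [p K1y'] := IH _ Cy' dy'; apply: contrapT => no.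
  have [k Ak ck] := charted_step cK K1y' Cy yy.
  apply: (Kmax (K `|` [set a | cell M y a.1 /\ a.2 = k a.1])); last by rewrite /= setUA.
  split; first by move=> a Ka; left.
  move=> /(_ (y, k y)) sub; apply: no; exists (k y); right; apply: sub; right.
  by split => //; exact: cell_refl.
(* The value at [z] is read in a chart of any chamber whose closure contains [z]; two such chambers
   lie in a common chart, so the choice is immaterial. *)
pose near z h := exists x, [/\ A h, in_chamber M x, in_closed_cell M x z & forall y, cell M x y -> K1 (y, h y)].
have near_fun z h h' : near z h -> near z h' -> h z = h' z.
  move=> [x [Ah Cx xz hx]] [x' [Ah' Cx' xz' hx']].
  have [k [Ak _ _ k1 k2]] := cK _ _ (hx _ (cell_refl _ _)) (hx' _ (cell_refl _ _)).
  have -> : h z = k z by apply: (agreeP Ah Ak) xz => y xy; exact: (charted_fun cK (hx _ xy) (k1 _ xy)).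
  by apply: (agreeP Ak Ah') xz' => y xy; exact: (charted_fun cK (k2 _ xy) (hx' _ xy)).
have near_ex z : exists h, near z h.
  have [x Cx xz] := chamber_cover z; have [p Kp] := total _ Cx.
  by have [h [Ah _ _ h1 _]] := cK _ _ Kp Kp; exists h, x.
have [c cP] := choice near_ex; pose h z := c z z.
have hE z k : near z k -> h z = k z by move=> nk; exact: near_fun (cP z) nk.
exists h.
  apply: complete_chart => x y.
  have [x' Cx' xx'] := chamber_cover x; have [y' Cy' yy'] := chamber_cover y.
  have [p Kx] := total _ Cx'; have [q Ky] := total _ Cy'.
  have [k [Ak _ _ k1 k2]] := cK _ _ Kx Ky; exists k; split => // z [xz _]; apply: hE.
    by exists x'; split => //; exact: closed_cell_trans xx' xz.
  by exists y'; split => //; exact: closed_cell_trans yy' xz.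
move=> a Ga; have K1g : K1 a by left.
have [k [Ak [Ca ka] _ k1 _]] := cK _ _ K1g K1g.
by rewrite -ka; apply: hE; exists a.1; split => //; exact: in_closed_cell_refl.
Qed.

(** The open chambers of the half-apartment together with the new chamber form a charted set,
    because [extend_away] supplies the charts for mixed pairs. *)
Lemma half_apartment h k d d' u c z : A h -> A k -> agree k h d ->
  panel_between M d d' u c z ->
  exists h', [/\ A h', forall y, dot u y <= c -> h' y = h y & agree h' k d'].
Proof.
move=> Ah Ak kh P.
have [[Cd Cd' Mu _] /andP[ud ud'] _ _ _] := P.
pose G : set (E * X) := [set a | (in_chamber M a.1 /\ dot u a.1 < c) /\ a.2 = h a.1] `|`
  [set a | cell M d' a.1 /\ a.2 = k a.1].
have sideH x y : in_chamber M x -> dot u x < c -> cell M x y -> G (y, h y).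
  move=> Cx ux xy; left; split => //=; have Cy := M_cell_chamber arr Cx xy; split => //.
  exact: cell_lt xy ux.
have mixed x y : in_chamber M x -> dot u x < c -> cell M d' y -> exists l, [/\ A l,
    in_chamber M x /\ l x = h x, in_chamber M y /\ l y = k y,
    forall z, cell M x z -> G (z, l z) & forall z, cell M y z -> G (z, l z)].
  move=> Cx ux d'y; have [l [Al lx _ lk]] := extend_away Ah Ak (agree_sym kh) P Cx ux.
  exists l; split => //.
  - by split => //; apply: lx; exact: in_closed_cell_refl.
  - by split; [exact: (M_cell_chamber arr Cd' d'y)|apply: lk; case: d'y].
  - by move=> a xa; rewrite lx; [exact: sideH xa|case: xa].
  - move=> a ya; right; split; first exact: cell_trans d'y ya.
    by apply: lk; case: (cell_trans d'y ya).
have cG : charted G.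
  move=> [x a'] [y b'] [[/= [Cx ux] ->]|[/= xa ->]] [[/= [Cy uy] ->]|[/= yb ->]].
  - by exists h; split => // a; exact: sideH.
  - exact: mixed.
  - by have [l [Al h1 h2 h3 h4]] := mixed _ _ Cy uy xa; exists l.
  - have ok e : cell M d' e -> forall z, cell M e z -> G (z, k z).
      by move=> d'e a ea; right; split => //; exact: cell_trans d'e ea.
    by exists k; split => //; [split => //; exact: M_cell_chamber xa|split => //; exact: M_cell_chamber yb|exact: ok|exact: ok].
have [h' Ah' h'G] := charted_extends cG (sideH _ _ Cd ud (cell_refl _ _)).
exists h'; split => //; last first.
  by apply: agreeP => // y d'y; apply: (h'G (y, k y)); right.
have open y : in_chamber M y -> dot u y < c -> h' y = h y.
  by move=> Cy uy; exact: (h'G _ (sideH _ _ Cy uy (cell_refl _ _))).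
(* A regular direction pointing into the half-space: through it every point, even on the bounding
   wall, is approached from open chambers. *)
have [v [Cv uv]] : exists v, in_chamber (linear_walls M) v /\ dot u v < 0.
  have [uv|uv|uv] := ltgtP (dot u v0) 0; [by exists v0| |].
    by exists (- v0); split; [exact: (L_chamberN arr)|rewrite dotNr oppr_lt0].
  by have := (L_chamberP arr _).1 Cv0 _ (L_wall arr Mu); rewrite uv eqxx.
move=> y uy; have [e e0 /(_ (e / 2))] := regular_near arr y Cv.
rewrite divr_gt0//= ltr_pdivrMr// ltr_pMr ?ltr1n// => /(_ isT)[Cx xy].
apply: (agreeP Ah' Ah) xy => a xa.
have ux : dot u (y + (e / 2) *: v) < c.
  rewrite dotDr dotZr; apply: lt_le_trans uy; rewrite gtrDl.
  by rewrite pmulr_rlt0// divr_gt0.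
apply: open; first exact: M_cell_chamber xa.
exact: (cell_lt Mu (M_cell_chamber arr Cx xa) xa ux).
Qed.

End Extension.

(** * Apartments containing prescribed sectors *)

Section Sectors.
Implicit Types (f g h k l : E -> X) (x y z d e u v a b : E) (p q : X) (t c : R) (w : E -> E).

Definition sector_eq f g a v : Prop := forall y, in_closed_cell L v y -> f (a + y) = g (a + y).

Lemma sector_eq_sub f g a b v : in_closed_cell L v (b - a) -> sector_eq f g a v -> sector_eq f g b v.
Proof.
move=> vb fg y vy; rewrite -(subrK a b) addrAC [_ + a]addrC; apply: fg; exact: cone_add.
Qed.

Lemma sector_eq_trans f g h a v : sector_eq f g a v -> sector_eq g h a v -> sector_eq f h a v.
Proof. by move=> fg gh y vy; rewrite fg ?gh. Qed.

Lemma common_subsector v a b : in_chamber L v ->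
  exists e, in_closed_cell L v (e - a) /\ in_closed_cell L v (e - b).
Proof.
move=> Cv; have [S Sab] := cone_absorb arr Cv0 0 Cv; have [T Tab] := cone_absorb arr Cv0 (b - a) Cv.
pose t := Num.max S T; exists (b + t *: v); split.
  by rewrite addrAC addrC; apply: Tab; rewrite le_max lexx orbT.
by rewrite addrAC subrr add0r -[t *: v]addr0; apply: Sab; rewrite le_max lexx.
Qed.

(** Since [u] is negative on the whole cone, moving the apex far enough along [v] puts the sector
    into the half-space. *)
Lemma sector_eq_half f g h a v u c : in_chamber L v -> M (hyperplane u c) -> dot u v < 0 ->
  sector_eq h g a v -> (forall y, dot u y <= c -> f y = h y) ->
  exists b, sector_eq f g b v.
Proof.
move=> Cv Mu uv hg fh; pose t := Num.max 0 ((c - dot u a) / dot u v).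
exists (a + t *: v) => y vy.
have t0 : 0 <= t by rewrite le_max lexx.
have vty : in_closed_cell L v (t *: v + y) by apply: cone_add => //; apply: cone_scale.
have uy : dot u y <= 0 by apply: vy; [exact: L_wall Mu|exact: ltW].
rewrite -addrA fh ?hg// !dotDr dotZr.
have : t * dot u v <= c - dot u a.
  by rewrite -ler_ndivrMr// le_max lexx orbT.
by lra.
Qed.

(** Retracted from [x'], the chamber [l x'] lands on [x'] or on [x]. In the first case it belongs to
    the apartment of [h]; in the second it takes the place of [x] in a chart that agrees with [h] on
    [x']. *)
Lemma panel_refold h l x x' u c z : A h -> A l -> agree l h x -> panel_between M x x' u c z ->
  (exists e, h e = l x') \/ exists k e, [/\ A k, agree k h x', cell M x e & k e = l x'].
Proof.
move=> Ah Al lh P; have [[Cx Cx' Mu uz] _ _ [xz x'z] _] := P.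
have rq : regular (l x') by exists l, x'.
have [k [Ak kh ke]] := rhoP (l x') Ah Cx'.
set e := rho h x' (l x') in ke.
have Ce : in_chamber M e by exact: rho_regular.
have ez : in_closed_cell M e z by apply: rho_closed_cell => //; exact: lh.
have := panel_cells arr P Ce ez; case: ifPn => _ xe; first by right; exists k, e.
left; have [|y hy _] := same_chamber_range Ah Cx' rq; last by exists y.
by rewrite (wdist_rho _ Ah Cx' (@in_closed_cell_refl _ _ M x')) (cell_dE0 xe).
Qed.

(* Following a gallery from the sector to [p], each step either stays in the
   current apartment or is absorbed by a half-apartment containing a
   subsector. *)
Lemma sector_point g v p : A g -> in_chamber L v -> regular p ->
  exists h a, [/\ A h, sector_eq h g a v & exists x, h x = p].
Proof.
move=> Ag Cv rp.
suff ind m h x a : A h -> in_chamber M x -> sector_eq h g a v -> wdist (h x) p = m ->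
    exists h a, [/\ A h, sector_eq h g a v & exists x, h x = p].
  have [x Cx _] := chamber_cover 0.
  exact: (ind _ g x 0 Ag Cx (fun y _ => erefl) erefl).
elim: m h x a => [|m IH] h x a Ah Cx hg hm.
  by have [z hz _] := same_chamber_range Ah Cx rp hm; exists h, a; split => //; exists z.
have [l [Al lh lp]] := rhoP p Ah Cx; set y := rho h x p in lp.
have Cy : in_chamber M y by exact: rho_regular.
have yx : dE y x = m.+1.
  by rewrite dEC -hm; apply/esym/wdist_rho => //; exact: in_closed_cell_refl.
have [x' [Cx' yx' xx' _ _]] := last_step arr Cy Cx yx.
have lm : wdist (l x') p = m by rewrite -lp wdistE// dEC.
have xx : dE x x' = 1%N by rewrite dEC.
have [u [c [z P]]] := adjacent_panel arr Cx Cx' xx.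
have [[_ _ Mu uz] /andP[ux ux'] _ _ _] := P.
(* Exactly one side of the wall contains a subsector of direction [v]; the half-apartment on that
   side is the one to keep. *)
have [uv|uv|e] := ltgtP (dot u v) 0; last by have := (L_chamberP arr _).1 Cv _ (L_wall arr Mu); rewrite e eqxx.
- have [h' [Ah' h'h h'l]] := half_apartment Ah Al lh P.
  have [b h'g] := sector_eq_half Cv Mu uv hg h'h.
  apply: (IH h' x' b) => //; rewrite h'l//; exact: in_closed_cell_refl.
- have [[e he]|[k [e [Ak kh xe ke]]]] := panel_refold Ah Al lh P.
    apply: (IH h e a) => //; last by rewrite he.
    by apply: (regular_chart Ah); rewrite he; exists l, x'.
  have [h' [Ah' h'h h'k]] := half_apartment Ah Ak kh (panel_sym P).
  have uv' : dot (- u) v < 0 by rewrite dotNl oppr_lt0.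
  have [b h'g] := sector_eq_half Cv (wallN Mu) uv' hg h'h.
  apply: (IH h' e b) => //; first exact: M_cell_chamber xe.
  by rewrite h'k ?ke//; case: xe.
Qed.

(** Combinatorial form of the sector of direction [v] based at the chamber of [x]: its chambers are
    the intersection of the half-spaces containing [x] and unbounded towards [v]. *)
Definition upward x v y : Prop := in_chamber M y /\
  forall u c, M (hyperplane u c) -> 0 < dot u v -> c < dot u x -> c < dot u y.

Lemma upward_cell x v y y' : upward x v y -> cell M y y' -> upward x v y'.
Proof.
move=> [Cy up] yy; split; first exact: M_cell_chamber yy.
move=> u c Mu uv ux; have := up _ _ Mu uv ux.
have Cy' := M_cell_chamber arr Cy yy.
by have := cell_lt (wallN Mu) Cy' yy; rewrite !dotNl !ltrN2.
Qed.

Lemma upward_refl x v : in_chamber M x -> upward x v x.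
Proof. by []. Qed.

Lemma upward_sector f g x v : A f -> A g -> in_chamber L v ->
  (forall y, upward x v y -> f y = g y) -> sector_eq f g x v.
Proof.
move=> Af Ag Cv fg y vy; have [e e0 /(_ (e / 2))] := regular_near arr (x + y) Cv.
rewrite divr_gt0//= ltr_pdivrMr// ltr_pMr ?ltr1n// => /(_ isT)[Cz zy].
have uz : upward x v (x + y + (e / 2) *: v).
  split=> // u c Mu uv ux; rewrite -addrA dotDr ltr_wpDr//.
  apply: (cone_pos (L_wall arr Mu)) (ltW uv); apply: cone_add => //.
  by apply: cone_scale => //; rewrite divr_ge0// ltW.
by apply: (agreeP Af Ag) zy => z' zz; apply: fg; exact: upward_cell zz.
Qed.

Lemma panel_near d d' u c z : panel_between M d d' u c z -> exists2 e : R, 0 < e &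
  forall z', dot u z' = c -> enorm (z' - z) < e -> in_closed_cell M d z' /\ in_closed_cell M d' z'.
Proof.
move=> [[Cd Cd' Mu uz] _ uniq [dz d'z] _]; have [e e0 /avoid_closed_cell near] := near_walls arr z.
exists e => // z' uz' z'e.
suff H y : in_closed_cell M y z -> in_closed_cell M y z' by split; exact: H.
move=> yz v b Mv vy; have vz := yz _ _ Mv vy.
have [vzb|vzb] := eqVneq (dot v z) b.
  have vu := uniq _ Mv vzb.
  have : hyperplane v b z' by rewrite vu.
  by rewrite /hyperplane /= => ->.
rewrite leNgt; apply/negP => vz'.
have := near _ z'e _ _ (wallN Mv); rewrite !dotNl !lerN2 => /(_ (ltW vz')) bz.
by move: vzb; rewrite eq_le vz bz.
Qed.

(** [w] fixes an open piece of the wall, so its linear part is the identity or the reflection on the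
    normal; the identity is excluded because [w] brings [y'] back to the side of [y]. *)
Lemma folded_lin h l y y' u c z w : A h -> A l -> panel_between M y y' u c z ->
  (forall a, dot u a = c -> in_closed_cell M y a -> in_closed_cell M y' a -> l a = h a) ->
  W w -> (forall a, in_closed_cell M y' a -> l a = h (w a)) -> cell M y (w y') ->
  forall v, lin w v = reflection u 0 v.
Proof.
move=> Ah Al P lh Ww lw yw v.
have [e e0 near] := panel_near P; have [[Cy Cy' Mu uz] /andP[uy uy'] _ [yz y'z] _] := P.
have u0 := wall_neq0 arr Mu.
have fixw a : dot u a = c -> enorm (a - z) < e -> w a = a.
  move=> ua ae; have [ya y'a] := near _ ua ae; apply: (chart_inj Ah).
  by rewrite -lw// lh.
have wz : w z = z by apply: fixw => //; rewrite subrr enorm0.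
have perp r : dot u r = 0 -> lin w r = r.
  move=> ur; have X0 : 0 < enorm r + 1 by rewrite ltr_wpDl ?enorm_ge0.
  have [t /andP[t0 te] _] := exists_notin [::] (divr_gt0 e0 X0).
  have := fixw (z + t *: r); rewrite dotDr dotZr ur mulr0 addr0 => /(_ uz).
  rewrite [in enorm _]addrAC subrr add0r enormZ gtr0_norm// (W_D _ _ Ww) wz (W_linZ _ _ Ww).
  have le : t * enorm r < e.
    move: te; rewrite ltr_pdivlMr//; apply: le_lt_trans.
    by apply: ler_wpM2l; [exact: ltW|rewrite lerDl].
  by move=> /(_ le) /addrI /scalerI; apply; exact: lt0r_neq0.
have uu : dot u u != 0 by rewrite dot_eq0.
pose k := dot u (lin w u) / dot u u.
have wu : lin w u = k *: u.
  apply/eqP; rewrite -subr_eq0 -dot_eq0; set r := lin w u - _.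
  have ur : dot u r = 0 by rewrite dotBr dotZr divfK// subrr.
  rewrite {1}/r dotBl dotZl ur mulr0 subr0 -{1}(perp _ ur) (W_lin_dot _ _ Ww).
  by rewrite ur.
have k1 : k ^+ 2 = 1.
  have := W_lin_dot u u Ww; rewrite wu dotZl dotZr mulrA -expr2.
  by rewrite -[X in _ = X]mul1r => /(mulIf uu).
have vE : v = (v - (dot u v / dot u u) *: u) + (dot u v / dot u u) *: u by rewrite subrK.
have vp : dot u (v - (dot u v / dot u u) *: u) = 0 by rewrite dotBr dotZr divfK// subrr.
rewrite {1}vE (W_linD _ _ Ww) perp// (W_linZ _ _ Ww) wu.
move/eqP: k1; rewrite sqrf_eq1 => /orP[] /eqP kE.
  exfalso; have wid b : lin w b = b.
    have bE : b = (b - (dot u b / dot u u) *: u) + (dot u b / dot u u) *: u by rewrite subrK.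
    have bp : dot u (b - (dot u b / dot u u) *: u) = 0 by rewrite dotBr dotZr divfK// subrr.
    by rewrite {1}bE (W_linD _ _ Ww) perp// (W_linZ _ _ Ww) wu kE scale1r -bE.
  have wy' : w y' = y' by rewrite -(subrK z y') addrC (W_D _ _ Ww) wz wid.
  have := cell_lt Mu Cy' _ uy; rewrite -wy' => /(_ yw); rewrite wy' => h1.
  by move: (lt_trans h1 uy'); rewrite ltxx.
rewrite kE scaleN1r /reflection subr0 scalerN -addrA -opprD -scalerDl.
by congr (_ - _ *: _); ring.
Qed.

(* Retract [f] from the direction [v']: among all chambers choose one where the
   retracted direction [V] of [v] is farthest from [v'].  From there on the
   retraction does not fold the sector any more, so that this sector and a
   sector of direction [v'] can be assembled in one chart. *)
Lemma two_sectors f g v v' : A f -> A g -> in_chamber L v -> in_chamber L v' ->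
  exists h w V a b, [/\ A h, W w, lin w V = v, sector_eq (f \o w) h a V & sector_eq h g b v'].
Proof.
move=> Af Ag Cv Cv'.
pose P m := exists h w V x b, [/\ A h /\ W w, lin w V = v, in_chamber M x,
  sector_eq h g b v' /\ agree (f \o w) h x & ncard (sepset L v' V) = m].
have exP : exists m, `[< P m >].
  have [x Cx _] := chamber_cover 0.
  have [|h [b [Ah hg [y hy]]]] := @sector_point g v' (f x) Ag Cv'; first by exists f, x.
  have [w [Ww wy _ wc _]] := chart_change Ah Af hy hy.
  have [w' [Ww' ww' w'w]] := W_inv arr Ww.
  exists (ncard (sepset L v' (lin w' v))); apply/asboolP.
  exists h, w, (lin w' v), y, b; split => //.
  - by rewrite (W_linK Ww' Ww).
  - by apply: (regular_chart Ah); rewrite hy; exists f, x.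
  - by split => // a ya; rewrite wc.
(* Finiteness of the linear walls makes the maximum exist. *)
have bndP m : `[< P m >] -> (m <= ncard L)%N.
  move=> /asboolP[h [w [V [x [b [_ _ _ _ <-]]]]]].
  by apply: ncard_le; [exact: (L_finite arr Cv0)|move=> H [u [c [-> Lu _ _]]]].
have [m /asboolP[h [w [V [x [b [[Ah Ww] wV Cx [hg fh] mE]]]]]] mmax] := ex_maxnP exP bndP.
have AF := chart_comp Af Ww; set F := f \o w in AF fh.
have CV : in_chamber L V by rewrite -(lin_chamber arr V Ww) wV.
(* Each chamber [upward] towards [V] shares a chart with all chambers [upward] towards [v']; this is
   proved along a minimal gallery from [x]. *)
have step i y : upward x V y -> dE x y = i ->
    exists k, [/\ A k, forall y', upward x v' y' -> k y' = h y' & agree k F y].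
  elim: i y => [|i IH] y [Cy up] xy.
    by exists h; split => //; apply: agree_cell (agree_sym fh); exact: (dE0_cell arr).
  have [y1 [Cy1 xy1 yy sub1 sub2]] := last_step arr Cx Cy xy.
  have up1 : upward x V y1.
    split=> // u c Mu uV ux; have [uy1|//|/(Cy1 _ Mu)//] := ltgtP (dot u y1) c.
    have : sepset M x y (hyperplane u c) by apply: sub1; rewrite sepsetC; exists u, c.
    move=> /(sep_rep (wall_neq0 arr Mu))[[h1 _]|[_ h1]].
      by move: (lt_trans h1 ux); rewrite ltxx.
    by move: (lt_trans h1 (up _ _ Mu uV ux)); rewrite ltxx.
  have [k [Ak kh kF]] := IH _ up1 xy1.
  have [u [c [z Q]]] := adjacent_panel arr Cy1 Cy yy.
  have [[_ _ Mu uz] /andP[uy1 uy] _ [y1z yz] sQ] := Q.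
  have Hxy : sepset M x y (hyperplane u c) by apply: sub2; rewrite sQ.
  have ux : dot u x < c.
    have [[//]|[_ h1]] := sep_rep (wall_neq0 arr Mu) Hxy.
    by move: (lt_trans h1 uy); rewrite ltxx.
  have uV : 0 < dot u V.
    have [uV|//|e] := ltgtP (dot u V) 0; last first.
      by have := (L_chamberP arr _).1 CV _ (L_wall arr Mu); rewrite e eqxx.
    have := up _ _ (wallN Mu); rewrite !dotNl !ltrN2 oppr_gt0 => /(_ uV ux) h1.
    by move: (lt_trans h1 uy); rewrite ltxx.
  have [uv'|uv'|e] := ltgtP (dot u v') 0; last first.
  - by have := (L_chamberP arr _).1 Cv' _ (L_wall arr Mu); rewrite e eqxx.
  - have [[e ke]|[l [e [Al lk y1e le]]]] := panel_refold Ak AF (agree_sym kF) Q.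
      have [ey kFy] := agree_point Ak AF Cy1 kF ke.
      by exists k; split => //; rewrite -ey.
    (* The half-apartment beyond the panel contains a subsector towards [v']. Attaching [F y] to it
       on the near side turns the retracted direction into the mirror image of [V], which is farther
       from [v']. *)
    exfalso; have [k' [Ak' k'k k'l]] := half_apartment Ak Al lk (panel_sym Q).
    have khs : sector_eq k h x v' := upward_sector Ak Ah Cv' kh.
    have [a [xa ba]] := common_subsector x b Cv'.
    have kg : sector_eq k g a v'.
      exact: sector_eq_trans (sector_eq_sub xa khs) (sector_eq_sub ba hg).
    have uv'' : dot (- u) v' < 0 by rewrite dotNl oppr_lt0.
    have [b' k'g] := sector_eq_half Cv' (wallN Mu) uv'' kg k'k.
    have k'e : F y = k' e by rewrite k'l ?le//; case: y1e.
    have [r [Wr ry _ rc _]] := chart_change AF Ak' k'e k'e.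
    have rE a' : lin r a' = reflection u 0 a'.
      apply: (folded_lin Ak' AF Q _ Wr) => //; last by rewrite ry.
      move=> d ud y1d yd; rewrite k'k ?dotNl ?ud// -kF//.
    have [r' [Wr' rr' r'r]] := W_inv arr Wr.
    have : P (ncard (sepset L v' (reflection u 0 V))).
      exists k', (w \o r'), (reflection u 0 V), e, b'; split => //.
      - by split => //; exact: W_comp.
      - by rewrite (lin_comp _ _ Ww) -rE (W_linK Wr Wr').
      - exact: M_cell_chamber y1e.
      - split => // d ed; rewrite -[in RHS](r'r d) -rc//.
        by rewrite -(W_closed_cell arr _ _ Wr) ry r'r.
    move=> /asboolP/mmax; rewrite -mE leqNgt (reflection_farther arr Cv0)//.
    exact: L_wall Mu.
  (* Here [v'] points to the side of [x], so the kept half-apartment contains every chamber [upward]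
     towards [v']. *)
  - have [k' [Ak' k'k k'F]] := half_apartment Ak AF (agree_sym kF) Q.
    exists k'; split => // y' [Cy' up']; rewrite k'k ?kh//.
    have := up' _ _ (wallN Mu); rewrite !dotNl !ltrN2 oppr_gt0 => /(_ uv' ux).
    exact: ltW.
pose G : set (E * X) := [set a | upward x V a.1 /\ a.2 = F a.1] `|`
  [set a | upward x v' a.1 /\ a.2 = h a.1].
have GF y y' : upward x V y -> cell M y y' -> G (y', F y').
  by move=> uy yy; left; split => //; exact: upward_cell uy yy.
have Gh y y' : upward x v' y -> cell M y y' -> G (y', h y').
  by move=> uy yy; right; split => //; exact: upward_cell uy yy.
have mixed y y' : upward x V y -> upward x v' y' -> exists k, [/\ A k,
    in_chamber M y /\ k y = F y, in_chamber M y' /\ k y' = h y',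
    forall z, cell M y z -> G (z, k z) & forall z, cell M y' z -> G (z, k z)].
  move=> uy uy'; have [k [Ak kh kF]] := step _ _ uy erefl; exists k; split => //.
  - by split; [case: uy|rewrite kF//; exact: in_closed_cell_refl].
  - by split; [case: uy'|rewrite kh].
  - by move=> z yz; rewrite kF; [exact: GF uy yz|case: yz].
  - by move=> z yz; rewrite kh; [exact: Gh uy' yz|exact: upward_cell uy' yz].
have cG : charted G.
  move=> [y p] [y' q] [[/= uy ->]|[/= uy ->]] [[/= uy' ->]|[/= uy' ->]].
  - exists F; split => //; [by split => //; case: uy|by split => //; case: uy'|by move=> z; exact: GF uy|by move=> z; exact: GF uy'].
  - exact: mixed.
  - by have [k [Ak h1 h2 h3 h4]] := mixed _ _ uy' uy; exists k.
  - exists h; split => //; [by split => //; case: uy|by split => //; case: uy'|by move=> z; exact: Gh uy|by move=> z; exact: Gh uy'].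
have [k Ak kG] := charted_extends cG (GF _ _ (upward_refl V Cx) (cell_refl _ _)).
have kF y : upward x V y -> F y = k y by move=> uy; rewrite (kG _ (GF _ _ uy (cell_refl _ _))).
have kh y : upward x v' y -> k y = h y by move=> uy; exact: (kG _ (Gh _ _ uy (cell_refl _ _))).
have [a [xa ba]] := common_subsector x b Cv'.
exists k, w, V, x, a; split => //; first exact: upward_sector.
exact: sector_eq_trans (sector_eq_sub xa (upward_sector Ak Ah Cv' kh)) (sector_eq_sub ba hg).
Qed.

End Sectors.

(** * CAT(0) inequality and convexity of distances *)

Section NonpositiveCurvature.
Implicit Types (p q : X) (s t : R) (c d : R -> X).

Lemma geodesic_point p q t : 0 <= t <= 1 ->
  exists m, mdist p m = t * mdist p q /\ mdist m q = (1 - t) * mdist p q.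
Proof.
move=> /andP[t0 t1]; have [h [a [b [Ah <- <-]]]] := chart_through p q.
exists (h (a + t *: (b - a))); rewrite !chart_isom//; split.
  by rewrite opprD addrA subrr add0r enormN enormZ ger0_norm// enormB.
rewrite (_ : _ - b = (1 - t) *: (a - b)) ?enormZ ?ger0_norm ?subr_ge0//.
by apply/rowP => i; rewrite !mxE; ring.
Qed.

Lemma cat0_ineq p y z m t : 0 <= t <= 1 ->
  mdist y m = t * mdist y z -> mdist m z = (1 - t) * mdist y z ->
  mdist p m ^+ 2 <= (1 - t) * mdist p y ^+ 2 + t * mdist p z ^+ 2 - t * (1 - t) * mdist y z ^+ 2.
Proof.
move=> t01 ym mz; have [h [a [b [Ah ha hb]]]] := chart_through y z.
have cov : exists x, in_chamber M x /\ in_closed_cell M x (a + t *: (b - a)).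
  by have [x] := chamber_cover (a + t *: (b - a)); exists x.
have cat q := cat0_chart q Ah t01 cov.
have dE : enorm (b - a) = mdist y z by rewrite -ha -hb chart_isom// enormB.
(* Uniqueness of geodesics, by the inequality applied to [m] itself. *)
have mE : m = h (a + t *: (b - a)).
  apply/eqP; rewrite -[_ == _]negbK -mdist_gt0 -leNgt -(@ler_pXn2r _ 2)// ?nnegrE ?mdist_ge0//.
  have := cat m; rewrite ha hb dE (metric_sym m y) ym mz; lra.
by have := cat p; rewrite ha hb dE -mE.
Qed.

(** Two uses of the CAT(0) inequality, for the point on one side seen from [z] and then for the
    point on the other side seen from [a]. *)
Lemma thin_triangle p y z a b t : 0 <= t <= 1 ->
  mdist p a = t * mdist p y -> mdist a y = (1 - t) * mdist p y ->
  mdist p b = t * mdist p z -> mdist b z = (1 - t) * mdist p z ->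
  mdist a b <= t * mdist y z.
Proof.
move=> t01 pa ay pb bz; have /andP[t0 t1] := t01.
have h1 := cat0_ineq a t01 pb bz; have h2 := cat0_ineq z t01 pa ay.
rewrite -(@ler_pXn2r _ 2)// ?nnegrE ?mulr_ge0 ?mdist_ge0//.
rewrite (metric_sym a p) (metric_sym a z) pa in h1.
rewrite (metric_sym z p) (metric_sym z y) in h2.
have h3 := ler_wpM2l t0 h2; nra.
Qed.

Lemma ray_dist0 c t : ray c -> 0 <= t -> mdist (c 0) (c t) = t.
Proof. by move=> rc t0; rewrite rc// sub0r normrN ger0_norm. Qed.

Lemma scaled_triangle p y z a b r t : 0 <= r -> r <= t -> 0 < t ->
  mdist p y = t -> mdist p z = t -> mdist p a = r -> mdist a y = t - r ->
  mdist p b = r -> mdist b z = t - r -> mdist a b <= (r / t) * mdist y z.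
Proof.
move=> r0 rt t0 py pz pa ay pb bz.
have s01 : 0 <= r / t <= 1 by rewrite ler_pdivrMr// mul1r rt divr_ge0// ltW.
have rE : r / t * t = r by rewrite divfK// gt_eqF.
have rE' : (1 - r / t) * t = t - r by rewrite mulrBl mul1r rE.
by apply: (thin_triangle (p := p) s01); rewrite ?py ?pz ?rE ?rE'.
Qed.

Lemma ray_shrink c d r t : ray c -> ray d -> c 0 = d 0 -> 0 <= r -> r <= t -> 0 < t ->
  mdist (c r) (d r) <= (r / t) * mdist (c t) (d t).
Proof.
move=> rc rd cd r0 rt t0; have t0' := ltW t0.
have E e : ray e -> mdist (e r) (e t) = t - r.
  by move=> re; rewrite re// ler0_norm ?opprB// subr_le0.
by apply: (@scaled_triangle (c 0)); rewrite ?E ?ray_dist0//; rewrite cd ray_dist0.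
Qed.

(** Cut the quadrilateral by the diagonal from [c 0] to [d T]. The triangle at the far end
    contributes at most [t / T * K], which becomes negligible. *)
Lemma asymptotic_dist c d t : ray c -> ray d -> asymptotic c d -> 0 <= t ->
  mdist (c t) (d t) <= mdist (c 0) (d 0).
Proof.
move=> rc rd [K cK] t0; rewrite leNgt; apply/negP => lt.
set e := mdist (c t) _ in lt; set D := mdist _ _ in lt.
have K0 : 0 <= K by apply: le_trans (cK 0 (lexx 0)); exact: mdist_ge0.
have D0 : 0 <= D by exact: mdist_ge0.
have eD : 0 < e - D by rewrite subr_gt0.
(* Chosen so that [(e - D) * T > t * K], against the comparison below. *)
pose T := t + (t * K + 1) / (e - D).
have tK : 0 <= t * K by rewrite mulr_ge0.
have T0 : 0 < T by rewrite /T ltr_wpDl// divr_gt0// ltr_wpDl.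
have tT : t <= T by rewrite /T lerDl divr_ge0 ?(ltW eD)// addr_ge0.
have T0' := ltW T0.
have s01 : 0 <= t / T <= 1 by rewrite ler_pdivrMr// mul1r tT divr_ge0.
have s01' : 0 <= 1 - t / T <= 1 by move: s01 => /andP[? ?]; apply/andP; split; lra.
have sT : t / T * T = t by rewrite divfK// gt_eqF.
have sT' : (1 - t / T) * T = T - t by rewrite mulrBl mul1r sT.
have [m [m1 m2]] := geodesic_point (c 0) (d T) s01.
have h1 : mdist (c t) m <= t / T * mdist (c T) (d T).
  apply: (thin_triangle (p := c 0) s01) => //; first by rewrite !ray_dist0.
  by rewrite ray_dist0// rc// ler0_norm ?subr_le0// opprB.
have h2 : mdist m (d t) <= (1 - t / T) * mdist (c 0) (d 0).
  apply: (thin_triangle (p := d T) s01').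
  - by rewrite metric_sym m2 (metric_sym (d T)).
  - by rewrite subKr metric_sym m1 metric_sym.
  - by rewrite rd// ger0_norm ?subr_ge0// (metric_sym (d T)) ray_dist0.
  - by rewrite subKr (metric_sym (d t)) (metric_sym (d T)) !ray_dist0.
have := metric_triangle (c t) m (d t); rewrite -/e => h3.
have h4 := cK T T0'; rewrite -/D in h2.
have /andP[s0 _] := s01; have h5 := ler_wpM2l s0 h4.
have h6 : e <= t / T * K + D.
  have : 0 <= t / T * D by rewrite mulr_ge0.
  lra.
have : (e - D) * T <= t * K.
  rewrite -ler_pdivlMr//; move: h6; rewrite mulrAC; lra.
rewrite /T mulrDr [X in _ + X]mulrC divfK ?gt_eqF//.
have : 0 <= (e - D) * t by rewrite mulr_ge0// ltW.
lra.
Qed.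

Lemma asymptotic_eq c d t : ray c -> ray d -> c 0 = d 0 -> asymptotic c d -> 0 <= t -> c t = d t.
Proof.
move=> rc rd cd as_ t0; apply/eqP; rewrite -[_ == _]negbK -mdist_gt0 -leNgt.
by have := asymptotic_dist rc rd as_ t0; rewrite cd mdistxx.
Qed.

End NonpositiveCurvature.

(** * Chambers at infinity *)

Section IdealChambers.
Implicit Types (f g h k : E -> X) (x y z d u v a b al : E) (t : R) (w : E -> E)
  (zeta : ideal_point X) (e : set (ideal_point X)).

Lemma chart_flat f : A f -> euclidean_isometry f.
Proof. by move=> Af x y; exact: chart_isom. Qed.

Lemma ideal_class_eq zeta (c c' : R -> X) : (forall t, 0 <= t -> c t = c' t) ->
  ideal_class zeta c -> ideal_class zeta c'.
Proof.
move=> cc zc; apply: (asymptotic_ideal zc).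
  by move=> s t s0 t0; rewrite -!cc//; exact: (ideal_ray zc).
by exists 0 => t t0; rewrite cc// mdistxx.
Qed.

Lemma sector_from p f v : A f -> in_chamber L v ->
  exists h a z, [/\ A h, sector_eq h f a v & h z = p].
Proof.
move=> Af Cv; have [k [x [_ [Ak kx _]]]] := chart_through p p.
have [x' Cx' x'x] := chamber_cover x.
have [|h [a [Ah hf [y hy]]]] := sector_point (p := k x') Af Cv; first by exists k, x'.
have [w [Ww _ _ wc _]] := chart_change Ak Ah (esym hy) (esym hy).
by exists h, a, (w x); split => //; rewrite -wc.
Qed.

(** The direction lies in a closed chamber at infinity, and some chart contains both [p] and a
    sector towards that chamber. *)
Lemma ray_to p f u zeta : A f -> chart_end f u zeta ->
  exists2 c, ideal_class zeta c & c 0 = p.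
Proof.
move=> Af fu; have [v Cv vu] := direction_cover arr Cv0 u.
have [h [a [z [Ah hf hz]]]] := sector_from p Af Cv; have [u1 _] := fu.
exists (fun t => h (z + t *: u)); last by rewrite scale0r addr0.
apply/(chart_endP _ z (chart_flat Ah) u1)/(chart_endP _ a (chart_flat Ah) u1).
apply: ideal_class_eq ((chart_endP zeta a (chart_flat Af) u1).1 fu) => t t0.
by rewrite hf//; exact: cone_scale.
Qed.

Definition chart_match f g w a v : Prop :=
  forall y, in_closed_cell L v y -> f (a + y) = g (w (a + y)).

Lemma match_end f g w a v u zeta : A f -> A g -> W w -> chart_match f g w a v ->
  in_closed_cell L v u -> chart_end f u zeta <-> chart_end g (lin w u) zeta.
Proof.
move=> Af Ag Ww fg vu.
have E t : 0 <= t -> f (a + t *: u) = g (w a + t *: lin w u).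
  by move=> t0; rewrite fg; [rewrite (W_D _ _ Ww) (W_linZ _ _ Ww)|exact: cone_scale].
split=> [fu|gu].
  have [u1 _] := fu; have u1' : enorm (lin w u) = 1 by rewrite (W_enorm _ Ww).
  apply/(chart_endP _ (w a) (chart_flat Ag) u1').
  exact: ideal_class_eq E ((chart_endP zeta a (chart_flat Af) u1).1 fu).
have [u1' _] := gu; have u1 : enorm u = 1 by rewrite -(W_enorm _ Ww).
apply/(chart_endP _ a (chart_flat Af) u1).
apply: ideal_class_eq ((chart_endP zeta (w a) (chart_flat Ag) u1').1 gu) => t t0.
by rewrite E.
Qed.

Lemma match_cell f g w a v u : A f -> A g -> W w -> chart_match f g w a v ->
  in_closed_cell L v u -> ideal_cell M f u = ideal_cell M g (lin w u).
Proof.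
move=> Af Ag Ww fg vu; have [w' [Ww' ww' w'w]] := W_inv arr Ww.
apply/seteqP; split => [zeta [y uy fy]|zeta [y uy gy]].
  exists (lin w y); first exact/(lin_cell arr).
  by apply/(match_end _ Af Ag Ww fg) => //; apply: closed_cell_trans vu uy.1.
exists (lin w' y); first by apply/(lin_cell arr _ _ Ww); rewrite (W_linK Ww' Ww).
apply/(match_end _ Af Ag Ww fg); last by rewrite (W_linK Ww' Ww).
apply: closed_cell_trans vu _; case: uy => + _.
by rewrite -{1}(W_linK Ww' Ww w'w y) lin_closed_cell.
Qed.

Lemma lin_id x : lin (idfun : E -> E) x = x.
Proof. by rewrite /lin subr0. Qed.

Lemma sector_match f g a v : sector_eq f g a v -> chart_match f g idfun a v.
Proof. by []. Qed.

Lemma sector_end f g a v u zeta : A f -> A g -> sector_eq f g a v -> in_closed_cell L v u ->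
  chart_end f u zeta <-> chart_end g u zeta.
Proof.
move=> Af Ag fg vu.
by rewrite (match_end zeta Af Ag (reflection_group_id M) (sector_match fg) vu) lin_id.
Qed.

Lemma sector_cell f g a v u : A f -> A g -> sector_eq f g a v -> in_closed_cell L v u ->
  ideal_cell M f u = ideal_cell M g u.
Proof.
move=> Af Ag fg vu.
by rewrite (match_cell Af Ag (reflection_group_id M) (sector_match fg) vu) lin_id.
Qed.

(** The charts sharing with [f] a sector towards the chamber of [v]. Reading directions in such
    charts is the retraction centered at this ideal chamber. *)
Definition centered f v h : Prop := exists a, sector_eq h f a v.

Lemma centered_chart f g v x : A f -> A g -> in_chamber L v -> in_chamber L x ->
  exists h w a V, [/\ A h, W w, centered f v h, lin w V = x & chart_match h g w a V].
Proof.
move=> Af Ag Cv Cx.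
have [h [w [V [a [b [Ah Ww wV gh hf]]]]]] := two_sectors Ag Af Cx Cv.
by exists h, w, a, V; split => //; [exists b|move=> y Vy; rewrite -gh].
Qed.

Lemma centered_end f v k d zeta : A f -> in_chamber L v -> A k -> chart_end k d zeta ->
  exists h d' w, [/\ A h, centered f v h, W w, d = lin w d' & chart_end h d' zeta].
Proof.
move=> Af Cv Ak kd; have [v1 Cv1 vd] := direction_cover arr Cv0 d.
have [h [w [a [V [Ah Ww hf wV m]]]]] := centered_chart Af Ak Cv Cv1.
have [w' [Ww' ww' w'w]] := W_inv arr Ww.
have dE' : lin w (lin w' d) = d by rewrite (W_linK Ww' Ww).
have Vd : in_closed_cell L V (lin w' d) by rewrite -(lin_closed_cell arr _ _ Ww) dE' wV.
by exists h, (lin w' d), w; split => //; apply/(match_end zeta Ah Ak Ww m Vd); rewrite dE'.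
Qed.

Lemma centered_ex f v e : A f -> in_chamber L v -> ideal_chamber M A e ->
  exists h x, [/\ A h, centered f v h, in_chamber L x & e = ideal_cell M h x].
Proof.
move=> Af Cv [g [x [Ag Cx ->]]].
have [h [w [a [V [Ah Ww hf wV m]]]]] := centered_chart Af Ag Cv Cx.
exists h, V; split => //; first by rewrite -(lin_chamber arr V Ww) wV.
by rewrite -wV (match_cell Ah Ag Ww m (@in_closed_cell_refl _ _ L V)).
Qed.

(** A third chart contains sectors of both charts. There the common regular point has a single
    direction, so the two sectors are parallel and share a subsector. *)
Lemma common_chamber f g v v' zeta : A f -> A g -> in_chamber L v -> in_chamber L v' ->
  chart_end f v zeta -> chart_end g v' zeta ->
  exists w a, [/\ W w, lin w v = v' & chart_match f g w a v].
Proof.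
move=> Af Ag Cv Cv' fv gv'.
have [h [w [a [V [Ah Ww [b hg] wV m]]]]] := centered_chart Ag Af Cv' Cv.
have [w' [Ww' ww' w'w]] := W_inv arr Ww.
have hV : chart_end h V zeta.
  by apply/(match_end zeta Ah Af Ww m (@in_closed_cell_refl _ _ L V)); rewrite wV.
have hv' := (sector_end zeta Ah Ag hg (@in_closed_cell_refl _ _ L v')).2 gv'.
have Vv' := chart_end_uniq (chart_flat Ah) hV hv'; rewrite -Vv' in hg.
have CV : in_chamber L V by rewrite Vv'.
have [e [ea eb]] := common_subsector a b CV.
exists w', (w e); split => //; first by rewrite -wV (W_linK Ww Ww')// Vv'.
move=> y vy; have Vy : in_closed_cell L V (lin w' y).
  by rewrite -(lin_closed_cell arr _ _ Ww) (W_linK Ww' Ww)// wV.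
have -> : w e + y = w (e + lin w' y) by rewrite (W_D _ _ Ww) (W_linK Ww' Ww).
rewrite ww' -(sector_eq_sub eb hg)// -[e + _](subrK a) addrC -m ?[a + _]addrC ?subrK//.
by rewrite addrAC; exact: cone_add.
Qed.

Lemma unit_in_cell v : v != 0 -> enorm ((enorm v)^-1 *: v) = 1 /\ cell L v ((enorm v)^-1 *: v).
Proof.
move=> v0'; have e0 : 0 < enorm v by rewrite enorm_gt0.
split; first by rewrite enormZ gtr0_norm ?invr_gt0// mulVf// gt_eqF.
by apply: cell_scale; rewrite ?invr_gt0//; exact: cell_refl.
Qed.

Lemma chamber_neq0 v : in_chamber L v -> (exists u, L (hyperplane u 0)) -> v != 0.
Proof. by move=> /(L_chamberP arr) Cv [u /Cv]; apply: contraNneq => ->; rewrite dot0r. Qed.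

Lemma chart_end_ex f v : A f -> enorm v = 1 -> exists zeta, chart_end f v zeta.
Proof.
move=> Af v1; have := flat_ray 0 (chart_flat Af) v1.
by move=> /ray_ideal[zeta zP]; exists zeta; apply/(chart_endP _ 0 (chart_flat Af) v1).
Qed.

(** From a point inside the common sector, the two rays to [zeta] coincide and begin in the sector,
    even if [d] points out of it; so their initial directions correspond. This makes the retraction
    centered at infinity well defined. *)
Lemma match_direction f g w a v d d' zeta : A f -> A g -> W w -> in_chamber L v ->
  chart_match f g w a v -> chart_end f d zeta -> chart_end g d' zeta -> d' = lin w d.
Proof.
move=> Af Ag Ww Cv fg fd gd.
have [d1 _] := fd; have [d1' _] := gd.
have fr := (chart_endP zeta (a + v) (chart_flat Af) d1).1 fd.
have gr := (chart_endP zeta (w (a + v)) (chart_flat Ag) d1').1 gd.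
have [e e0 near] := near_direction arr Cv0 Cv.
have t0 : 0 < e / 2 by rewrite divr_gt0.
set t := e / 2 in t0.
have E : f (a + v + t *: d) = g (w (a + v) + t *: d').
  apply: (asymptotic_eq (ideal_ray fr) (ideal_ray gr) _ (ideal_asymptotic fr gr) (ltW t0)).
  by rewrite !scale0r !addr0 fg//; exact: in_closed_cell_refl.
have vd : in_closed_cell L v (v + t *: d).
  suff [] : cell L v (v + t *: d) by [].
  apply: near; rewrite addrAC subrr add0r enormZ d1 mulr1 gtr0_norm//.
  by rewrite /t ltr_pdivrMr// ltr_pMr// ltr1n.
move: E; rewrite -addrA fg// addrA (W_D (a + v) (t *: d) Ww) (W_linZ t d Ww) => /(chart_inj Ag) /addrI.
by move=> /scalerI-/(_ (lt0r_neq0 t0)).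
Qed.

(** In a chart centered at a chamber whose closure contains [d'], the ideal point has a single
    direction; it is [d'], and it differs from [d] by the Weyl group. *)
Lemma same_type f g d d' zeta : A f -> A g -> chart_end f d zeta -> chart_end g d' zeta ->
  exists2 w, W w & lin w d = d'.
Proof.
move=> Af Ag fd gd; have [v Cv vd'] := direction_cover arr Cv0 d'.
have [h [e [w [Ah [a hg] Ww -> he]]]] := centered_end Ag Cv Af fd.
have [w' [Ww' ww' _]] := W_inv arr Ww; exists w' => //; rewrite (W_linK Ww Ww')//.
exact: chart_end_uniq (chart_flat Ah) he ((sector_end zeta Ah Ag hg vd').2 gd).
Qed.

Lemma ideal_cell_dir f v v' : A f -> v != 0 -> ideal_cell M f v = ideal_cell M f v' -> cell L v v'.
Proof.
move=> Af v0' vv; have [v1 vv1] := unit_in_cell v0'.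
have [zeta fz] := chart_end_ex Af v1.
have : ideal_cell M f v zeta by exists ((enorm v)^-1 *: v).
rewrite vv => -[y v'y fy]; have := chart_end_uniq (chart_flat Af) fz fy => e.
by apply: cell_trans vv1 _; rewrite e; exact: cell_sym.
Qed.

Lemma ideal_cell_eq f v v' : cell L v v' -> ideal_cell M f v = ideal_cell M f v'.
Proof.
move=> vv; apply/seteqP; split => zeta [y h1 h2]; exists y => //.
  exact: cell_trans (cell_sym vv) h1.
exact: cell_trans vv h1.
Qed.

Lemma common_cell f g v v' : A f -> A g -> v != 0 -> in_chamber L v -> in_chamber L v' ->
  ideal_cell M f v = ideal_cell M g v' ->
  exists w a, [/\ W w, cell L v' (lin w v) & chart_match f g w a v].
Proof.
move=> Af Ag v0' Cv Cv' fg; have [v1 vv1] := unit_in_cell v0'.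
have [zeta fz] := chart_end_ex Af v1.
have : ideal_cell M f v zeta by exists ((enorm v)^-1 *: v).
rewrite fg => -[y v'y gy].
have Cv1 : in_chamber L ((enorm v)^-1 *: v) := L_cell_chamber Cv vv1.
have Cy : in_chamber L y := L_cell_chamber Cv' v'y.
have [w [a [Ww wv m]]] := common_chamber Af Ag Cv1 Cy fz gy.
exists w, a; split => //.
  by apply: cell_trans v'y _; rewrite -wv; apply/(lin_cell arr _ _ Ww); exact: cell_sym.
by move=> z vz; apply: m; exact: closed_cell_trans vv1.2 vz.
Qed.

Lemma cell_perp x y u : L (hyperplane u 0) -> cell L x y -> dot u x = 0 -> dot u y = 0.
Proof.
move=> Lu [xy _] ux; have Lu' : L (hyperplane (- u) 0) by rewrite -oppr0 hyperplaneN.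
apply/eqP; rewrite eq_le xy ?ux//=.
by have := xy _ _ Lu'; rewrite !dotNl ux oppr0 !oppr_le0; exact.
Qed.

Lemma cell0 y : cell L 0 y -> y = 0.
Proof.
move=> c0y; case: arr => _ _ _ ess _; apply: ess => u c Mu.
exact: cell_perp (L_wall arr Mu) c0y (dot0r u).
Qed.

Lemma ideal_cell_neq0 f v zeta : ideal_cell M f v zeta -> v != 0.
Proof.
move=> [y vy [y1 _]]; apply/eqP => v0'; move: vy; rewrite v0' => /cell0 y0.
by move: y1; rewrite y0 enorm0 => /esym/eqP; rewrite oner_eq0.
Qed.

Lemma ideal_cell_nonempty f v : A f -> v != 0 -> exists zeta, ideal_cell M f v zeta.
Proof.
move=> Af v0'; have [v1 vv1] := unit_in_cell v0'.
have [zeta fz] := chart_end_ex Af v1.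
by exists zeta, ((enorm v)^-1 *: v).
Qed.

Lemma panel_cell x y : in_panel L x -> cell L x y -> in_panel L y.
Proof.
move=> [H [[LH Hx] uniq]] xy; have [u [u0 HE Lu]] := L_rep arr LH.
exists H; split; first by split => //; rewrite HE in Hx *; exact: cell_perp Hx.
move=> K [LK Ky]; apply: uniq; split => //.
have [b [b0 KE Lb]] := L_rep arr LK; rewrite KE in Ky *.
exact: cell_perp Lb (cell_sym xy) Ky.
Qed.

Lemma panel_lin x w : W w -> in_panel L x -> in_panel L (lin w x).
Proof.
move=> Ww [H [[LH Hx] uniq]]; have [u [u0 HE Lu]] := L_rep arr LH.
have [w' [Ww' ww' w'w]] := W_inv arr Ww.
exists (hyperplane (lin w u) 0); split.
  split; first exact: L_lin.
  by move: Hx; rewrite HE /hyperplane /= (W_lin_dot _ _ Ww).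
move=> K [LK Kx]; have [b [b0 KE Lb]] := L_rep arr LK.
have := uniq (hyperplane (lin w' b) 0) => H1.
have {}H1 : H = hyperplane (lin w' b) 0.
  apply: H1; split; first exact: L_lin.
  by move: Kx; rewrite KE /hyperplane /= => bx; rewrite (W_lin_dotK _ _ Ww Ww' ww').
rewrite HE in H1; have wb0 := hyperplane_neq0 u0 H1.
have [k k0 [bE _]] := hyperplane_eq u0 wb0 H1.
rewrite KE -[b](W_linK Ww' Ww w'w) bE (W_linZ _ _ Ww).
by rewrite -[in RHS](mulr0 k) hyperplaneZ.
Qed.

Lemma regular_direction f g v b : A f -> A g -> v != 0 -> in_chamber L v ->
  ideal_cell M f v = ideal_cell M g b -> in_chamber L b.
Proof.
move=> Af Ag v0' Cv fg; have [zeta fz] := ideal_cell_nonempty Af v0'.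
have := fz; rewrite fg => -[y by_ gy]; case: fz => x vx fx.
have [w Ww wx] := same_type Af Ag fx gy.
apply: (L_cell_chamber _ (cell_sym by_)); rewrite -wx; apply/(lin_chamber arr _ Ww).
exact: L_cell_chamber vx.
Qed.

Lemma centered_match f v h h' : in_chamber L v -> centered f v h -> centered f v h' ->
  exists a, chart_match h h' idfun a v.
Proof.
move=> Cv [a ha] [a' ha']; have [b [ba ba']] := common_subsector a a' Cv.
exists b => y vy; rewrite (sector_eq_sub ba ha)//.
by rewrite (sector_eq_sub ba' ha').
Qed.

Lemma centered_direction f v h h' d d' zeta : A h -> A h' -> in_chamber L v ->
  centered f v h -> centered f v h' -> chart_end h d zeta -> chart_end h' d' zeta -> d = d'.
Proof.
move=> Ah Ah' Cv ch ch' hd hd'; have [a m] := centered_match Cv ch ch'.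
by rewrite (match_direction Ah Ah' (reflection_group_id M) Cv m hd hd') lin_id.
Qed.

Lemma centered_cell f v h h' x x' : A h -> A h' -> in_chamber L v ->
  centered f v h -> centered f v h' -> ideal_cell M h x = ideal_cell M h' x' -> cell L x x'.
Proof.
move=> Ah Ah' Cv ch ch' hx; have [x0|x0] := eqVneq x 0.
  have [x'0|x'0] := eqVneq x' 0; first by rewrite x0 x'0; exact: cell_refl.
  have [zeta] := ideal_cell_nonempty Ah' x'0; rewrite -hx => /ideal_cell_neq0.
  by rewrite x0 eqxx.
have [zeta hz] := ideal_cell_nonempty Ah x0.
have := hz; rewrite hx => -[y' xy' hy']; case: hz => y xy hy.
have yy := centered_direction Ah Ah' Cv ch ch' hy hy'.
by apply: cell_trans xy _; rewrite yy; exact: cell_sym.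
Qed.

Lemma face_direction h x e p : A h -> x != 0 -> in_chamber L x -> e = ideal_cell M h x ->
  ideal_face M A p e -> exists2 d, in_closed_cell L x d & p = ideal_cell M h d.
Proof.
move=> Ah x0 Cx eE [g [a [b [Ag ba pE eE']]]].
have Cb : in_chamber L b by apply: (regular_direction Ah Ag x0 Cx); rewrite -eE.
have b0 : b != 0.
  have [zeta] := ideal_cell_nonempty Ah x0; rewrite -eE eE'; exact: ideal_cell_neq0.
have [|w [z [Ww xw m]]] := common_cell Ag Ah b0 Cb Cx; first by rewrite -eE'.
exists (lin w a); last by rewrite pE; exact: (match_cell Ag Ah Ww m ba).
by apply: closed_cell_trans xw.1 _; apply/(lin_closed_cell arr _ _ Ww).
Qed.

Lemma panel_direction g h a d : A g -> A h -> in_panel L a -> ideal_cell M g a = ideal_cell M h d ->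
  in_panel L d.
Proof.
move=> Ag Ah Pa gh; have [d0|d0] := eqVneq d 0.
  suff -> : d = a by [].
  apply/eqP; rewrite d0 eq_sym; apply/negPn/negP => a0.
  have [zeta] := ideal_cell_nonempty Ag a0; rewrite gh => /ideal_cell_neq0.
  by rewrite d0 eqxx.
have [zeta hz] := ideal_cell_nonempty Ah d0.
have := hz; rewrite -gh => -[y ay gy]; case: hz => x dx hx.
have [w Ww wy] := same_type Ag Ah gy hx.
apply: panel_cell (cell_sym dx); rewrite -wy; apply: panel_lin => //.
exact: panel_cell Pa ay.
Qed.

Definition fold al y : E := if 0 < dot al y then reflection al 0 y else y.

Lemma fold_lin al y : L (hyperplane al 0) -> exists2 w, W w & fold al y = lin w y.
Proof.
move=> /(LP M _ _).1[_ _ [c Mal]]; rewrite /fold; case: ifPn => _.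
  exists (reflection al c); first exact: W_reflection.
  by rewrite lin_reflection.
by exists idfun; [exact: reflection_group_id|rewrite lin_id].
Qed.

(** No linear wall cuts a chamber, so [fold] is a single linear map on its closure. *)
Lemma fold_closed_cell al v y : L (hyperplane al 0) -> in_chamber L v -> in_closed_cell L v y ->
  in_closed_cell L (fold al v) (fold al y).
Proof.
move=> Lal Cv vy; have [_ _ [c Mal]] := (LP M _ _).1 Lal.
have Wr := W_reflection arr Mal.
rewrite /fold; have [av|av|e] := ltgtP 0 (dot al v); last 1 first.
- by have := (L_chamberP arr _).1 Cv _ Lal; rewrite -e eqxx.
- have E : reflection al 0 y = (if 0 < dot al y then reflection al 0 y else y).
    case: ifPn => //; rewrite -leNgt => ay; rewrite reflection_id//.
    by apply/eqP; rewrite eq_le ay (cone_pos Lal vy (ltW av)).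
  by rewrite -E -(lin_reflection al c); apply/(lin_closed_cell arr _ _ Wr).
- by rewrite ltNge (vy _ _ Lal (ltW av)).
Qed.

(* Folding along a wall through [sigma] in the retraction centered at the
   projection [cm] of [c] maps a gallery from [c] to [cm] to a gallery of the
   same length from [c] to the mirror image of [cm], which also has the face
   [sigma]. *)
Lemma projection_side f v vc s al sigma c cm : A f -> in_chamber L v -> in_chamber L vc ->
  cm = ideal_cell M f v -> c = ideal_cell M f vc -> sigma = ideal_cell M f s ->
  in_closed_cell L v s -> is_projection M A (residue M A sigma) c cm ->
  L (hyperplane al 0) -> dot al s = 0 -> 0 < dot al v -> 0 <= dot al vc.
Proof.
move=> Af Cv Cvc cmE cE sE vs [Rcm [k [[p [p0 pk padj]] kmin] closest]] Lal als alv.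
rewrite leNgt; apply/negP => alvc.
have nz x : in_chamber L x -> x != 0 by move=> Cx; apply: (chamber_neq0 Cx); exists al.
(* For each ideal chamber, a chart containing it together with [cm]; [(f, v)] is the default for
   other sets. *)
have selex e : exists hx : (E -> X) * E, ideal_chamber M A e ->
    [/\ A hx.1, centered f v hx.1, in_chamber L hx.2 & e = ideal_cell M hx.1 hx.2].
  have [ce|nce] := pselect (ideal_chamber M A e); last by exists (f, v).
  by have [h [x hx]] := centered_ex Af Cv ce; exists (h, x).
have [sel selP] := choice selex.
pose phi e := ideal_cell M f (fold al (sel e).2).
have cf : centered f v f by exists 0.
have phi_chamber e : ideal_chamber M A e -> ideal_chamber M A (phi e).
  move=> /selP[_ _ Cx _]; exists f, (fold al (sel e).2); split => //.
  have [w Ww ->] := fold_lin (sel e).2 Lal; exact/(lin_chamber arr).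
have phi_adj e e' : Defs.adjacent M A e e' -> Defs.adjacent M A (phi e) (phi e').
  move=> [q [[g [a [Ag Pa qE]]] ce ce' qe qe']].
  have [Ah ch Cx eE] := selP _ ce; have [Ah' ch' Cx' eE'] := selP _ ce'.
  have [d xd qd] := face_direction Ah (nz _ Cx) Cx eE qe.
  have [d' xd' qd'] := face_direction Ah' (nz _ Cx') Cx' eE' qe'.
  have dd : cell L d d' by apply: (centered_cell Ah Ah' Cv ch ch'); rewrite -qd.
  have Pd : in_panel L d by apply: (panel_direction Ag Ah Pa); rewrite -qE.
  have xd2 : in_closed_cell L (sel e').2 d by apply: closed_cell_trans xd' dd.2.
  exists (ideal_cell M f (fold al d)); split.
  - exists f, (fold al d); split => //; have [w Ww ->] := fold_lin d Lal.
    exact: panel_lin.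
  - exact: phi_chamber.
  - exact: phi_chamber.
  - by exists f, (fold al d), (fold al (sel e).2); split => //; exact: fold_closed_cell.
  - by exists f, (fold al d), (fold al (sel e').2); split => //; exact: fold_closed_cell.
have phi_dir e x : A f -> in_chamber L x -> e = ideal_cell M f x -> cell L x (sel e).2.
  move=> _ Cx eE; have ce : ideal_chamber M A e by exists f, x.
  by have [Ah ch Cy eE'] := selP _ ce; apply: (centered_cell Af Ah Cv cf ch); rewrite -eE.
have phic : phi c = c.
  have cc := phi_dir _ _ Af Cvc cE; rewrite /phi /fold.
  have -> : (0 < dot al (sel c).2) = false.
    by apply/negbTE; rewrite -leNgt; case: cc => cc _; exact: cc _ _ Lal (ltW alvc).
  by rewrite [RHS]cE; symmetry; exact: (ideal_cell_eq f cc).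
have [_ _ [b Mal]] := (LP M _ _).1 Lal; have Wr := W_reflection arr Mal.
have phicm : phi cm = ideal_cell M f (reflection al 0 v).
  have cc := phi_dir _ _ Af Cv cmE; rewrite /phi /fold.
  have -> : 0 < dot al (sel cm).2.
    rewrite ltNge; apply/negP => h; have := cc.2 _ _ Lal h.
    by rewrite leNgt alv.
  symmetry; apply: (ideal_cell_eq f); rewrite -(lin_reflection al b); exact/(lin_cell arr _ _ Wr).
have Cr : in_chamber L (reflection al 0 v) by rewrite -(lin_reflection al b); apply/(lin_chamber arr).
have gal : gallery M A k c (phi cm).
  exists (fun i => phi (p i)); split; rewrite ?p0 ?pk//.
  by move=> i ik; exact: phi_adj (padj _ ik).
have exg : exists m, `[< gallery M A m c (phi cm) >] by exists k; apply/asboolP.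
have [k' /asboolP gk' k'min] := ex_minnP exg.
have k'k : (k' <= k)%N by apply: k'min; apply/asboolP.
have : (k < k')%N.
  apply: (closest (phi cm)).
  - split; first by rewrite phicm; exists f, (reflection al 0 v).
    rewrite phicm; exists f, s, (reflection al 0 v); split => //.
    rewrite -(reflection_id als) -(lin_reflection al b).
    by apply/(lin_closed_cell arr _ _ Wr).
  - by split => // m gm; apply: k'min; apply/asboolP.
  - rewrite phicm cmE => e; have [rv _] := ideal_cell_dir Af (nz _ Cr) e.
    have al0 : al != 0 := wall_neq0 arr Mal.
    have := rv _ _ Lal; have := dot_reflection_normal 0 v al0; rewrite !subr0 => ->.
    by rewrite oppr_le0 => /(_ (ltW alv)); rewrite leNgt alv.
by rewrite ltnNge k'k.
Qed.

End IdealChambers.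

(** * Dynamics *)

Section Isometries.
Implicit Types (p q : X) (s t r : R) (c d l : R -> X) (xi zeta : ideal_point X) (phi : X -> X)
  (lam : R).

Lemma archi_mul (lam x : R) : 0 < lam ->
  exists N : nat, forall k : nat, (N <= k)%N -> x < k%:R * lam.
Proof.
move=> lam0; exists (Num.bound (`|x| / lam)) => k Nk.
rewrite -ltr_pdivrMr//; apply: le_lt_trans (_ : `|x| / lam < _).
  by rewrite ler_pM2r ?invr_gt0// ler_norm.
apply: lt_le_trans (archi_boundP _) _; first by rewrite divr_ge0// ltW.
by rewrite ler_nat.
Qed.

Lemma iter_isometric phi k : isometric phi -> isometric (iter k phi).
Proof. by move=> iphi; elim: k => // k IH x y /=; rewrite iphi IH. Qed.

Lemma axis_end phi l lam xi c : 0 < lam -> ray l ->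
  (forall k, iter k phi (l 0) = l (k%:R * lam)) ->
  (fun k => Interior (iter k phi (l 0))) @ \oo --> Ideal xi ->
  ideal_class xi c -> c 0 = l 0 -> ideal_class xi l.
Proof.
move=> lam0 rl phil xicvg xic c0; apply: (ideal_class_eq _ xic) => t.
rewrite le_eqVlt => /predU1P[<-//|t0]; apply/eqP; rewrite -[_ == _]negbK -mdist_gt0.
apply/negP => e0; have [N NP] := cone_cvg_interior xicvg xic t0 e0.
have [N' N'P] := archi_mul t lam0; pose k := maxn N N'.
have tk := N'P k (leq_maxr _ _); have [_ [y [y1 y2 y3]]] := NP k (leq_maxl _ _).
have k0 := lt_trans t0 tk.
rewrite phil c0 in y1 y2; rewrite ray_dist0 ?ltW// in y2.
suff yl : y = l t by move: y3; rewrite yl metric_sym ltxx.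
apply/eqP; rewrite -[_ == _]negbK -mdist_gt0 -leNgt.
rewrite -(mulr0 (t / (k%:R * lam))) -(mdistxx (l (k%:R * lam))).
apply: (@scaled_triangle (l 0)) => //; rewrite ?ray_dist0 ?ltW//.
by rewrite rl ?ltW// ler0_norm ?opprB// subr_le0 ltW.
Qed.

Lemma iter_displacement phi p k : isometric phi -> mdist p (iter k phi p) <= k%:R * mdist p (phi p).
Proof.
move=> iphi; elim: k => [|k IH] /=; first by rewrite mdistxx mul0r.
apply: le_trans (metric_triangle _ (phi p) _) _.
by rewrite iphi -natr1 mulrDl mul1r addrC lerD2r.
Qed.

(** A deficit after [k] steps would grow linearly along multiples of [k], while the orbits of [p]
    and of the axis stay at bounded distance. *)
Lemma orbit_displacement phi l lam p k : isometric phi -> 0 < lam -> ray l ->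
  (forall k, iter k phi (l 0) = l (k%:R * lam)) -> mdist p (phi p) = lam ->
  mdist p (iter k phi p) = k%:R * lam.
Proof.
move=> iphi lam0 rl phil pp; apply/eqP; rewrite eq_le -{1}pp iter_displacement//=.
rewrite leNgt; apply/negP => lt; set D := mdist p _ in lt; pose e := k%:R * lam - D.
have e0 : 0 < e by rewrite subr_gt0.
have [N /(_ N (leqnn _)) NP] := archi_mul (2 * mdist p (l 0)) e0.
have h1 : mdist p (iter (N * k) phi p) <= N%:R * D.
  rewrite (_ : iter (N * k) phi p = iter N (iter k phi) p); last first.
    by elim: (N) => //= m IH; rewrite mulSn iterD IH.
  by apply: iter_displacement; exact: iter_isometric.
have h2 : N%:R * (k%:R * lam) <= 2 * mdist p (l 0) + mdist p (iter (N * k) phi p).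
  have -> : N%:R * (k%:R * lam) = mdist (l 0) (iter (N * k) phi (l 0)).
    by rewrite phil ray_dist0// ?natrM ?mulrA// mulr_ge0// ltW.
  apply: le_trans (metric_triangle _ p _) _; rewrite mulr2n mulrDl mul1r -addrA.
  rewrite (metric_sym (l 0) p) lerD2l addrC.
  by apply: le_trans (metric_triangle _ (iter (N * k) phi p) _) _; rewrite iter_isometric.
move: NP; rewrite /e mulrBr; lra.
Qed.

(* Both the orbit of [p] and the ray [c] are geodesics from [p] at bounded
   distance from the axis [l], so they agree by thinness of triangles. *)
Lemma orbit_ray phi l lam p c k : isometric phi -> 0 < lam -> ray l ->
  (forall k, iter k phi (l 0) = l (k%:R * lam)) -> mdist p (phi p) = lam ->
  ray c -> c 0 = p -> asymptotic c l -> iter k phi p = c (k%:R * lam).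
Proof.
move=> iphi lam0 rl phil pp rc c0 [K cK].
have lamk0 (m : nat) : 0 <= m%:R * lam by rewrite mulr_ge0// ltW.
have orb m := orbit_displacement m iphi lam0 rl phil pp.
have bound m : mdist (iter m phi p) (c (m%:R * lam)) <= mdist p (l 0) + K.
  apply: le_trans (metric_triangle _ (iter m phi (l 0)) _) _.
  by rewrite (iter_isometric m iphi) phil lerD2l metric_sym cK.
apply/eqP; rewrite -[_ == _]negbK -mdist_gt0; apply/negP; set e := mdist _ _ => e0.
pose B := mdist p (l 0) + K.
have [N /(_ (N + k.+1)%N (leq_addr _ _)) NP] := archi_mul (k%:R * lam * B) (mulr_gt0 e0 lam0).
set N' := (N + k.+1)%N in NP.
have kN : (k < N')%N by rewrite /N' addnS ltnS leq_addl.
have kN' : k%:R * lam <= N'%:R * lam by rewrite ler_pM2r// ler_nat ltnW.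
have N0 : 0 < N'%:R * lam by rewrite mulr_gt0// ltr0n (leq_trans _ kN).
have le : e <= (k%:R * lam) / (N'%:R * lam) * mdist (iter N' phi p) (c (N'%:R * lam)).
  apply: (@scaled_triangle p) => //.
  - by rewrite -c0 ray_dist0.
  - rewrite -(subnKC (ltnW kN)) iterD (iter_isometric k iphi) orb natrD; ring.
  - by rewrite -c0 ray_dist0.
  - by rewrite rc// ler0_norm ?opprB// subr_le0.
have : e <= (k%:R * lam) / (N'%:R * lam) * B.
  by apply: le_trans le _; rewrite ler_wpM2l ?bound// divr_ge0.
by rewrite mulrAC ler_pdivlMr// leNgt mulrCA NP.
Qed.

End Isometries.

(** * Limits of ideal points by eventually equal rays *)

Section RayLimits.
Implicit Types (p q : X) (s t r e : R) (b c d : R -> X) (xi zeta eta : ideal_point X)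
  (xis : nat -> ideal_point X).

(** The ray [c] may depend on [t] and [k], but it starts where [b] does and follows it up to time
    [t]. *)
Definition ray_limit xis eta : Prop := exists2 b, ideal_class eta b &
  forall t, exists N, forall k, (N <= k)%N -> exists2 c, ideal_class (xis k) c &
    forall s, 0 <= s -> s <= t -> c s = b s.

Lemma ray_limit_uniq xis eta eta' : ray_limit xis eta -> ray_limit xis eta' -> eta = eta'.
Proof.
move=> [b eb bP] [b' eb' bP']; apply: (ideal_eq eb); apply: asymptotic_ideal eb' (ideal_ray eb) _.
exists (mdist (b' 0) (b 0)) => t t0.
have [N /(_ (maxn N _) (leq_maxl _ _)) NP] := bP t.
have [N' /(_ (maxn N N') (leq_maxr _ _)) [c' xc' cb']] := bP' t.
have [c xc cb] := NP N'.
rewrite -(cb t)// -(cb' t)// -(cb 0)// -(cb' 0)//.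
by apply: (asymptotic_dist (ideal_ray xc') (ideal_ray xc)) => //; exact: ideal_asymptotic xc' xc.
Qed.

Lemma ray_limit_cvg xis eta : (forall k p, exists2 c, ideal_class (xis k) c & c 0 = p) ->
  ray_limit xis eta -> ideal_cvg xis eta.
Proof.
move=> rays [b eb bP]; apply: cone_cvg => U [[x [e [_ ->]]] [y _ //]|[d [r [e [rd r0 e0 ->]]]]].
move=> [c' [ec' c'd c're]]; pose D := mdist (b 0) (d 0); pose de := e - mdist (c' r) (d r).
have de0 : 0 < de by rewrite subr_gt0.
have D0 : 0 <= D by exact: mdist_ge0.
(* Late enough for the factor [r / t] to bring the bound [2 * D] at time [t] below the margin [de]
   at time [r]. *)
pose t := r + (r * (2 * D) + 1) / de.
have rD : 0 <= r * (2 * D) by rewrite !mulr_ge0// ltW.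
have rt : r <= t.
  by rewrite /t lerDl; apply: divr_ge0; [apply: addr_ge0|exact: ltW].
have t0 := lt_le_trans r0 rt; have t0' := ltW t0; have r0' := ltW r0.
have [N NP] := bP t; exists N => k /NP[c kc cb].
have [c'' kc'' c''0] := rays k (d 0); exists c''; split => //.
have h1 : mdist (c'' t) (b t) <= D.
  rewrite -(cb t)// /D -(cb 0)// metric_sym -c''0.
  by apply: (asymptotic_dist (ideal_ray kc) (ideal_ray kc'')) => //; exact: ideal_asymptotic kc kc''.
have h2 : mdist (b t) (c' t) <= D.
  rewrite /D -c'd.
  by apply: (asymptotic_dist (ideal_ray eb) (ideal_ray ec')) => //; exact: ideal_asymptotic eb ec'.
have h3 : mdist (c'' t) (c' t) <= 2 * D.
  by apply: le_trans (metric_triangle _ (b t) _) _; lra.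
have h4 : mdist (c'' r) (c' r) < de.
  apply: le_lt_trans (ray_shrink (ideal_ray kc'') (ideal_ray ec') _ r0' rt t0) _.
    by rewrite c''0 c'd.
  rewrite mulrAC ltr_pdivrMr//; apply: le_lt_trans (ler_wpM2l r0' h3) _.
  rewrite /t mulrDr [de * (_ / _)]mulrC divfK ?gt_eqF//.
  have : 0 < de * r by rewrite mulr_gt0.
  lra.
apply: le_lt_trans (metric_triangle _ (c' r) _) _.
by move: h4; rewrite /de; lra.
Qed.

End RayLimits.

Hypothesis L0 : exists u, L (hyperplane u 0).

(** * Attraction of ideal points by the iterates of the automorphism *)

Section Attraction.
Implicit Types (f g h : E -> X) (x y d u v a b s al P : E) (t : R) (w : E -> E)
  (xi eta zeta : ideal_point X) (c e cm sigma beta : set (ideal_point X)) (p q : X).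

(** Pass to a chart through [cm] and [c] to use [projection_side]; directions read from a common
    sector at [cm] do not change, and [u] lies in the closure of the chamber [c]. *)
Lemma projection_positive f v u cm c sigma beta xi zeta :
  A f -> in_chamber L v -> cm = ideal_cell M f v -> sigma zeta -> beta xi ->
  residue M A beta c -> is_projection M A (residue M A sigma) c cm -> chart_end f u xi ->
  exists s, [/\ chart_end f s zeta, in_closed_cell L v s &
    forall al, L (hyperplane al 0) -> dot al s = 0 -> 0 < dot al v -> 0 <= dot al u].
Proof.
move=> Af Cv cmE sz bx [cc bc] proj fu.
have nz x : in_chamber L x -> x != 0 by move=> Cx; exact: (chamber_neq0 Cx).
have [h [x [Ah [a hf] Cx cE]]] := centered_ex Af Cv cc.
have cmE' : cm = ideal_cell M h v by rewrite cmE (sector_cell Ah Af hf).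
have [[_ scm] _] := proj.
have [d vd sE] := face_direction Ah (nz _ Cv) Cv cmE' scm.
have [d' xd' bE] := face_direction Ah (nz _ Cx) Cx cE bc.
have := sz; rewrite sE => -[s ds hs]; have := bx; rewrite bE => -[u' du' hu'].
have cf : centered f v f by exists 0.
have ch : centered f v h by exists a.
have uu := centered_direction Af Ah Cv cf ch fu hu'; rewrite -uu in du'.
have vs : in_closed_cell L v s := closed_cell_trans vd ds.1.
exists s; split => //; first exact/(sector_end zeta Ah Af hf vs).
move=> al Lal als alv.
have alx : 0 <= dot al x.
  apply: (projection_side Ah Cv Cx cmE' cE sE vd proj Lal _ alv).
  by apply: (cell_perp Lal _ als); exact: cell_sym.
exact: cone_pos Lal (closed_cell_trans xd' du'.1) alx.
Qed.

(** On a wall positive at [v], either [s] is positive and its multiple dominates [t *: u], or [s]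
    lies on the wall and the hypothesis on [u] applies. There are finitely many walls, hence one
    bound [N]. *)
Lemma cone_translate v s u (lam T : R) : in_chamber L v -> 0 < lam -> in_closed_cell L v s ->
  (forall al, L (hyperplane al 0) -> dot al s = 0 -> 0 < dot al v -> 0 <= dot al u) ->
  exists N, forall k t, (N <= k)%N -> 0 <= t -> t <= T ->
    in_closed_cell L v ((k%:R * lam) *: s + t *: u).
Proof.
move=> Cv lam0 vs pos.
pose Q H k := forall al t, L (hyperplane al 0) -> H = hyperplane al 0 -> 0 < dot al v ->
  0 <= t -> t <= T -> 0 <= k%:R * lam * dot al s + t * dot al u.
have QN H : L H -> exists N, forall k, (N <= k)%N -> Q H k.
  move=> LH; have [b [b0 HE Lb bv]] : exists b, [/\ b != 0, H = hyperplane b 0,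
      L (hyperplane b 0) & 0 < dot b v].
    have [b [b0 HE Lb]] := L_rep arr LH; have := (L_chamberP arr v).1 Cv _ Lb.
    rewrite neq_lt => /orP[bv|bv]; last by exists b.
    exists (- b); rewrite oppr_eq0 dotNl oppr_gt0; split => //.
      by rewrite HE -[in RHS]oppr0 hyperplaneN.
    by rewrite -oppr0 hyperplaneN.
  have [N NP] : exists N, forall k t, (N <= k)%N -> 0 <= t -> t <= T ->
      0 <= k%:R * lam * dot b s + t * dot b u.
    have := cone_pos Lb vs (ltW bv); rewrite le_eqVlt => /predU1P[bs|bs].
      exists 0%N => k t _ t0 _; rewrite -bs mulr0 add0r mulr_ge0//.
      by apply: pos => //; rewrite -bs.
    have [N NP] := archi_mul (T * `|dot b u|) (mulr_gt0 lam0 bs).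
    exists N => k t /NP + t0 tT; rewrite mulrA => h.
    have h1 : t * `|dot b u| <= T * `|dot b u| by rewrite ler_wpM2r.
    have h2 : - (t * `|dot b u|) <= t * dot b u.
      by rewrite -mulrN ler_wpM2l// lerNl; have := ler_norm (- dot b u); rewrite normrN.
    lra.
  exists N => k Nk al t Lal HE' alv t0 tT.
  have al0 : al != 0 by apply: contraTneq alv => ->; rewrite dot0l ltxx.
  have [r r0 [alE _]] := hyperplane_eq b0 al0 (etrans (esym HE) HE').
  have {}r0 : 0 < r by move: alv; rewrite alE dotZl pmulr_lgt0.
  have -> : k%:R * lam * dot al s + t * dot al u = r * (k%:R * lam * dot b s + t * dot b u).
    by rewrite alE !dotZl; ring.
  by apply: mulr_ge0; [exact: ltW|exact: NP].
have [hs hsE] := (finite_seqP _).1 (L_finite arr Cv0).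
have [N NP] : exists N, forall H k, H \in hs -> (N <= k)%N -> Q H k.
  have : forall H, H \in hs -> L H by move=> H Hhs; rewrite hsE.
  elim: (hs) => [|H r IH] Lr; first by exists 0%N.
  have [|N NP] := IH; first by move=> K Kr; apply: Lr; rewrite inE Kr orbT.
  have [|N' NP'] := QN H; first by apply: Lr; rewrite inE eqxx.
  exists (maxn N N') => K k; rewrite inE geq_max => /predU1P[->|Kr] /andP[h1 h2]; first exact: NP'.
  exact: NP.
exists N => k t Nk t0 tT; apply/L_closed_cellP => al Lal; rewrite le_eqVlt => /predU1P[alv|alv].
  by have := (L_chamberP arr v).1 Cv _ Lal; rewrite alv eqxx.
have Lal' : L (hyperplane (- al) 0) by rewrite -oppr0 hyperplaneN.
have hs' : hyperplane (- al) 0 \in hs by move: Lal'; rewrite hsE.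
have := NP _ _ hs' Nk (- al) t Lal' erefl; rewrite !dotNl oppr_gt0 dotDr !dotZr => /(_ alv t0 tT).
lra.
Qed.

(** A ray in [Y] towards an interior point of [cm] is straight in a chart sharing a sector towards
    [cm], and its regular direction carries it into any sector of that direction. *)
Lemma min_sector g v cm a (Y : set X) : A g -> in_chamber L v -> cm = ideal_cell M g v ->
  cm `<=` boundary Y -> exists P, in_closed_cell L v (P - a) /\ Y (g P).
Proof.
move=> Ag Cv cmE cmY; have [v1 vv1] := unit_in_cell (chamber_neq0 Cv L0).
have [zeta gz] := chart_end_ex Ag v1; set y := _ *: v in v1 vv1 gz.
have [r zr Yr] : boundary Y zeta by apply: cmY; rewrite cmE; exists y.
have [h [b [z [Ah hg hz]]]] := sector_from (r 0) Ag Cv.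
have hz' : ideal_class zeta (fun t => h (z + t *: y)).
  apply/(chart_endP _ z (chart_flat Ah) v1).
  exact/(sector_end zeta Ah Ag hg vv1.1).
have rE t : 0 <= t -> r t = h (z + t *: y).
  apply: (asymptotic_eq (ideal_ray zr) (ideal_ray hz')).
    by rewrite scale0r addr0.
  exact: ideal_asymptotic zr hz'.
have Cy : in_chamber L y := L_cell_chamber Cv vv1.
have [T1 T1P] := cone_absorb arr Cv0 (z - a) Cy; have [T2 T2P] := cone_absorb arr Cv0 (z - b) Cy.
pose t := Num.max 0 (Num.max T1 T2).
have t0 : 0 <= t by rewrite le_max lexx.
have vP x : in_closed_cell L y x -> in_closed_cell L v x by apply: closed_cell_trans; exact: vv1.1.
exists (z + t *: y); split.
  by apply: vP; rewrite addrAC addrC; apply: T1P; rewrite !le_max lexx !orbT.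
rewrite -[z + _](subrK b) addrC -hg -?[b + _]addrC ?subrK -?rE//; first exact: Yr.
by apply: vP; rewrite addrAC addrC; apply: T2P; rewrite !le_max lexx !orbT.
Qed.

Lemma comp_end g w u zeta : A g -> W w ->
  chart_end (g \o w) u zeta <-> chart_end g (lin w u) zeta.
Proof.
move=> Ag Ww; have m : chart_match (g \o w) g w 0 u by [].
exact: (match_end zeta (chart_comp Ag Ww) Ag Ww m (@in_closed_cell_refl _ _ L u)).
Qed.

Lemma boundary_end g zeta : A g -> boundary (range g) zeta -> exists s, chart_end g s zeta.
Proof.
move=> Ag [c zc rc]; have [|x [s [s1 cE]]] := flat_line (chart_flat Ag) (ideal_ray zc).
  by move=> t t0; have [y _ gy] := rc t t0; exists y.
exists s; apply/(chart_endP _ x (chart_flat Ag) s1).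
exact: ideal_class_eq cE zc.
Qed.

Lemma lin_fixed w v u : W w -> in_chamber L v ->
  (forall y, enorm y = 1 -> cell L v y -> lin w y = y) -> lin w u = u.
Proof.
move=> Ww Cv fix_.
have fixv z : cell L v z -> lin w z = z.
  move=> vz; have z0 := chamber_neq0 (L_cell_chamber Cv vz) L0.
  have [z1 zz1] := unit_in_cell z0.
  have := fix_ _ z1 (cell_trans vz zz1); rewrite (W_linZ _ _ Ww) => /scalerI; apply.
  by rewrite invr_eq0 enorm_eq0.
have [e e0 near] := near_direction arr Cv0 Cv; pose t := e / (2 * (enorm u + 1)).
have u0 := enorm_ge0 u; have t0 : 0 < t by rewrite divr_gt0// mulr_gt0// ltr_wpDl.
have vt : cell L v (v + t *: u).
  apply: near; rewrite addrAC subrr add0r enormZ gtr0_norm// /t mulrAC ltr_pdivrMr ?mulr_gt0 ?ltr_wpDl//.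
  rewrite ltr_pM2l//; lra.
have := fixv _ vt; rewrite (W_linD _ _ Ww) (fixv v (cell_refl _ _)) => /addrI.
by rewrite (W_linZ _ _ Ww) => /scalerI; apply; rewrite lt0r_neq0.
Qed.

(** Agreement at infinity determines a chart on a sector only up to an element with trivial linear
    part, that is, a translation. *)
Lemma retraction_match f g v : A f -> A g -> in_chamber L v ->
  (forall y zeta, cell L v y -> chart_end f y zeta <-> chart_end g y zeta) ->
  exists w a, [/\ W w, forall u, lin w u = u & sector_eq f (g \o w) a v].
Proof.
move=> Af Ag Cv fg; have v0' := chamber_neq0 Cv L0.
have vfg : ideal_cell M f v = ideal_cell M g v.
  by apply/seteqP; split => zeta [y vy fy]; exists y => //; apply/fg.
have [w [a [Ww _ m]]] := common_cell Af Ag v0' Cv Cv vfg.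
exists w, a; split => // u; apply: (lin_fixed u Ww Cv) => y y1 vy.
have [zeta fy] := chart_end_ex Af y1.
apply: (chart_end_uniq (chart_flat Ag) (_ : chart_end g _ zeta)); last exact/fg.
exact/(match_end zeta Af Ag Ww m vy.1).
Qed.

(** A chart through [cm] and [xi], compared with a chart of the apartment adjusted by the Weyl
    group, shows that the default value of [retraction] is never taken. *)
Lemma retractionP (ap : set X) cm xi k d : ideal_chamber M A cm -> apartment A ap ->
  cm `<=` boundary ap -> A k -> chart_end k d xi ->
  exists f g v u,
    [/\ [/\ A f, A g & ap = range g], in_chamber L v, cm = ideal_cell M f v,
        forall y zeta, cell L v y -> (chart_end f y zeta <-> chart_end g y zeta)
      & chart_end f u xi /\ chart_end g u (retraction M A ap cm xi)].
Proof.
move=> + + + Ak kd; rewrite /retraction; case: xgetP => [x _ //|none].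
move=> [g0 [v [Ag0 Cv cmE]]] [g1 Ag1 apE] cmb; exfalso.
have [y1 vy] := unit_in_cell (chamber_neq0 Cv L0); set y := _ *: v in y1 vy.
have Cy := L_cell_chamber Cv vy; have [zeta gz] := chart_end_ex Ag0 y1.
have [|y' gz'] := boundary_end (zeta := zeta) Ag1.
  by rewrite -apE; apply: cmb; rewrite cmE; exists y.
have [w1 Ww1 w1y] := same_type Ag0 Ag1 gz gz'.
have Cy' : in_chamber L y' by rewrite -w1y; apply/(lin_chamber arr _ Ww1).
have [w [b [Ww wy m]]] := common_chamber Ag0 Ag1 Cy Cy' gz gz'.
have Ag := chart_comp Ag1 Ww.
have [f [u [_ [Af cf _ _ fu]]]] := centered_end Ag0 Cy Ak kd.
have cg : centered g0 y (g1 \o w) by exists b => z yz; rewrite m.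
have [a fg] := centered_match Cy cf cg.
have [u1 _] := fu; have [eta ge] := chart_end_ex Ag u1.
apply: (none eta); exists f, (g1 \o w), y, u; split => //.
- split => //; rewrite apE; have [w' [_ ww' w'w]] := W_inv arr Ww.
  apply/seteqP; split => _ [x _ <-]; last by exists (w x).
  by exists (w' x) => //=; rewrite w'w.
- case: cf => c fc; rewrite cmE (ideal_cell_eq g0 vy).
  by rewrite (sector_cell Af Ag0 fc (@in_closed_cell_refl _ _ L y)).
- by move=> x zeta' yx; exact: (sector_end zeta' Af Ag fg yx.1).
Qed.

Variable gamma : automorphism M A.
Notation lam := (translation_length gamma).
Hypothesis lam0 : 0 < lam.

Lemma aut_inv_isometric : isometric (aut_inv gamma).
Proof. by move=> x y; rewrite -(aut_isometric gamma) !aut_invK. Qed.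

Lemma aut_boundary_class xi (c : R -> X) k : ideal_class xi c ->
  ideal_class (iter k (aut_boundary gamma) xi) (fun t => iter k gamma (c t)).
Proof. by move=> xc; elim: k => //= k IH; exact: (ideal_map_class (aut_isometric gamma) IH). Qed.

Lemma aut_boundary_ray xi k : (forall p, exists2 c, ideal_class xi c & c 0 = p) ->
  forall p, exists2 c, ideal_class (iter k (aut_boundary gamma) xi) c & c 0 = p.
Proof.
move=> xir p; have [c xc c0] := xir (iter k (aut_inv gamma) p).
exists (fun t => iter k gamma (c t)); first exact: aut_boundary_class.
by rewrite c0; elim: k p {xc c0} => [|k IH] p //; rewrite iterS iterSr IH aut_invK.
Qed.

(** Along a ray in [Min] the displacement is constant, so the ray and its image are asymptotic. *)
Lemma boundary_min_fixed zeta k : boundary (Min gamma) zeta -> iter k (aut_boundary gamma) zeta = zeta.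
Proof.
move=> [c zc Mc]; elim: k => //= k ->.
apply: (ideal_eq (ideal_map_class (aut_isometric gamma) zc)).
apply: (asymptotic_ideal zc); first by move=> s t s0 t0 /=; rewrite (aut_isometric gamma) (ideal_ray zc).
by exists lam => t t0 /=; rewrite Mc.
Qed.

Variables (lp lm : R -> X) (xip xim : ideal_point X).
Hypotheses (xlp : ideal_class xip lp) (xlm : ideal_class xim lm).
Hypothesis orbp : forall k, iter k gamma (lp 0) = lp (k%:R * lam).
Hypothesis orbm : forall k, iter k (aut_inv gamma) (lm 0) = lm (k%:R * lam).

Lemma min_inv p : Min gamma p -> mdist p (aut_inv gamma p) = lam.
Proof. by move=> <-; rewrite -(aut_isometric gamma) aut_invK metric_sym. Qed.

Lemma min_orbit g P s k : A g -> Min gamma (g P) -> chart_end g s xip ->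
  iter k gamma (g P) = g (P + (k%:R * lam) *: s).
Proof.
move=> Ag Mp gs; have [s1 _] := gs; have gr := (chart_endP _ P (chart_flat Ag) s1).1 gs.
apply: (orbit_ray k (aut_isometric gamma) lam0 (ideal_ray xlp) orbp Mp (ideal_ray gr)).
  by rewrite scale0r addr0.
exact: ideal_asymptotic gr xlp.
Qed.

Lemma min_orbit_inv g P s k : A g -> Min gamma (g P) -> chart_end g s xim ->
  iter k (aut_inv gamma) (g P) = g (P + (k%:R * lam) *: s).
Proof.
move=> Ag Mp gs; have [s1 _] := gs; have gr := (chart_endP _ P (chart_flat Ag) s1).1 gs.
apply: (orbit_ray k aut_inv_isometric lam0 (ideal_ray xlm) orbm (min_inv Mp) (ideal_ray gr)).
  by rewrite scale0r addr0.
exact: ideal_asymptotic gr xlm.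
Qed.

(** The points [g P] and its second iterate are at distance twice the translation length, hence so
    are its backward and forward images; the two unit directions are then at distance [2]. *)
Lemma opposite_ends g P s s' : A g -> Min gamma (g P) -> chart_end g s xip -> chart_end g s' xim ->
  s = - s'.
Proof.
move=> Ag Mp gs gs'; have [s1 _] := gs; have [s1' _] := gs'.
have := orbit_displacement 2 (aut_isometric gamma) lam0 (ideal_ray xlp) orbp Mp.
have -> : mdist (g P) (iter 2 gamma (g P)) =
    mdist (iter 1 (aut_inv gamma) (g P)) (iter 1 gamma (g P)).
  by rewrite /= -[RHS](aut_isometric gamma) aut_invK.
rewrite (min_orbit 1 Ag Mp gs) (min_orbit_inv 1 Ag Mp gs') chart_isom//.
rewrite opprD addrACA subrr add0r -scalerBr enormZ mul1r gtr0_norm// mulrC.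
move=> /(mulIf (lt0r_neq0 lam0)) E2.
apply/eqP; rewrite -subr_eq0 opprK -dot_eq0.
have := sqr_enorm (s' - s); have := sqr_enorm s; have := sqr_enorm s'.
rewrite E2 s1 s1' !dotBl !dotBr !dotDl !dotDr (dotC s' s) => h1 h2 h3; apply/eqP.
lra.
Qed.

(* The points of the chamber [cm] at infinity are fixed by [gamma], hence it
   acts on a sector of [g] towards [cm] based in [Min gamma] by translation. *)
Lemma sector_orbit g P v s y k : A g -> Min gamma (g P) -> chart_end g s xip ->
  in_chamber L v -> ideal_cell M g v `<=` boundary (Min gamma) -> cell L v y ->
  iter k gamma (g (P + y)) = g (P + (k%:R * lam) *: s + y).
Proof.
move=> Ag Mp gs Cv vM vy; have y0 : y != 0 := chamber_neq0 (L_cell_chamber Cv vy) L0.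
have [y1 yy1] := unit_in_cell y0; have [zeta gz] := chart_end_ex Ag y1.
set y' := _ *: y in y1 yy1 gz.
have fix_ := boundary_min_fixed k (vM zeta (ex_intro2 _ _ _ (cell_trans vy yy1) gz)).
have r1 : ideal_class zeta (fun t => iter k gamma (g (P + t *: y'))).
  rewrite -fix_; apply: aut_boundary_class; exact: (chart_endP _ P (chart_flat Ag) y1).1 gz.
have r2 := (chart_endP _ (P + (k%:R * lam) *: s) (chart_flat Ag) y1).1 gz.
have -> : y = enorm y *: y' by rewrite /y' scalerA mulfV ?scale1r// enorm_eq0.
apply: (asymptotic_eq (ideal_ray r1) (ideal_ray r2) _ (ideal_asymptotic r1 r2)).
  by rewrite !scale0r !addr0 (min_orbit _ Ag Mp gs).
exact: enorm_ge0.
Qed.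

Lemma attraction f g a v u s s' xi eta : A f -> A g -> in_chamber L v -> sector_eq f g a v ->
  ideal_cell M g v `<=` boundary (Min gamma) -> chart_end g s xip -> chart_end g s' xim ->
  in_closed_cell L v s' ->
  (forall al, L (hyperplane al 0) -> dot al s' = 0 -> 0 < dot al v -> 0 <= dot al u) ->
  chart_end f u xi -> chart_end g u eta ->
  ray_limit (fun k => iter k (aut_boundary gamma) xi) eta.
Proof.
move=> Af Ag Cv fg vM gs gs' vs pos fu gu; have [u1 _] := fu.
have [P [aP Mp]] := min_sector a Ag Cv erefl vM.
have sE := opposite_ends Ag Mp gs gs'.
exists (fun t => g (P + v + t *: u)).
  exact: (chart_endP _ (P + v) (chart_flat Ag) u1).1 gu.
move=> T; have [N NP] := cone_translate T Cv lam0 vs pos; exists N => k Nk.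
(* The starting point is pushed towards the repelling end by exactly the amount that the [k]-th
   iterate takes back; the summand [v] keeps the points in the open sector, where [sector_orbit]
   applies. *)
exists (fun t => iter k gamma (f (P + v + (k%:R * lam) *: s' + t *: u))).
  by apply: aut_boundary_class; exact: (chart_endP _ _ (chart_flat Af) u1).1 fu.
move=> t t0 tT; have vy := NP k t Nk t0 tT; set z := _ *: s' + _ in vy.
have vvy : cell L v (v + z) by apply: cell_add => //; exact: cell_refl.
have -> : f (P + v + (k%:R * lam) *: s' + t *: u) = g (P + (v + z)).
  have -> : P + v + (k%:R * lam) *: s' + t *: u = a + ((P - a) + (v + z)).
    by rewrite /z; apply/rowP => i; rewrite !mxE; ring.
  rewrite fg; last by apply: cone_add => //; exact: vvy.1.
  by congr g; apply/rowP => i; rewrite !mxE; ring.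
rewrite (sector_orbit k Ag Mp gs Cv vM vvy); congr g; rewrite sE /z.
by apply/rowP => i; rewrite !mxE; ring.
Qed.

End Attraction.

End Building.

Theorem proposition3p24 (R : realType) (n : nat) (X : metricType R)
  (M : set (set 'rV[R]_n)) (A : set ('rV[R]_n -> X))
  (v0 : 'rV[R]_n) (I J : set (set 'rV[R]_n))
  (gamma : automorphism M A)
  (xip xim xi : ideal_point X)
  (sigmap sigmam beta : set (ideal_point X))
  (hn : (0 < n)%N)
  (hDelta : euclidean_building M A)
  (hthick : thick M A)
  (hfin : locally_finite_building M A)
  (hv0 : in_chamber (linear_walls M) v0)
  (hirr : irreducible_system (chamber_walls (linear_walls M) v0))
  (hI : I `<` chamber_walls (linear_walls M) v0)
  (htype : type_preserving gamma)
  (hreg : strongly_regular M A v0 I gamma)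
  (hxip : attracting gamma xip) (hxim : repelling gamma xim)
  (hsigmap : ideal_simplex M A sigmap /\ sigmap xip)
  (hsigmam : ideal_simplex M A sigmam /\ sigmam xim)
  (hxi : ~ boundary (Min gamma) xi)
  (hbeta : ideal_simplex M A beta /\ beta xi)
  (hJ : has_type M A v0 J beta)
  (hproj : exists2 cm,
     projection M A (residue M A sigmam) (residue M A beta) cm &
     cm `<=` boundary (Min gamma)) :
  exists2 eta : ideal_point X,
    ideal_cvg (fun k => iter k (aut_boundary gamma) xi) eta &
    forall (cm : set (ideal_point X)) (a : set X),
      projection M A (residue M A sigmam) (residue M A beta) cm ->
      cm `<=` boundary (Min gamma) ->
      apartment A a ->
      cm `|` sigmap `<=` boundary a ->
      retraction M A a cm xi = eta.
Proof.
have [arr atl cpl] := hDelta.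
(* Since [I] is a proper subset, the model chamber has a wall. *)
have L0 : exists u, linear_walls M (hyperplane u 0).
  have [_ /nonsubset[H [[LH _] _]]] := hI.
  by have [u [_ _ Lu]] := L_rep arr LH; exists u.
have [[lam0 _] _ [l [bp [bm [[liso lgam] _ _ _ _]]]]] := hreg.
set lam := translation_length gamma in lam0 lgam.
have simplex_end b zeta : ideal_simplex M A b /\ b zeta ->
    exists k d, A k /\ chart_end k d zeta.
  by move=> [[k [d [Ak _ ->]]] [y _ ky]]; exists k, y.
have rl : ray l by move=> s t _ _; exact: liso.
have orbp k : iter k gamma (l 0) = l (k%:R * lam).
  by elim: k => [|k IH]; rewrite ?mul0r//= IH lgam -natr1 mulrDl mul1r.
have xlp : ideal_class xip l.
  have [k [d [Ak kd]]] := simplex_end _ _ hsigmap.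
  have [c xc c0] := ray_to arr atl hv0 cpl (l 0) Ak kd.
  exact: (axis_end arr atl hv0 lam0 rl orbp (hxip _) xc c0).
pose lm t := l (- t).
have rlm : ray lm by move=> s t _ _; rewrite liso opprK addrC distrC.
have orbm k : iter k (aut_inv gamma) (lm 0) = lm (k%:R * lam).
  elim: k => [|k IH]; rewrite ?mul0r//= IH.
  apply: (can_inj (autK gamma)); rewrite aut_invK /lm lgam -natr1; congr l; ring.
have xlm : ideal_class xim lm.
  have [k [d [Ak kd]]] := simplex_end _ _ hsigmam.
  have [c xc c0] := ray_to arr atl hv0 cpl (lm 0) Ak kd.
  exact: (axis_end arr atl hv0 lam0 rlm orbm (hxim _) xc c0).
have [kx [dx [Akx kdx]]] := simplex_end _ _ hbeta.
have [hb bxi] := hbeta; have [hm smxim] := hsigmam.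
pose xis k := iter k (aut_boundary gamma) xi.
(* Stated for an arbitrary admissible chamber and pair of charts: one instance yields the limit, the
   others identify it with each value of the retraction. *)
have limit cm f g a v u s eta :
    projection M A (residue M A sigmam) (residue M A beta) cm ->
    cm `<=` boundary (Min gamma) -> A f -> A g -> in_chamber (linear_walls M) v ->
    cm = ideal_cell M f v -> sector_eq M f g a v -> chart_end g s xip ->
    chart_end f u xi -> chart_end g u eta -> ray_limit xis eta.
  move=> [c bc proj] cmM Af Ag Cv cmE fg gs fu gu.
  have [s' [fs' vs' pos]] := projection_positive arr atl hv0 cpl L0 Af Cv cmE smxim bxi bc proj fu.
  have gs' := (sector_end atl xim Af Ag fg vs').1 fs'.
  apply: (attraction arr atl hv0 cpl L0 lam0 xlp xlm orbp orbm Af Ag Cv fg _ gs gs' vs' pos fu gu).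
  by rewrite -(sector_cell arr atl Af Ag fg (@in_closed_cell_refl _ _ (linear_walls M) v)) -cmE.
have [eta etaP] : exists eta, ray_limit xis eta.
  have [cm cmP cmM] := hproj; have [c bc proj] := cmP.
  have [[[g0 [v [Ag0 Cv cmE]]] _] _] := proj.
  have [kp [dp [Akp kdp]]] := simplex_end _ _ hsigmap.
  have [f [u [_ [Af cf _ _ fu]]]] := centered_end arr atl hv0 cpl Ag0 Cv Akx kdx.
  have [g [s [_ [Ag cg _ _ gs]]]] := centered_end arr atl hv0 cpl Ag0 Cv Akp kdp.
  have [a fg] := centered_match arr hv0 Cv cf cg.
  have [u1 _] := fu; have [eta ge] := chart_end_ex atl Ag u1.
  exists eta; apply: (limit cm f g a v u s eta) => //.
  case: cf => b fb; rewrite cmE.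
  by rewrite (sector_cell arr atl Af Ag0 fb (@in_closed_cell_refl _ _ (linear_walls M) v)).
exists eta.
  apply: (ray_limit_cvg arr atl hv0 _ etaP) => k; apply: (aut_boundary_ray gamma k) => p.
  exact: (ray_to arr atl hv0 cpl p Akx kdx).
move=> cm a cmP cmM aA sub; have [c _ [[cmC _] _]] := cmP.
have cmb : cm `<=` boundary a by move=> zeta cz; apply: sub; left.
have [f [g [v [u [[Af Ag aE] Cv cmE fg [fu gu]]]]]] := retractionP arr atl hv0 cpl L0 cmC aA cmb Akx kdx.
(* As [w] is a translation, replacing [g] by [g \o w] turns agreement at infinity into agreement on
   a sector without changing any direction. *)
have [w [b [Ww wid sfg]]] := retraction_match arr atl hv0 cpl L0 Af Ag Cv fg.
have [|s gs] := boundary_end (zeta := xip) atl Ag.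
  by rewrite -aE; apply: sub; right; exact: hsigmap.2.
apply: (ray_limit_uniq arr atl hv0 _ etaP).
apply: (limit cm f (g \o w) b v u s) => //.
- exact: (chart_comp atl Ag Ww).
- by apply/(comp_end atl _ _ Ag Ww); rewrite wid.
- by apply/(comp_end atl _ _ Ag Ww); rewrite wid.
Qed.
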